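(* Let $\mathcal Y$ be a finite set, let the local randomizers $W^{(n)}$ be in the two-dominant sparse-error critical regime with dominant pairs $D_0,D_1$, parameters $p_0,p_1\in(0,1)$ and intensities $\alpha_b(y)$, and assume $D_0\cap D_1=\varnothing$. Let $k_n\in\{0,\dots,n-1\}$ with $\pi_n:=k_n/n\to\pi\in[0,1]$. Define the operator $$\Sigma:=(1-\pi)p_0(1-p_0)\,g_0g_0^{\top}+\pi p_1(1-p_1)\,g_1g_1^{\top}\quad\text{on }M,$$ for $b\in\{0,1\}$ and $y\notin D_b$ the jump vector $j_{b,y}:=\Pi_J(e_y-\mu_b)\in M^\perp$, and the finite measure on $M^\perp$ $$\nu:=\sum_{y\notin D_0}(1-\pi)\alpha_0(y)\,\delta_{j_{0,y}}+\sum_{y\notin D_1}\pi\alpha_1(y)\,\delta_{j_{1,y}}.$$ Let $G\sim N(0,\Sigma)$ and let $J$ be an independent compound-Poisson random vector with Lévy measure $\nu$, equivalently $$J\overset{d}{=}\sum_{y\notin D_0}U_y\,j_{0,y}+\sum_{y\notin D_1}V_y\,j_{1,y}$$ with all $U_y\sim\mathrm{Poi}((1-\pi)\alpha_0(y))$, $V_y\sim\mathrm{Poi}(\pi\alpha_1(y))$ independent. Set $\Delta:=\Pi_J(\mu_1-\mu_0)\in M^\perp$. Let $P_n$ be the law of $S_n$ under $T_{n,k_n}$ and $Q_n$ the law of the same statistic $S_n$ (with the same centering) under $T_{n,k_n+1}$. Then, weakly as $n\to\infty$, $$P_n\Longrightarrow P_\infty:=\mathcal L(G,J),\qquad Q_n\Longrightarrow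 Q_\infty:=\mathcal L(G,J+\Delta).$$ Equivalently, the characteristic functions converge to those of the limits, where for $u\in M$, $v\in M^\perp$, $$\mathbb E\exp\bigl(i\langle u,G\rangle+i\langle v,J\rangle\bigr)=\exp\Bigl(-\tfrac12\langle u,\Sigma u\rangle+\int_{M^\perp}(e^{i\langle v,z\rangle}-1)\,\nu(dz)\Bigr),$$ and under the neighboring alternative the limiting characteristic function is this one multiplied by $e^{i\langle v,\Delta\rangle}$. In particular, the limiting normalized experiment factors into a Gaussian component on $M$ and an independent compound-Poisson component on $M^\perp$.
   Context: For each $n$, $W^{(n)}$ consists of two probability vectors $W_0^{(n)},W_1^{(n)}$ on $\mathcal Y$. Under $T_{n,k}$ there are $n-k$ users with input $0$ and $k$ users with input $1$; each user with input $b$ independently outputs a message from $W_b^{(n)}$, and $N(y)$ is the number of messages equal to $y$. $N=(N(y))_{y\in\mathcal Y}$ is the released histogram. Two-dominant sparse-error critical regime: for each $b\in\{0,1\}$ there are a pair $D_b=\{y_{ba},y_{bb}\}\subseteq\mathcal Y$ with $y_{ba}\ne y_{bb}$ and $p_b\in(0,1)$ such that $W_b^{(n)}(y_{ba})=p_b+O(n^{-1})$, $W_b^{(n)}(y_{bb})=1-p_b+O(n^{-1})$, and $nW_b^{(n)}(y)\to\alpha_b(y)\in[0,\infty)$ for every $y\notin D_b$. (In $y_{ba}$ and $y_{bb}$ the first subscript is the input $b$ and the second subscript is a label a or b for the two elements of the pair.) With $e_y$ the standard basis of $\mathbb R^{\mathcal Y}$: $\mu_b:=p_be_{y_{ba}}+(1-p_b)e_{y_{bb}}$,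 $g_b:=e_{y_{ba}}-e_{y_{bb}}$, $M:=\mathrm{span}\{g_0,g_1\}$, $\Pi_G$ is the orthogonal projection onto $M$ and $\Pi_J:=I-\Pi_G$ the orthogonal projection onto $M^\perp$. Define $$\widehat H_{n,k_n}:=N-(n-k_n)\mu_0-k_n\mu_1,\qquad S_n:=\bigl(n^{-1/2}\Pi_G\widehat H_{n,k_n},\ \Pi_J\widehat H_{n,k_n}\bigr)\in M\times M^\perp,$$ where $N$ is the released histogram under the dataset considered ($T_{n,k_n}$ or $T_{n,k_n+1}$), and the same centering $(n-k_n)\mu_0+k_n\mu_1$ is used in both cases. In the definition of $\nu$, $\delta_z$ denotes the Dirac mass at $z$; $\mathrm{Poi}(0)$ is the point mass at $0$. *)

(* Defs.v *)
From HB Require Import structures.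
From mathcomp Require Import all_boot all_order all_algebra.
From mathcomp Require Import all_classical all_reals all_analysis.
From mathcomp Require Import complex.

Set Implicit Arguments.
Unset Strict Implicit.
Unset Printing Implicit Defensive.

Import Order.TTheory GRing.Theory Num.Theory.
Import numFieldNormedType.Exports.

Local Open Scope classical_set_scope.
Local Open Scope ring_scope.

Definition borel (T : ptopologicalType) := g_sigma_algebraType (@open T).
HB.instance Definition _ (T : ptopologicalType) := Measurable.on (borel T).

Lemma continuous_borel_measurable (T1 T2 : ptopologicalType) (f : T1 -> T2) :
  continuous f -> measurable_fun setT (f : borel T1 -> borel T2).
Proof.
move=> /continuousP cf; apply: (@measurability _ _ (borel T1) (borel T2) setT f (@open T2)) => //.
move=> _ [B oB <-]; rewrite setTI; apply: sub_sigma_algebra; exact: cf.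
Qed.

Section dirac_sum.
Context d (T : measurableType d) (R : realType) (I : finType) (Q : pred I).
Context (c : I -> {nonneg R}) (z : I -> T).
Local Open Scope ereal_scope.

Definition dirac_sum (A : set T) : \bar R :=
  \sum_(i | Q i) mscale (c i) (dirac (z i)) A.

Let dirac_sum0 : dirac_sum set0 = 0.
Proof. by rewrite /dirac_sum big1. Qed.

Let dirac_sum_ge0 A : 0 <= dirac_sum A.
Proof. by apply: sume_ge0. Qed.

Let dirac_sum_sigma_additive : semi_sigma_additive dirac_sum.
Proof.
move=> F mF tF mUF; rewrite [X in _ --> X](_ : _ =
    lim ((fun n => \sum_(0 <= i < n) dirac_sum (F i)) @ \oo)).
  by apply: is_cvg_ereal_nneg_natsum => k _; exact: sume_ge0.
rewrite nneseries_sum//; apply: eq_bigr => /= i _.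
exact: measure_semi_bigcup.
Qed.

HB.instance Definition _ := isMeasure.Build _ _ _ dirac_sum
  dirac_sum0 dirac_sum_ge0 dirac_sum_sigma_additive.

End dirac_sum.

Section random_vectors.
Context d (T : measurableType d) (R : realType).

Definition rv_pair d1 d2 (T1 : measurableType d1) (T2 : measurableType d2)
  (X : {mfun T >-> T1}) (Y : {mfun T >-> T2}) (w : T) : T1 * T2 := (X w, Y w).

HB.instance Definition _ d1 d2 (T1 : measurableType d1)
    (T2 : measurableType d2) (X : {mfun T >-> T1}) (Y : {mfun T >-> T2}) :=
  isMeasurableFun.Build _ _ _ _ (rv_pair X Y)
    (measurable_fun_pair (@measurable_funPT _ _ _ _ X)
      (@measurable_funPT _ _ _ _ Y)).

Definition rv_shift n (X : {mfun T >-> borel 'rV[R]_n}) (a : 'rV[R]_n) (w : T)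
  : borel 'rV[R]_n := (X w : 'rV[R]_n) + a.

Let measurable_rv_shift n (X : {mfun T >-> borel 'rV[R]_n}) a :
  measurable_fun setT (rv_shift X a).
Proof.
have cf : continuous (fun x : 'rV[R]_n => x + a).
  by move=> x; exact: (cvgD cvg_id (cvg_cst a)).
exact: (measurableT_comp (continuous_borel_measurable cf) (measurable_funPT X)).
Qed.

HB.instance Definition _ n (X : {mfun T >-> borel 'rV[R]_n}) a :=
  isMeasurableFun.Build _ _ _ _ (rv_shift X a) (@measurable_rv_shift n X a).

End random_vectors.

Section independence.
Context d (T : measurableType d) (R : realType) (P : probability T R).
Local Open Scope ereal_scope.

Definition independent_rv d1 d2 (T1 : measurableType d1)
    (T2 : measurableType d2) (X : T -> T1) (Y : T -> T2) :=
  forall A B, measurable A -> measurable B ->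
    P (X @^-1` A `&` Y @^-1` B) = P (X @^-1` A) * P (Y @^-1` B).

(* Mutual independence of the subfamily of X indexed by Q. *)
Definition mutually_independent_rv (I : finType) (Q : pred I) d'
    (T' : measurableType d') (X : I -> T -> T') :=
  forall (K : {set I}) (A : I -> set T'),
    (forall i, i \in K -> Q i) -> (forall i, measurable (A i)) ->
    P [set w | forall i, i \in K -> A i (X i w)] =
      \prod_(i in K) P (X i @^-1` A i).

End independence.

Section complex_valued.
Context {R : realType}.

Definition cexp (z : R[i]) : R[i] :=
  (expR (complex.Re z) * cos (complex.Im z) +i* (expR (complex.Re z) * sin (complex.Im z)))%C.

(* exp (i t) *)
Definition expi (t : R) : R[i] := cexp (0 +i* t)%C.

Definition cintegral d (T : measurableType d) (m : {measure set T -> \bar R})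
    (f : T -> R[i]) : R[i] :=
  ((\int[m]_x complex.Re (f x)) +i* (\int[m]_x complex.Im (f x)))%C.

End complex_valued.

Section euclidean.
Context {R : realType} {n : nat}.
Local Notation V := 'rV[R]_n.

Definition dot (u v : V) : R := \sum_j u 0 j * v 0 j.

(* Vectors are rows, so that a subspace is a matrix up to its row space
   and linear maps act on the right. *)
Definition orthocomp (M : 'M[R]_n) : 'M[R]_n := kermx M^T.

Definition orthoproj (M : 'M[R]_n) : 'M[R]_n := proj_mx M (orthocomp M).

Definition subspace_set (M : 'M[R]_n) : set (borel V) := [set v | (v <= M)%MS].

(* The one-dimensional law N(m, v) with variance v >= 0; the library's
   [normal_prob] takes a standard deviation, and is not a point mass when the
   latter is 0. *)
Definition normal_law (m v : R) : set R -> \bar R :=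
  if v == 0 then dirac m else normal_prob m (Num.sqrt v).

Definition gaussian_law (m : V) (Sigma : 'M[R]_n)
    (gamma : set (borel V) -> \bar R) :=
  forall (u : V) (A : set R), measurable A ->
    gamma (dot u @^-1` A) = normal_law (dot u m) (dot (u *m Sigma) u) A.

Definition convolution (m1 m2 : set (borel V) -> \bar R) (A : set (borel V))
  : \bar R := (\int[m1]_x m2 [set y : V | A ((x : V) + y)%R])%E.

Definition convolution_power (m : set (borel V) -> \bar R) (k : nat)
  : set (borel V) -> \bar R := iter k (convolution m) (dirac ((0 : V) : borel V)).

(* exp (- nu V) * sum_k nu^{*k} / k!, for a finite measure nu. *)
Definition compound_poisson (nu : set (borel V) -> \bar R) (A : set (borel V))
  : \bar R :=
  ((expR (- fine (nu setT)))%:E *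
   \sum_(k <oo) (k`!%:R^-1)%:E * convolution_power nu k A)%E.

(* Laws on V x V are carried by the product of the Borel sigma-algebras, which
   is the Borel sigma-algebra of V x V. *)
Local Notation V2 := (borel V * borel V)%type.

Definition weak_cvg (mu : nat -> {measure set V2 -> \bar R})
    (mu_oo : {measure set V2 -> \bar R}) :=
  forall f : V * V -> R, continuous f ->
    (exists B, forall x, `|f x| <= B) ->
    \int[mu k]_x f x @[k --> \oo] --> \int[mu_oo]_x f x.

Definition charfun (m : {measure set V2 -> \bar R}) (u v : V) : R[i]^o :=
  cintegral m (fun x => expi (dot u x.1 + dot v x.2)).

End euclidean.

Section local_randomizers.
Context {R : realType} {Y : finType}.
(* Inputs 0 and 1 are false and true; ya b, yb b are the dominant outputs
   under input b. *)
Context (ya yb : bool -> Y) (p : bool -> R) (alpha : bool -> Y -> {nonneg R}).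
Local Notation V := 'rV[R]_#|Y|.

Definition dominant (b : bool) : {set Y} := [set ya b; yb b]%SET.

Definition two_dominant_critical (W : nat -> bool -> Y -> {nonneg R}) :=
  forall b : bool,
  [/\ ya b != yb b, 0 < p b < 1,
      ((fun n => (W n b (ya b))%:num - p b) : nat -> R^o) =O_\oo
        ((fun n => n%:R^-1) : nat -> R^o),
      ((fun n => (W n b (yb b))%:num - (1 - p b)) : nat -> R^o) =O_\oo
        ((fun n => n%:R^-1) : nat -> R^o) &
      forall y, y \notin dominant b ->
        n%:R * (W n b y)%:num @[n --> \oo] --> (alpha b y)%:num].

Definition ebasis (y : Y) : V := delta_mx 0 (enum_rank y).

Definition mean (b : bool) : V :=
  p b *: ebasis (ya b) + (1 - p b) *: ebasis (yb b).

Definition gdir (b : bool) : V := ebasis (ya b) - ebasis (yb b).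

Definition Mspace : 'M[R]_#|Y| := (gdir false + gdir true)%MS.

Definition PiG : 'M[R]_#|Y| := orthoproj Mspace.

Definition PiJ : 'M[R]_#|Y| := 1%:M - PiG.

Definition jump (b : bool) (y : Y) : V := (ebasis y - mean b) *m PiJ.

Definition Delta : V := (mean true - mean false) *m PiJ.

(* Limiting proportion of users with input b, when that of input 1 is w. *)
Definition proportion (w : {i01 R}) (b : bool) : {nonneg R} :=
  if b then w%:num%:nng else (1 - w%:num)%:nng.

(* On row vectors, g g^T is the matrix g^T *m g. *)
Definition Sigma (w : {i01 R}) : 'M[R]_#|Y| :=
  \sum_(b : bool) ((proportion w b)%:num * p b * (1 - p b)) *:
    ((gdir b)^T *m gdir b).

Definition rate (w : {i01 R}) (b : bool) (y : Y) : {nonneg R} :=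
  ((proportion w b)%:num * (alpha b y)%:num)%:nng.

Definition nondominant (by_ : bool * Y) : bool := by_.2 \notin dominant by_.1.

Definition nu (w : {i01 R}) : set (borel V) -> \bar R :=
  dirac_sum nondominant (fun i => rate w i.1 i.2)
    (fun i => jump i.1 i.2 : borel V).

HB.instance Definition _ w := Measure.on (nu w).

Lemma prod_message_ge0 (W : bool -> Y -> {nonneg R}) (n k : nat)
    (x : {ffun 'I_n -> Y}) :
  0 <= \prod_(i < n) (W (i < k)%N (x i))%:num.
Proof. exact: prodr_ge0. Qed.

(* Probability of the messages x when, of the n users, the first k have input 1
   and the others input 0. *)
Definition messages_prob W n k x : {nonneg R} :=
  NngNum (@prod_message_ge0 W n k x).

Definition histogram (n : nat) (x : {ffun 'I_n -> Y}) : V :=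
  \row_j #|[set i | x i == enum_val j]%SET|%:R.

Definition Hhat (n k : nat) (x : {ffun 'I_n -> Y}) : V :=
  histogram x - (n%:R - k%:R) *: mean false - k%:R *: mean true.

Definition Sstat (n k : nat) (x : {ffun 'I_n -> Y}) : borel V * borel V :=
  ((Num.sqrt n%:R)^-1 *: (Hhat k x *m PiG), Hhat k x *m PiJ).

(* Law of S_n, centred with k users of input 1, under the dataset T_{n,l}. *)
Definition Slaw (W : bool -> Y -> {nonneg R}) (n k l : nat)
  : set (borel V * borel V)%type -> \bar R :=
  dirac_sum xpredT (messages_prob W l) (@Sstat n k).

HB.instance Definition _ W n k l := Measure.on (Slaw W n k l).

End local_randomizers.

(* Main.v *)
(* Paired with (u, v), the statistic is a sum over the users of independent
   scores, so its characteristic function is a shift times A0^(n-l) A1^l, where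
   Ab is the characteristic function of the score of one user with input b.
   A dominant message of that user moves the histogram from mean b along gdir b
   only: it is invisible on the orthocomplement of M and, scaled by n^(-1/2),
   contributes - p(1-p)<u, gdir b>^2 / (2n) at second order; any other message
   has probability ~ alpha/n and contributes alpha (exp(i<v, jump>) - 1) / n,
   its Gaussian coordinate being negligible. Hence n (Ab - 1) converges and the
   powers converge to exponentials. The second moments of the coordinates are
   bounded, which gives tightness, and weak convergence follows from Levy's
   continuity theorem: on a large box a continuous function is approximated by
   its Bernstein operator in the variables (1 + sin(x/L)) / 2, which is a
   trigonometric polynomial, bounded by the same constant off the box. *)

(* The O(1/n) error in the dominant probabilities lets them be replaced by p and 1 - p: multiplied
   by n it stays bounded, and it meets a score that tends to 0. Under the exact weights p and 1 - p
   the dominant score has mean zero, so its linear term, which would sum to order n^(1/2), cancels.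
   Both datasets are treated at once, as k + m users with input 1 where m is 0 or 1. The centering
   is then off by m (mean true - mean false); the factor n^(-1/2) kills its Gaussian part and leaves
   [Delta]. The limit is given through hypotheses on the laws of G and J, so its characteristic
   function has to be computed from the definitions: the normal one by a differential equation in t,
   the compound Poisson one by expanding convolution powers as sums over words. Grouping words by
   their letter counts yields the description by independent Poisson variables. The laws live on a
   product of Borel sigma-algebras, for which continuity does not immediately give measurability;
   the Bernstein approximation supplies it as well. *)
Require Import Defs.
From HB Require Import structures.
From mathcomp Require Import all_boot all_order all_algebra.
From mathcomp Require Import all_classical all_reals all_analysis.
From mathcomp Require Import measurable_realfun complex.
From mathcomp Require Import ring lra.

Set Implicit Arguments.
Unset Strict Implicit.
Unset Printing Implicit Defensive.

Import Order.TTheory GRing.Theory Num.Theory.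
Import numFieldNormedType.Exports.

Local Open Scope classical_set_scope.
Local Open Scope ring_scope.

(** * Complex exponentials and trigonometric asymptotics *)

Section complex_exponential.
Context {R : realType}.
Implicit Types (x y t : R) (z : R[i]).
Local Notation normc := (@Normc.normc R).
Local Notation Re := complex.Re.
Local Notation Im := complex.Im.

Lemma normc_ge0 z : 0 <= normc z.
Proof. by case: z => a b; exact: sqrtr_ge0. Qed.

Lemma normc_leD z1 z2 : normc (z1 + z2) <= normc z1 + normc z2.
Proof. exact: le_normcD. Qed.

Lemma normc_sum (I : Type) (s : seq I) (P : pred I) (F : I -> R[i]) :
  normc (\sum_(i <- s | P i) F i) <= \sum_(i <- s | P i) normc (F i).
Proof.
elim/big_rec2: _ => [|i y z _ le_zy]; first by rewrite Normc.normc0.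
exact: le_trans (normc_leD _ _) (lerD _ _).
Qed.

Lemma normcX z n : normc (z ^+ n) = normc z ^+ n.
Proof.
elim: n => [|n IHn]; first exact: Normc.normc1.
by rewrite !exprS Normc.normcM IHn.
Qed.

Lemma normc_real x : normc x%:C%C = `|x|.
Proof. by rewrite /= expr0n /= addr0 sqrtr_sqr. Qed.

Lemma ReD z1 z2 : Re (z1 + z2) = Re z1 + Re z2.
Proof. by case: z1; case: z2. Qed.

Lemma ImD z1 z2 : Im (z1 + z2) = Im z1 + Im z2.
Proof. by case: z1; case: z2. Qed.

Lemma ReM z1 z2 : Re (z1 * z2) = Re z1 * Re z2 - Im z1 * Im z2.
Proof. by case: z1; case: z2. Qed.

Lemma ImM z1 z2 : Im (z1 * z2) = Re z1 * Im z2 + Im z1 * Re z2.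
Proof. by case: z1; case: z2. Qed.

Lemma ReB z1 z2 : Re (z1 - z2) = Re z1 - Re z2.
Proof. by case: z1; case: z2. Qed.

Lemma ImB z1 z2 : Im (z1 - z2) = Im z1 - Im z2.
Proof. by case: z1; case: z2. Qed.

Lemma Re_sum (I : Type) (s : seq I) (P : pred I) (F : I -> R[i]) :
  Re (\sum_(i <- s | P i) F i) = \sum_(i <- s | P i) Re (F i).
Proof. by elim/big_rec2: _ => // i y z _ <-; rewrite ReD. Qed.

Lemma Im_sum (I : Type) (s : seq I) (P : pred I) (F : I -> R[i]) :
  Im (\sum_(i <- s | P i) F i) = \sum_(i <- s | P i) Im (F i).
Proof. by elim/big_rec2: _ => // i y z _ <-; rewrite ImD. Qed.

Lemma natrc n : (n%:R : R[i]) = (n%:R)%:C%C.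
Proof. by elim: n => // n IHn; rewrite -addn1 !natrD IHn rmorphD. Qed.

Lemma cvg_complex (T : Type) (F : set_system T) {FF : Filter F}
    (u : T -> R[i]^o) (l : R[i]^o) :
  Re (u t) @[t --> F] --> Re l -> Im (u t) @[t --> F] --> Im l ->
  u t @[t --> F] --> l.
Proof.
move=> /cvgrPdist_lt cRe /cvgrPdist_lt cIm; apply/cvgrPdist_lt => -[e e'].
(* The norm of R[i] takes values in R[i]: a positive radius has zero imaginary part, so it is a real
   number. *)
rewrite ltcE /= => /andP[/eqP -> e0].
have e20 : 0 < e / 2 by rewrite divr_gt0.
near=> t.
have re : `|Re l - Re (u t)| < e / 2 by near: t; exact: cRe.
have im : `|Im l - Im (u t)| < e / 2 by near: t; exact: cIm.
rewrite [_ - _](_ : _ = (Re l - Re (u t))%:C%C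
    + ((Im l - Im (u t))%:C%C * 'i%C)); last first.
  by case: (l) (u t) => a b [a' b'] /=; simpc.
rewrite (le_lt_trans (ler_normD _ _))// normrM.
rewrite (_ : `|'i%C| = 1 :> R[i]) ?mulr1; last first.
  by rewrite normc_def /= expr0n /= add0r expr1n sqrtr1.
rewrite !normc_def /= expr0n /= !addr0 !sqrtr_sqr -rmorphD /= ltcR.
by rewrite [e]splitr ltrD.
Unshelve. all: by end_near. Qed.

Lemma cvg_Re (T : Type) (F : set_system T) {FF : Filter F}
    (u : T -> R[i]^o) (l : R[i]^o) :
  u t @[t --> F] --> l -> Re (u t) @[t --> F] --> Re l.
Proof.
move=> /cvgrPdist_lt cu; apply/cvgrPdist_lt => e e0.
have e0' : 0 < (e%:C%C : R[i]) by rewrite ltcR.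
near=> t.
have : `|l - u t| < e%:C%C by near: t; exact: cu.
rewrite -ReB -ltcR; apply: le_lt_trans; exact: normc_ge_Re.
Unshelve. all: by end_near. Qed.

Lemma cvg_Im (T : Type) (F : set_system T) {FF : Filter F}
    (u : T -> R[i]^o) (l : R[i]^o) :
  u t @[t --> F] --> l -> Im (u t) @[t --> F] --> Im l.
Proof.
move=> /cvgrPdist_lt cu; apply/cvgrPdist_lt => e e0.
have e0' : 0 < (e%:C%C : R[i]) by rewrite ltcR.
near=> t.
have : `|l - u t| < e%:C%C by near: t; exact: cu.
(* Multiplication by i turns the imaginary part into minus a real part and preserves the norm, so
   the bound on real parts applies. *)
rewrite -ImB -ltcR; apply: le_lt_trans; rewrite -normrN -ReiNIm.
rewrite (le_trans (normc_ge_Re _))// normrM.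
by rewrite [`|'i%C|]normc_def /= expr0n /= add0r expr1n sqrtr1 mulr1.
Unshelve. all: by end_near. Qed.

(** A squeeze with a real error: the norm attached to R[i] is complex valued, so quantitative
    estimates are made with the real-valued [normc]. *)
Lemma cvg_normc0 (T : Type) (F : set_system T) {FF : Filter F}
    (u : T -> R[i]^o) (l : R[i]^o) (e : T -> R) :
  (\forall t \near F, normc (u t - l) <= e t) -> e t @[t --> F] --> 0 ->
  u t @[t --> F] --> l.
Proof.
move=> ue /cvgrPdist_lt e0; apply/cvgrPdist_lt => -[r r'].
rewrite ltcE /= => /andP[/eqP -> r0]; near=> t.
rewrite distrC -[`|_|]/((normc (u t - l))%:C%C) ltcR.
apply: (@le_lt_trans _ _ (e t)); first by near: t.
rewrite (le_lt_trans (ler_norm _))// -normrN -[- _]add0r.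
by near: t; exact: e0.
Unshelve. all: by end_near. Qed.

Lemma cvg_normc (T : Type) (F : set_system T) {FF : Filter F}
    (u : T -> R[i]^o) (l : R[i]^o) :
  u t @[t --> F] --> l -> normc (u t - l) @[t --> F] --> 0.
Proof.
move=> cu.
have /(cvg_norm (V := R[i]^o)) /cvg_Re : u t - l @[t --> F] --> (0 : R[i]^o).
  by rewrite -(subrr l); apply: cvgB => //; exact: cvg_cst.
rewrite normr0; apply: cvg_trans; apply: near_eq_cvg.
by apply: nearW => t; rewrite normc_def /=; case: (u t - l).
Qed.

Lemma cvg_mulc (T : Type) (F : set_system T) {FF : Filter F}
    (u v : T -> R[i]^o) (l m : R[i]^o) :
  u t @[t --> F] --> l -> v t @[t --> F] --> m ->
  (u t * v t : R[i]^o) @[t --> F] --> (l * m : R[i]^o).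
Proof.
move=> cu cv; have cuR := @cvg_Re _ _ FF _ _ cu; have cuI := @cvg_Im _ _ FF _ _ cu.
have cvR := @cvg_Re _ _ FF _ _ cv; have cvI := @cvg_Im _ _ FF _ _ cv.
apply: cvg_complex; rewrite ?(ReM, ImM).
  by under eq_fun do rewrite ReM; apply: cvgB; apply: cvgM.
by under eq_fun do rewrite ImM; apply: cvgD; apply: cvgM.
Qed.

Lemma cvg_addc (T : Type) (F : set_system T) {FF : Filter F}
    (u v : T -> R[i]) (l m : R[i]) :
  (u s : R[i]^o) @[s --> F] --> (l : R[i]^o) -> (v s : R[i]^o) @[s --> F] --> (m : R[i]^o) ->
  (u s + v s : R[i]^o) @[s --> F] --> (l + m : R[i]^o).
Proof.
move=> cu cv; have cuR := @cvg_Re _ _ FF _ _ cu; have cuI := @cvg_Im _ _ FF _ _ cu.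
have cvR := @cvg_Re _ _ FF _ _ cv; have cvI := @cvg_Im _ _ FF _ _ cv.
apply: cvg_complex; rewrite ?(ReD, ImD).
  by under eq_fun do rewrite ReD; apply: cvgD.
by under eq_fun do rewrite ImD; apply: cvgD.
Qed.

Lemma cvg_subc (T : Type) (F : set_system T) {FF : Filter F}
    (u v : T -> R[i]) (l m : R[i]) :
  (u s : R[i]^o) @[s --> F] --> (l : R[i]^o) -> (v s : R[i]^o) @[s --> F] --> (m : R[i]^o) ->
  (u s - v s : R[i]^o) @[s --> F] --> (l - m : R[i]^o).
Proof.
move=> cu cv; have cuR := @cvg_Re _ _ FF _ _ cu; have cuI := @cvg_Im _ _ FF _ _ cu.
have cvR := @cvg_Re _ _ FF _ _ cv; have cvI := @cvg_Im _ _ FF _ _ cv.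
apply: cvg_complex; rewrite ?(ReB, ImB).
  by under eq_fun do rewrite ReB; apply: cvgB.
by under eq_fun do rewrite ImB; apply: cvgB.
Qed.

Lemma cvg_sub0c (T : Type) (F : set_system T) {FF : Filter F}
    (u v : T -> R[i]) (l : R[i]) :
  (u s - v s : R[i]^o) @[s --> F] --> (0 : R[i]^o) ->
  (v s : R[i]^o) @[s --> F] --> (l : R[i]^o) -> (u s : R[i]^o) @[s --> F] --> (l : R[i]^o).
Proof.
move=> uv cv; rewrite -[l]add0r.
apply: cvg_trans (@cvg_addc _ _ FF _ _ _ _ uv cv); apply: near_eq_cvg.
by apply: nearW => s; rewrite subrK.
Qed.

Lemma cexpD z1 z2 : cexp (z1 + z2) = cexp z1 * cexp z2.
Proof.
case: z1 z2 => a b [a' b']; rewrite /cexp /= expRD cosD sinD; simpc.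
by congr (_ +i* _)%C; ring.
Qed.

Lemma cexp0 : cexp 0 = 1 :> R[i].
Proof. by rewrite /cexp /= expR0 cos0 sin0 mul1r mulr0. Qed.

Lemma cexpMn z n : cexp (z *+ n) = cexp z ^+ n.
Proof.
elim: n => [|n IHn]; first by rewrite mulr0n cexp0.
by rewrite mulrS exprS cexpD IHn.
Qed.

Lemma normc_cexp z : normc (cexp z) = expR (Re z).
Proof.
rewrite /cexp /= !exprMn -mulrDr cos2Dsin2 mulr1 sqrtr_sqr.
by rewrite ger0_norm ?expR_ge0.
Qed.

Lemma cvg_cexp (T : Type) (F : set_system T) {FF : Filter F}
    (u : T -> R[i]^o) (l : R[i]^o) :
  u t @[t --> F] --> l ->
  (cexp (u t) : R[i]^o) @[t --> F] --> (cexp l : R[i]^o).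
Proof.
move=> cu; have cR := @cvg_Re _ _ FF _ _ cu; have cI := @cvg_Im _ _ FF _ _ cu.
apply: cvg_complex => /=; apply: cvgM.
- by apply: (continuous_cvg _ _ cR); exact: continuous_expR.
- by apply: (continuous_cvg _ _ cI); exact: continuous_cos.
- by apply: (continuous_cvg _ _ cR); exact: continuous_expR.
- by apply: (continuous_cvg _ _ cI); exact: continuous_sin.
Qed.

Lemma expiE t : expi t = (cos t +i* sin t)%C :> R[i].
Proof. by rewrite /expi /cexp /= expR0 !mul1r. Qed.

Lemma expiD s t : expi (s + t) = expi s * expi t :> R[i].
Proof. by rewrite -cexpD; congr cexp; simpc. Qed.

Lemma expi0 : expi 0 = 1 :> R[i].
Proof. exact: cexp0. Qed.

Lemma expi_sum (I : Type) (s : seq I) (P : pred I) (F : I -> R) :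
  expi (\sum_(i <- s | P i) F i) = \prod_(i <- s | P i) expi (F i).
Proof.
by elim/big_rec2: _ => [|i y z _ <-]; [exact: expi0 | rewrite expiD].
Qed.

Lemma normc_expi t : normc (expi t) = 1.
Proof. by rewrite normc_cexp expR0. Qed.

(** Telescoping, one factor at a time. The exponent n on K, rather than n - 1, costs nothing when K
    >= 1 and avoids predecessors. *)
Lemma normc_leB_expr (A B : R[i]) (K : R) n : 1 <= K ->
  normc A <= K -> normc B <= K ->
  normc (A ^+ n - B ^+ n) <= n%:R * K ^+ n * normc (A - B).
Proof.
move=> K1 AK BK; have K0 : 0 <= K by rewrite (le_trans _ K1).
elim: n => [|n IHn]; first by rewrite !expr0 subrr Normc.normc0 mul0r mul0r.
rewrite (_ : _ - _ = A ^+ n * (A - B) + (A ^+ n - B ^+ n) * B); last first.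
  by rewrite !exprSr; ring.
rewrite (le_trans (normc_leD _ _))// !Normc.normcM normcX -natr1 mulrDl mul1r.
rewrite mulrDl addrC lerD//.
  apply: (@le_trans _ _ (n%:R * K ^+ n * normc (A - B) * K)).
    by rewrite ler_pM ?normc_ge0.
  by rewrite exprSr le_eqVlt; apply/orP; left; apply/eqP; ring.
rewrite ler_wpM2r ?normc_ge0// (@le_trans _ _ (K ^+ n))//.
  by rewrite lerXn2r ?nnegrE ?normc_ge0.
by rewrite exprS ler_peMl// exprn_ge0.
Qed.

(** The limit defining a derivative is taken over punctured neighbourhoods, hence the requirement
    that h be eventually nonzero. *)
Lemma is_derive_cvg (f : R -> R) (a l : R) (h : nat -> R) :
  is_derive a 1 f l -> h n @[n --> \oo] --> 0 -> (\forall n \near \oo, h n != 0) ->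
  (h n)^-1 * (f (a + h n) - f a) @[n --> \oo] --> l.
Proof.
move=> [df <-] h0 hN0; move/cvg_ex : df => [l' df].
have -> : 'D_1 f a = l' by apply/cvg_lim.
have /(cvg_comp _ _) : h n @[n --> \oo] --> 0^'.
  rewrite /dnbhs => A /= /h0 hA; rewrite /nbhs /= in hA *.
  by apply: filterS2 hA hN0 => n; apply.
move=> /(_ _ _ _ df); apply: cvg_trans; apply: near_eq_cvg; apply: nearW => n /=.
by congr (_ * (f _ - _)); rewrite addrC; congr (a + _); exact: mulr1.
Qed.

Lemma cvgn_inv : n%:R^-1 @[n --> \oo] --> (0 : R).
Proof. by apply/gtr0_cvgV0; [near=> n; rewrite ltr0n; near: n; exact: nbhs_infty_gt | exact: cvgr_idn].
Unshelve. all: by end_near. Qed.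

Lemma near_natr_neq0 : \forall n \near \oo, (n%:R : R) != 0.
Proof. by near=> n; rewrite pnatr_eq0 -lt0n; near: n; exact: nbhs_infty_gt.
Unshelve. all: by end_near. Qed.

(** This is the derivative at 0 of s -> cexp (s z) along s = 1/n, taken separately on real and
    imaginary parts. *)
Lemma cvg_cexp_sub1 z :
  (n%:R * (cexp ((n%:R^-1)%:C%C * z) - 1) : R[i]^o) @[n --> \oo] --> (z : R[i]^o).
Proof.
case: z => x y.
pose f s := expR (s * x) * cos (s * y); pose g s := expR (s * x) * sin (s * y).
have df : is_derive (0 : R) 1 f x.
  by apply: is_derive_eq; rewrite !mul0r expR0 sin0 cos0 /GRing.scale /=; ring.
have dg : is_derive (0 : R) 1 g y.
  by apply: is_derive_eq; rewrite !mul0r expR0 sin0 cos0 /GRing.scale /=; ring.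
have n0 : \forall n \near \oo, (n%:R^-1 : R) != 0.
  by apply: filterS near_natr_neq0 => n; rewrite invr_eq0.
apply: cvg_complex.
  have := is_derive_cvg df cvgn_inv n0; apply: cvg_trans; apply: near_eq_cvg.
  apply: nearW => n; rewrite natrc ReM /= !mul0r subr0 add0r invrK subr0.
  by rewrite /f !mul0r expR0 cos0 mulr1 addr0.
have := is_derive_cvg dg cvgn_inv n0; apply: cvg_trans; apply: near_eq_cvg.
apply: nearW => n; rewrite natrc ImM /= !mul0r subr0 add0r invrK addr0.
by rewrite /g !mul0r expR0 sin0 mulr0 subr0 addr0 oppr0 addr0.
Qed.

(** The powers of A are compared with those of exp (z / n), which are explicit; this avoids a
    complex logarithm. With K = exp (c / n) the difference is at most (r / n) exp (c r / n) times |n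
    (A - 1) - n (exp (z / n) - 1)|, whose last factor tends to |z - z|. *)
Lemma cvg_cexp_expn (A : nat -> R[i]) z (r : nat -> nat) (rho c : R) :
  (\forall n \near \oo, normc (A n) <= expR (c / n%:R)) -> 0 <= c -> Re z <= c ->
  (n%:R * (A n - 1) : R[i]^o) @[n --> \oo] --> (z : R[i]^o) ->
  (r n)%:R / n%:R @[n --> \oo] --> rho ->
  (A n ^+ r n : R[i]^o) @[n --> \oo] --> (cexp (rho%:C%C * z) : R[i]^o).
Proof.
move=> Ac c0 zc cA cr.
pose B n := cexp ((n%:R^-1)%:C%C * z).
have cB : (B n ^+ r n : R[i]^o) @[n --> \oo] --> (cexp (rho%:C%C * z) : R[i]^o).
  have : (cexp (((r n)%:R / n%:R)%:C%C * z) : R[i]^o) @[n --> \oo]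
      --> (cexp (rho%:C%C * z) : R[i]^o).
    apply: cvg_cexp; apply: cvg_mulc; last exact: cvg_cst.
    by apply: cvg_complex => //=; exact: cvg_cst.
  apply: cvg_trans; apply: near_eq_cvg; apply: nearW => n.
  by rewrite /B -cexpMn; congr cexp; rewrite -[RHS]mulr_natl natrc mulrA -rmorphM.
suff cAB : (A n ^+ r n - B n ^+ r n : R[i]^o) @[n --> \oo] --> (0 : R[i]^o).
  exact: cvg_sub0c cAB cB.
pose e n := (r n)%:R / n%:R * expR (c * ((r n)%:R / n%:R)) *
  normc (n%:R * (A n - 1) - n%:R * (B n - 1)).
apply: (@cvg_normc0 _ _ _ _ _ e).
  near=> n; rewrite subr0.
  have n0 : (0 < n)%N by near: n; exact: nbhs_infty_gt.
  have nR0 : (n%:R : R) != 0 by rewrite pnatr_eq0 -lt0n.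
  have K1 : 1 <= expR (c / n%:R) by rewrite -expR0 ler_expR divr_ge0.
  apply: (le_trans (normc_leB_expr (r n) K1 _ _)).
  - by near: n.
  - by rewrite normc_cexp ReM /= mul0r subr0 ler_expR mulrC ler_wpM2r// invr_ge0.
  rewrite /e (_ : n%:R * (A n - 1) - _ = n%:R * (A n - B n)); last by ring.
  rewrite [X in _ <= _ * X]Normc.normcM natrc normc_real ger0_norm// -expRM_natl.
  rewrite [_ * (c / _)](_ : _ = c * ((r n)%:R / n%:R)); last by field.
  by rewrite le_eqVlt; apply/orP; left; apply/eqP; field.
have -> : (0 : R) = rho * expR (c * rho) * 0 by rewrite mulr0.
apply: cvgM.
  apply: cvgM => //.
  have ccr : c * ((r n)%:R / n%:R) @[n --> \oo] --> c * rho by apply: cvgM => //; exact: cvg_cst.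
  by apply: (continuous_cvg _ _ ccr); exact: continuous_expR.
have -> : (0 : R) = normc (z - z - 0) by rewrite subrr subr0 Normc.normc0.
rewrite subrr subr0 Normc.normc0.
apply: cvg_trans (@cvg_normc _ _ eventually_filter _ _
  (@cvg_subc _ _ eventually_filter _ _ _ _ cA (@cvg_cexp_sub1 z))).
by apply: near_eq_cvg; apply: nearW => n; rewrite subrr subr0.
Unshelve. all: by end_near. Qed.

(** Here c = |z|, because |1 + z / n| <= 1 + |z| / n <= exp (|z| / n). *)
Lemma cvg_1D_expn z :
  ((1 + n%:R^-1 * z) ^+ n : R[i]^o) @[n --> \oo] --> (cexp z : R[i]^o).
Proof.
have -> : cexp z = cexp ((1 : R)%:C%C * z) by rewrite mul1r.
apply: (@cvg_cexp_expn _ z id 1 (normc z)).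
- near=> n; rewrite (le_trans (normc_leD _ _))// Normc.normc1 Normc.normcM.
  rewrite natrc -fmorphV normc_real ger0_norm ?invr_ge0// mulrC.
  exact: expR_ge1Dx.
- exact: normc_ge0.
- rewrite (le_trans (ler_norm _))//; have := normc_ge_Re z.
  by rewrite normc_def lecR; case: z.
- apply: cvg_near_cst.
  near=> n; rewrite addrAC subrr add0r mulrA divff ?mul1r//.
  by rewrite pnatr_eq0 -lt0n; near: n; exact: nbhs_infty_gt.
- apply: cvg_near_cst.
  near=> n; rewrite divff//.
  by rewrite pnatr_eq0 -lt0n; near: n; exact: nbhs_infty_gt.
Unshelve. all: by end_near. Qed.

Lemma cvg_1D_expn_real x : (1 + n%:R^-1 * x) ^+ n @[n --> \oo] --> expR x.
Proof.
have := @cvg_Re _ _ (eventually_filter) _ _ (@cvg_1D_expn x%:C%C).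
rewrite /= cos0 mulr1; apply: cvg_trans; apply: near_eq_cvg.
apply: nearW => n; rewrite natrc -fmorphV -rmorphM -[1](rmorph1 (real_complex R)).
by rewrite -rmorphD -rmorphXn.
Qed.

(* Comparing with [(1 + z / n) ^ n], whose binomial coefficients are dominated
   by those of the exponential, reduces the claim to its real instance. *)
Lemma cvg_series_cexp z :
  (\sum_(k < n.+1) (k`!%:R^-1) * z ^+ k : R[i]^o) @[n --> \oo] --> (cexp z : R[i]^o).
Proof.
pose x := normc z.
pose S (F : numFieldType) (t : F) n : F := \sum_(k < n.+1) k`!%:R^-1 * t ^+ k.
(* The gap between the coefficients of z^k in the exponential series and in (1 + z / n)^n. It is
   nonnegative because n (n - 1) ... (n - k + 1) <= n^k, so it is its own norm. *)
pose d n k : R := k`!%:R^-1 - 'C(n, k)%:R * n%:R^-1 ^+ k.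
have d0 n k : (0 < n)%N -> 0 <= d n k.
  move=> n0; rewrite subr_ge0 exprVn ler_pdivrMr ?exprn_gt0 ?ltr0n//.
  rewrite mulrC ler_pdivlMr ?ltr0n ?fact_gt0// -natrM -natrX ler_nat bin_ffact.
  by rewrite ffact_prod -[in leqRHS](card_ord k) -prod_nat_const leq_prod// => i _; exact: leq_subr.
(* The morphism f lets one expansion serve the complex sum at z and the real sum at |z|. *)
have SB (F : numFieldType) (f : {rmorphism R -> F}) (t : F) n :
    S F t n - (1 + n%:R^-1 * t) ^+ n = \sum_(k < n.+1) f (d n k) * t ^+ k.
  rewrite /S exprDn -sumrB; apply: eq_bigr => k _.
  rewrite expr1n mul1r rmorphB rmorphM rmorphXn !fmorphV !rmorph_nat.
  by rewrite exprMn -mulr_natl; ring.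
suff cS : (S R[i] z n - (1 + n%:R^-1 * z) ^+ n : R[i]^o) @[n --> \oo] --> (0 : R[i]^o).
  exact: (@cvg_sub0c _ _ _ (S R[i] z) (fun n => (1 + n%:R^-1 * z) ^+ n) _ cS (@cvg_1D_expn z)).
apply: (@cvg_normc0 _ _ _ _ _ (fun n => S R x n - (1 + n%:R^-1 * x) ^+ n)).
  near=> n; rewrite subr0 (SB _ (real_complex R)) (SB _ idfun).
  rewrite (le_trans (normc_sum _ _ _))//; apply: ler_sum => k _.
  rewrite Normc.normcM normc_real normcX ger0_norm//.
  by apply: d0; near: n; exact: nbhs_infty_gt.
rewrite -(subrr (expR x)); apply: cvgB; last exact: cvg_1D_expn_real.
have : series (exp_coeff x) n.+1 @[n --> \oo] --> expR x.
  by rewrite cvg_shiftS; exact: is_cvg_series_exp_coeff.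
apply: cvg_trans; apply: near_eq_cvg; apply: nearW => n.
by rewrite /series /= big_mkord /S; apply: eq_bigr => k _; rewrite /exp_coeff mulrC.
Unshelve. all: by end_near. Qed.

End complex_exponential.

Section trigonometric_asymptotics.
Context {R : realType}.
Implicit Types (x a : R).

Lemma cvg_sumr (T I : Type) (F : set_system T) {FF : Filter F} (s : seq I)
    (P : pred I) (u : I -> T -> R) (l : I -> R) :
  (forall i, P i -> u i t @[t --> F] --> l i) ->
  \sum_(i <- s | P i) u i t @[t --> F] --> \sum_(i <- s | P i) l i.
Proof. by move=> ul; apply: cvg_big => //; exact: add_continuous. Qed.

Lemma norm_sin_le x : `|sin x| <= `|x|.
Proof.
have [->|x0] := eqVneq x 0; first by rewrite sin0.
wlog x_gt0 : x x0 / 0 < x.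
  move=> H; case: (ltgtP x 0) => [xN|/H->//|/eqP]; last by rewrite (negbTE x0).
  by rewrite -(normrN x) -(normrN (sin x)) -sinN H ?oppr_eq0// oppr_gt0.
have [|c _] := @MVT R (@sin R) (@cos R) 0 x x_gt0.
  by apply: continuous_subspaceT => y; exact: continuous_sin.
rewrite sin0 !subr0 => ->; rewrite normrM ler_piMl//; exact: cos_max.
Qed.

Lemma oneB_cosE x : 1 - cos x = 2 * sin (x / 2) ^+ 2.
Proof.
have := cos_mulr2n (x / 2); rewrite -[(x / 2) *+ 2]mulr_natr divfK ?pnatr_eq0// => ->.
by rewrite cos2sin2 -[_ *+ 2]mulr_natr; ring.
Qed.

Lemma oneB_cos_le x : 1 - cos x <= x ^+ 2.
Proof.
rewrite oneB_cosE -[sin _ ^+ 2]real_normK ?num_real//.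
apply: (@le_trans _ _ (2 * `|x / 2| ^+ 2)).
  by rewrite ler_wpM2l// lerXn2r ?nnegrE// norm_sin_le.
rewrite real_normK ?num_real//; have := sqr_ge0 x; lra.
Qed.

(** Mean value theorem for sin y - y, whose derivative cos y - 1 is at most y^2 in size. The
    constant is crude, but only the order 3 matters. *)
Lemma norm_sinB_le x : `|sin x - x| <= `|x| ^+ 3.
Proof.
have [->|x0] := eqVneq x 0; first by rewrite sin0 subrr normr0 expr0n.
wlog x_gt0 : x x0 / 0 < x.
  move=> H; case: (ltgtP x 0) => [xN|/H->//|/eqP]; last by rewrite (negbTE x0).
  by rewrite -(normrN x) -(normrN (sin x - x)) opprD -sinN H ?oppr_eq0// oppr_gt0.
have [|c cx] := @MVT R (fun y => sin y - y) (fun y => cos y - 1) 0 x x_gt0.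
  apply: continuous_subspaceT => y.
  by apply: cvgB; [exact: continuous_sin | exact: cvg_id].
rewrite sin0 !subr0 => ->; rewrite normrM exprSr ler_wpM2r//.
rewrite distrC ger0_norm ?subr_ge0 ?cos_le1// (le_trans (oneB_cos_le _))//.
move: cx; rewrite in_itv /= => /andP[c0 cx].
by rewrite gtr0_norm// lerXn2r ?nnegrE ?ltW.
Qed.

Lemma cvgn_sqrt_inv : (Num.sqrt n%:R)^-1 @[n --> \oo] --> (0 : R).
Proof.
rewrite -(sqrtr0 R); under eq_fun do rewrite -sqrtrV ?ler0n//.
by apply: (continuous_cvg _ _ cvgn_inv); exact: sqrt_continuous.
Qed.

(** The Boolean records the case n = 0, where the inverse of 0 is 0. *)
Lemma natr_sqrtV n : n%:R * (Num.sqrt n%:R)^-1 ^+ 2 = (n != 0)%:R :> R.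
Proof.
case: n => [|n]; first by rewrite mul0r.
by rewrite exprVn sqr_sqrtr// divff// pnatr_eq0.
Qed.

(** With s = n^(-1/2), the real part is -2 (s^-1 sin (s a / 2))^2 by the half-angle formula, so a
    first derivative suffices for a second-order limit; the imaginary part is at most n s^3 |a|^3 =
    s |a|^3. *)
Lemma cvg_expi_taylor2 a :
  (n%:R * (expi ((Num.sqrt n%:R)^-1 * a) - 1 - (0 +i* ((Num.sqrt n%:R)^-1 * a))%C) : R[i]^o)
    @[n --> \oo] --> ((- (a ^+ 2 / 2))%:C%C : R[i]^o).
Proof.
pose s (n : nat) : R := (Num.sqrt n%:R)^-1.
have s_ge0 n : 0 <= s n by rewrite invr_ge0 sqrtr_ge0.
have nz : \forall n \near \oo, s n != 0.
  near=> n; rewrite invr_eq0 sqrtr_eq0 -ltNge ltr0n.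
  by near: n; exact: nbhs_infty_gt.
apply: cvg_complex => /=.
  have cs : (s n)^-1 * sin (s n * (a / 2)) @[n --> \oo] --> a / 2.
    have df : is_derive (0 : R) 1 (fun t : R => sin (t * (a / 2))) (a / 2).
      by apply: is_derive_eq; rewrite !mul0r cos0 /GRing.scale /=; ring.
    apply: cvg_trans (is_derive_cvg df cvgn_sqrt_inv nz); apply: near_eq_cvg.
    by apply: nearW => n; rewrite mul0r sin0 subr0 add0r.
  have -> : - (a ^+ 2 / 2) = - 2 * ((a / 2) * (a / 2)) by field.
  have cst : (fun=> - 2 : R) n @[n --> \oo] --> (- 2 : R) by exact: cvg_cst.
  apply: cvg_trans (cvgM cst (cvgM cs cs)); apply: near_eq_cvg.
  apply: nearW => n; suff -> : complex.Re (n%:R * (expi (s n * a) - 1 - (0 +i* (s n * a))%C)) =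
    - 2 * ((s n)^-1 * sin (s n * (a / 2)) * ((s n)^-1 * sin (s n * (a / 2)))) by [].
  rewrite natrc expiE ReM /= mul0r !subr0.
  have := oneB_cosE (s n * a); rewrite -mulrA => E.
  rewrite -[cos _ - 1]opprB E; have <- : (s n)^-1 ^+ 2 = n%:R by rewrite invrK sqr_sqrtr.
  by ring.
suff : n%:R * (sin (s n * a) - s n * a) @[n --> \oo] --> (0 : R).
  apply: cvg_trans; apply: near_eq_cvg; apply: nearW => n.
  by rewrite natrc expiE ImM /= mul0r addr0 subr0.
apply/norm_cvg0P.
apply: (@squeeze_cvgr _ _ _ _ (fun=> 0) (fun n => s n * `|a| ^+ 3)).
- apply: nearW => n; rewrite normr_ge0 /= normrM ger0_norm//.
  apply: (@le_trans _ _ (n%:R * `|s n * a| ^+ 3)).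
    by rewrite ler_wpM2l// norm_sinB_le.
  rewrite normrM ger0_norm// exprMn mulrA ler_wpM2r ?exprn_ge0//.
  rewrite exprSr mulrA -[n%:R * s n ^+ 2]/(n%:R * (Num.sqrt n%:R)^-1 ^+ 2) natr_sqrtV.
  by case: (n != 0); rewrite ?mul1r ?mul0r.
- exact: cvg_cst.
- by rewrite -(mul0r (`|a| ^+ 3)); apply: cvgM; [exact: cvgn_sqrt_inv | exact: cvg_cst].
Unshelve. all: by end_near. Qed.

End trigonometric_asymptotics.

(** * The normal characteristic function *)

Section normal_characteristic_function.
Context {R : realType} (s : R) (s0 : 0 < s).
Local Notation mu := (@lebesgue_measure R).
Implicit Types (t x : R) (f : R -> R).
Local Notation pdf := (normal_pdf 0 s : R -> R).
Local Notation pdf2 := (normal_pdf 0 (s * Num.sqrt 2) : R -> R).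

Let sN0 : s != 0. Proof. by rewrite gt_eqF. Qed.

Let pdfE x : pdf x = normal_peak s * expR (- (x ^+ 2) / (s ^+ 2 *+ 2)).
Proof. by rewrite normal_pdfE// /normal_fun subr0. Qed.

Let mpdf : measurable_fun setT pdf. Proof. exact: measurable_normal_pdf. Qed.

Let pdf_ge0 x : 0 <= pdf x. Proof. exact: normal_pdf_ge0. Qed.

(** [normal_prob] is given by integrating its density, so its Radon-Nikodym derivative is that
    density almost everywhere. *)
Lemma integral_normal_prob (f : R -> R) : measurable_fun setT f ->
  [bounded f x | x in setT] ->
  \int[normal_prob 0 s]_x f x = \int[mu]_x (f x * pdf x).
Proof.
move=> mf bf; rewrite /Rintegral; congr fine.
have nd := @normal_prob_dominates R 0 s.
rewrite -(Radon_Nikodym_change_of_variables nd)//=; last first.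
  apply: measurable_bounded_integrable => //.
  by rewrite [X in (X < _)%E](_ : _ = 1%E) ?ltry//; exact: (@probability_setT _ _ R (normal_prob 0 s)).
apply: ae_eq_integral => //.
- apply: emeasurable_funM; first exact/measurable_EFinP.
  by apply: (measurable_int mu); apply: Radon_Nikodym_integrable.
- by apply/measurable_EFinP; apply: measurable_funM.
under [X in ae_eq _ _ _ X]eq_fun do rewrite EFinM.
apply: ae_eqe_mul2l => /=.
apply: integral_ae_eq => //=.
- exact: Radon_Nikodym_integrable.
- exact/measurable_EFinP.
- by move=> E _ mE; rewrite -Radon_Nikodym_integral.
Qed.

(** With this constant the density of variance 2 s^2 dominates |x| times the density of variance
    s^2, which gives an integrable envelope independent of t. *)
Let C := s * normal_peak s / normal_peak (s * Num.sqrt 2).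

(* [s + x^2 / (4 s) >= |x|] *)
Let norm_mul_pdf_le x : `|x| * pdf x <= C * pdf2 x.
Proof.
have s20 : s * Num.sqrt 2 != 0 by rewrite mulf_neq0// sqrtr_eq0 -ltNge.
rewrite pdfE (normal_pdfE 0 s20) /C [X in _ <= X]mulrA divfK ?gt_eqF ?normal_peak_gt0//.
rewrite /normal_fun subr0 exprMn sqr_sqrtr//.
rewrite mulrCA [s * _]mulrC -[leRHS]mulrA ler_wpM2l ?normal_peak_ge0//.
set a := x ^+ 2 / (s ^+ 2 * 2 *+ 2).
have -> : - (x ^+ 2) / (s ^+ 2 * 2 *+ 2) = - a by rewrite mulNr.
have -> : - (x ^+ 2) / (s ^+ 2 *+ 2) = - a - a.
  by rewrite /a -[_ * 2 *+ 2]mulr_natr -[_ *+ 2]mulr_natr; field.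
rewrite expRD mulrA ler_wpM2r ?expR_ge0// expRN ler_pdivrMr ?expR_gt0//.
apply: (@le_trans _ _ (s * (1 + a))); last by rewrite ler_wpM2l ?expR_ge1Dx// ltW.
have -> : s * (1 + a) = s + x ^+ 2 / (4 * s).
  by rewrite /a -[_ * 2 *+ 2]mulr_natr; field.
rewrite -subr_ge0 -(real_normK (num_real x)).
have -> : s + `|x| ^+ 2 / (4 * s) - `|x| = (2 * s - `|x|) ^+ 2 / (4 * s) by field.
by rewrite divr_ge0 ?sqr_ge0// mulr_ge0// ltW.
Qed.

Let integrable_norm_pdf : mu.-integrable setT (fun x => (C * pdf2 x)%:E).
Proof.
under eq_fun do rewrite EFinM; apply: integrableZl => //.
exact: integrable_normal_pdf.
Qed.

Let integrable_bounded_pdf (f : R -> R) : measurable_fun setT f ->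
  (forall x, `|f x| <= 1) -> mu.-integrable setT (fun x => (f x * pdf x)%:E).
Proof.
move=> mf f1; apply: (le_integrable _ _ _ (@integrable_normal_pdf R 0 s)) => //.
  by apply/measurable_EFinP; exact: measurable_funM.
move=> x _; rewrite /= lee_fin normrM (ger0_norm (pdf_ge0 x)).
by rewrite ler_piMl.
Qed.

Let integrable_id_pdf (f : R -> R) : measurable_fun setT f ->
  (forall x, `|f x| <= 1) -> mu.-integrable setT (fun x => (x * f x * pdf x)%:E).
Proof.
move=> mf f1; apply: (le_integrable _ _ _ integrable_norm_pdf) => //.
  by apply/measurable_EFinP; apply: measurable_funM => //; exact: measurable_funM.
move=> x _; rewrite /= lee_fin (le_trans _ (ler_norm _))//.
rewrite (le_trans _ (norm_mul_pdf_le x))// !normrM (ger0_norm (pdf_ge0 x)).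
by rewrite ler_wpM2r// ler_piMr.
Qed.

Let msin t : measurable_fun setT (fun x : R => sin (t * x)).
Proof.
apply: continuous_measurable_fun => x.
by apply: continuous_comp; [apply: cvgM; [exact: cvg_cst|exact: cvg_id]|exact: continuous_sin].
Qed.

Let mcos t : measurable_fun setT (fun x : R => cos (t * x)).
Proof.
apply: continuous_measurable_fun => x.
by apply: continuous_comp; [apply: cvgM; [exact: cvg_cst|exact: cvg_id]|exact: continuous_cos].
Qed.

Let dpdf x : is_derive x 1 pdf (- (x / s ^+ 2) * pdf x).
Proof.
have -> : pdf = fun x => normal_peak s * expR (- (x ^+ 2) / (s ^+ 2 *+ 2)).
  by apply/funext => y; exact: pdfE.
apply: is_derive_eq.
by rewrite /GRing.scale /= -[_ *+ 2]mulr_natr; field.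
Qed.

Let F t := \int[mu]_x (cos (t * x) * pdf x).

(** H vanishes at infinity and h is its derivative in x, so h integrates to 0: this is the
    integration by parts that equates the integral of x sin (t x) pdf with s^2 t F t. *)
Let H t x := s ^+ 2 * sin (t * x) * pdf x.
Let h t x := s ^+ 2 * t * (cos (t * x) * pdf x) - x * sin (t * x) * pdf x.

Let dH t x : is_derive x 1 (H t) (h t x).
Proof.
have d1 : is_derive x 1 (fun y => s ^+ 2 * sin (t * y)) (s ^+ 2 * (t * cos (t * x))).
  by apply: is_derive_eq; rewrite /GRing.scale /=; ring.
have := is_deriveM d1 (dpdf x); rewrite -[_ * _]/(H t) => d2.
by apply: (is_derive_eq d2); rewrite /h /GRing.scale /=; field.
Qed.

Let int_cos t : mu.-integrable setT (fun x => (cos (t * x) * pdf x)%:E).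
Proof. by apply: integrable_bounded_pdf => // x; exact: cos_max. Qed.

Let int_h t : mu.-integrable setT (EFin \o h t).
Proof.
rewrite /h /comp; under eq_fun do rewrite EFinB.
apply: integrableB => //.
  by under eq_fun do rewrite EFinM; apply: integrableZl.
by apply: integrable_id_pdf => // x; exact: sin_max.
Qed.

Let cH t : continuous (H t).
Proof.
move=> x; apply/differentiable_continuous/derivable1_diffP.
by have [] := dH t x.
Qed.

Let ch t : continuous (h t).
Proof.
have cpdf : continuous pdf by exact: continuous_normal_pdf.
have cM : continuous (fun x => t * x).
  by move=> x; apply: cvgM; [exact: cvg_cst|exact: cvg_id].
have ccos : continuous (fun x => cos (t * x)).
  by move=> x; apply: continuous_comp; [exact: cM|exact: continuous_cos].
have csin : continuous (fun x => sin (t * x)).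
  by move=> x; apply: continuous_comp; [exact: cM|exact: continuous_sin].
move=> x; apply: cvgB.
  by apply: cvgM; [exact: cvg_cst|apply: cvgM; [exact: ccos|exact: cpdf]].
apply: cvgM; last exact: cpdf.
by apply: cvgM; [exact: cvg_id|exact: csin].
Qed.

Let norm_H_le t x : 0 < x -> `|H t x| <= s ^+ 2 * (C * normal_peak (s * Num.sqrt 2)) / x.
Proof.
move=> x0; rewrite /H 2!normrM (ger0_norm (sqr_ge0 s)) (ger0_norm (pdf_ge0 x)).
rewrite ler_pdivlMr//.
have -> : s ^+ 2 * `|sin (t * x)| * pdf x * x = s ^+ 2 * (`|sin (t * x)| * (pdf x * x)).
  by ring.
rewrite ler_wpM2l ?sqr_ge0//; apply: (@le_trans _ _ (pdf x * x)).
  by rewrite ler_piMl ?sin_max// mulr_ge0// ltW.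
rewrite mulrC; have := norm_mul_pdf_le x; rewrite gtr0_norm// => /le_trans; apply.
rewrite ler_wpM2l//.
  by rewrite /C divr_ge0 ?mulr_ge0 ?normal_peak_ge0// ltW.
by apply: normal_pdf_ub; rewrite mulf_neq0// sqrtr_eq0 -ltNge.
Qed.

Let itvn (n : nat) : set R := `[- n%:R, n%:R]%classic.

Let integral_h_itv t (n : nat) : (0 < n)%N ->
  (\int[mu]_(x in itvn n) (h t x)%:E = (H t n%:R - H t (- n%:R))%:E)%E.
Proof.
move=> n0; rewrite EFinB; apply: continuous_FTC2.
- by rewrite -subr_gt0 opprK -natrD ltr0n addn_gt0 n0.
- by apply: continuous_subspaceT => x; exact: ch.
- split; first by move=> x _; have [] := dH t x.
    by apply: cvg_at_right_filter; exact: cH.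
  by apply: cvg_at_left_filter; exact: cH.
- by move=> x _; rewrite derive1E; have [_ ->] := dH t x.
Qed.

(** The integrals over [- n, n] have two limits: the whole integral, by dominated convergence, and
    0, since the fundamental theorem gives H n - H (- n) = 2 H n, which is O(1/n). *)
Let integral_h t : \int[mu]_x h t x = 0.
Proof.
rewrite /Rintegral; have /integrableP[mh _] := int_h t.
have mh' := int_h t.
have c1 : (\int[mu]_(x in itvn n) (h t x)%:E)%E @[n --> \oo] --> (\int[mu]_x (h t x)%:E)%E.
  under eq_fun do rewrite integral_mkcond.
  apply: (@dominated_cvg _ _ _ mu setT measurableT _ _ (fun x => `|(h t x)%:E|%E)).
  - move=> n; apply: (iffLR (measurable_restrictT (EFin \o h t) (measurable_itv `[- n%:R, n%:R]))).
    exact: measurable_funS mh.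
  - move=> x _; apply: cvg_near_cst; near=> n.
    rewrite patchE ifT//; apply/mem_set; rewrite /itvn /= in_itv /= -ler_norml.
    by near: n; exact: nbhs_infty_ger.
  - by move=> x _.
  - exact: integrable_abse.
  - move=> n x _; rewrite patchE; case: ifPn => // _.
    by rewrite abse0.
have c2 : (\int[mu]_(x in itvn n) (h t x)%:E)%E @[n --> \oo] --> 0%E.
  apply: (@cvg_trans _ ((fun n : nat => (H t n%:R - H t (- n%:R))%:E) @ \oo)).
    apply: near_eq_cvg; near=> n; rewrite integral_h_itv//.
    by near: n; exact: nbhs_infty_gt.
  apply: cvg_EFin; first exact: nearW.
  pose K := s ^+ 2 * (C * normal_peak (s * Num.sqrt 2)).
  apply/norm_cvg0P; apply: (@squeeze_cvgr _ _ _ _ (fun=> 0) (fun n => 2 * K * n%:R^-1)).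
  - near=> n; rewrite normr_ge0 /=.
    have -> : H t (- n%:R) = - H t n%:R.
      rewrite /H mulrN sinN !pdfE sqrrN; ring.
    rewrite opprK -mulr2n normrMn -[leLHS]mulr_natl -mulrA ler_wpM2l//.
    by apply: norm_H_le; rewrite ltr0n; near: n; exact: nbhs_infty_gt.
  - exact: cvg_cst.
  - by rewrite -(mulr0 (2 * K)); apply: cvgM; [exact: cvg_cst|exact: cvgn_inv].
by rewrite (cvg_unique _ c1 c2).
Unshelve. all: by end_near. Qed.

(** Differentiation under the integral sign brings out - x sin (t x) pdf, and [integral_h] evaluates
    its integral. *)
Let dF t : is_derive t 1 F (- (s ^+ 2 * t) * F t).
Proof.
pose f t x := cos (t * x) * pdf x.
have dcos (x y : R) : is_derive y 1 (f ^~ x : R -> R) (- (x * sin (y * x) * pdf x)).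
  by rewrite /f; apply: is_derive_eq; rewrite /GRing.scale /=; ring.
have d1 x y : partial1of2 f y x = - (x * sin (y * x) * pdf x).
  by rewrite partial1of2E; exact: derive_val.
have tI : `]t - 1, t + 1[%classic t by rewrite /= in_itv /=; apply/andP; split; lra.
have i1 : forall x, `]t - 1, t + 1[%classic x -> mu.-integrable setT (EFin \o f x).
  by move=> y _; exact: int_cos.
have i2 : forall x y, `]t - 1, t + 1[%classic x -> setT y -> derivable (f ^~ y) x 1.
  by move=> y x _ _; exact: ex_derive.
have G0 : forall y, 0 <= C * pdf2 y.
  by move=> y; apply: le_trans (norm_mul_pdf_le y); rewrite mulr_ge0.
have Gub : forall x y, `]t - 1, t + 1[%classic x -> setT y ->
    `|partial1of2 f x y| <= C * pdf2 y.
  move=> y x _ _; rewrite d1 normrN !normrM (ger0_norm (pdf_ge0 x)).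
  apply: le_trans (norm_mul_pdf_le x); rewrite ler_wpM2r// ler_piMr//.
  exact: sin_max.
have dd := @derivable_under_integral _ _ _ mu f setT measurableT t _ _ tI i1 i2 _ G0
  integrable_norm_pdf Gub.
have DD := @differentiation_under_integral _ _ _ mu f setT measurableT t _ _ tI i1 i2 _ G0
  integrable_norm_pdf Gub.
apply: (DeriveDef dd); rewrite -derive1E DD.
under eq_Rintegral do rewrite d1.
have := integral_h t; rewrite /h RintegralB//; last 2 first.
- by rewrite /comp; under eq_fun do rewrite EFinM; apply: integrableZl.
- by apply: integrable_id_pdf => // x; exact: sin_max.
rewrite RintegralZl//; last exact: int_cos.
rewrite -/(F t) => /eqP; rewrite subr_eq0 => /eqP E.
rewrite mulNr E -[RHS]mulN1r -RintegralZl//.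
  by apply: eq_Rintegral => x _; rewrite mulN1r.
by apply: integrable_id_pdf => // x; exact: sin_max.
Qed.

Lemma integral_cos_normal_prob :
  \int[normal_prob 0 s]_x cos x = expR (- (s ^+ 2 / 2)).
Proof.
rewrite integral_normal_prob; last 2 first.
- by have := mcos 1; under eq_fun do rewrite mul1r.
- exists 1; split => // M M1 x _; apply: ltW; apply: le_lt_trans M1; exact: cos_max.
(* F solves F' = - s^2 t F, so multiplying by the integrating factor gives a constant. Comparing t =
   1 with t = 0 suffices, s being arbitrary. *)
pose g t := expR (s ^+ 2 / 2 * t ^+ 2) * F t.
have dg t : is_derive t 1 g 0.
  have d1 : is_derive t 1 (fun t => expR (s ^+ 2 / 2 * t ^+ 2))
      (s ^+ 2 * t * expR (s ^+ 2 / 2 * t ^+ 2)).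
    by apply: is_derive_eq; rewrite /GRing.scale /=; field.
  have := is_deriveM d1 (dF t); rewrite -[_ * _]/g => d2.
  by apply: (is_derive_eq d2); rewrite /GRing.scale /=; ring.
have := @is_derive_0_is_cst _ _ 1 0 dg; rewrite /g expr0n /= mulr0 expR0 mul1r expr1n mulr1.
have -> : F 0 = 1.
  rewrite /F /Rintegral; under eq_integral do rewrite mul0r cos0 mul1r.
  by rewrite integral_normal_pdf.
rewrite expRN => E; have e0 := lt0r_neq0 (expR_gt0 (s ^+ 2 / 2)).
apply: (mulfI e0); rewrite mulfV// -[RHS]E; congr (_ * _).
by apply: eq_Rintegral => x _; rewrite mul1r.
Qed.

End normal_characteristic_function.

(** * Levy's continuity theorem *)

Section product_weights.
Context {R : realFieldType} {I A : finType} (q : I -> A -> R).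
Hypotheses (q_ge0 : forall i a, 0 <= q i a) (q_sum1 : forall i, \sum_a q i a = 1).

(** The law of independent variables with marginals q. It serves both for the Bernoulli trials of
    the Bernstein operator and for the messages of the users. *)
Definition product_weight (x : {ffun I -> A}) : R := \prod_i q i (x i).

Local Notation pw := product_weight.

Lemma product_weight_ge0 x : 0 <= pw x.
Proof. exact: prodr_ge0. Qed.

Lemma product_weight_sum1 : \sum_x pw x = 1.
Proof. by rewrite -(bigA_distr_bigA q) big1. Qed.

Lemma product_weight_prod (f : I -> A -> R) :
  \sum_x pw x * \prod_i f i (x i) = \prod_i \sum_a q i a * f i a.
Proof.
by rewrite bigA_distr_bigA; apply: eq_bigr => x _; rewrite -big_split.
Qed.

(** h (x i) is padded by factors 1 to a product over all indices; the other factors then integrate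
    to the total mass 1. *)
Lemma product_weight1 (h : A -> R) i :
  \sum_x pw x * h (x i) = \sum_a q i a * h a.
Proof.
have -> : \sum_x pw x * h (x i) =
    \sum_x pw x * \prod_j (if j == i then h (x j) else 1).
  by apply: eq_bigr => x _; rewrite -big_mkcond big_pred1_eq.
rewrite (product_weight_prod (fun j a => if j == i then h a else 1)).
rewrite (bigD1 i)//= eqxx [X in _ * X]big1 ?mulr1// => j /negbTE ->.
by under eq_bigr do rewrite mulr1; exact: q_sum1.
Qed.

Lemma product_weight2 (h g : A -> R) i j : i != j ->
  \sum_x pw x * (h (x i) * g (x j)) =
    (\sum_a q i a * h a) * (\sum_a q j a * g a).
Proof.
move=> ij.
pose f k a := if k == i then h a else if k == j then g a else 1.
have -> : \sum_x pw x * (h (x i) * g (x j)) = \sum_x pw x * \prod_k f k (x k).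
  apply: eq_bigr => x _; congr (_ * _).
  rewrite (bigD1 i)//= (bigD1 j) 1?eq_sym//= [X in _ * (_ * X)]big1 ?mulr1.
    by rewrite /f !eqxx [j == i]eq_sym (negbTE ij).
  by move=> k /andP[/negbTE ki /negbTE kj]; rewrite /f ki kj.
rewrite product_weight_prod (bigD1 i)//= (bigD1 j) 1?eq_sym//= [X in _ * (_ * X)]big1 ?mulr1.
  by rewrite /f !eqxx [j == i]eq_sym (negbTE ij).
move=> k /andP[/negbTE ki /negbTE kj]; rewrite /f ki kj.
by under eq_bigr do rewrite mulr1; exact: q_sum1.
Qed.

Lemma product_weight_sqr (h : I -> A -> R) :
  \sum_x pw x * (\sum_i h i (x i)) ^+ 2 =
  \sum_i \sum_a q i a * h i a ^+ 2 +
  \sum_i \sum_(j | j != i) (\sum_a q i a * h i a) * (\sum_a q j a * h j a).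
Proof.
have -> : \sum_x pw x * (\sum_i h i (x i)) ^+ 2 =
    \sum_i \sum_j \sum_x pw x * (h i (x i) * h j (x j)).
  under [RHS]eq_bigr do rewrite exchange_big.
  rewrite exchange_big; apply: eq_bigr => x _.
  rewrite expr2 mulr_suml mulr_sumr; apply: eq_bigr => i _.
  by rewrite !mulr_sumr.
rewrite -big_split; apply: eq_bigr => i _; rewrite (bigD1 i)//=; congr (_ + _).
  by rewrite -(product_weight1 (fun a => h i a ^+ 2)).
by apply: eq_bigr => j ji; rewrite product_weight2// eq_sym.
Qed.

(** This form fits both uses: the means vanish for the Bernoulli trials, and for the users they are
    O(1/n), so that the sum of their sizes stays bounded. *)
Lemma product_weight_sqr_le (h : I -> A -> R) :
  \sum_x pw x * (\sum_i h i (x i)) ^+ 2 <=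
  \sum_i \sum_a q i a * h i a ^+ 2 + (\sum_i `|\sum_a q i a * h i a|) ^+ 2.
Proof.
rewrite product_weight_sqr lerD2l expr2 mulr_suml; apply: ler_sum => i _.
rewrite mulr_sumr big_mkcond; apply: ler_sum => j _; case: ifP => _.
  by rewrite -normrM ler_norm.
by rewrite mulr_ge0.
Qed.

End product_weights.

(** * Trigonometric polynomials on pairs of vectors *)

Section trigonometric_polynomials.
Context {R : realType} {n : nat}.
Local Notation V := 'rV[R]_n.
Implicit Types (u v : V) (f g : V * V -> R) (c : bool * 'I_n).

Lemma dotDl u u' v : dot (u + u') v = dot u v + dot u' v.
Proof. by rewrite /dot -big_split; apply: eq_bigr => j _; rewrite mxE mulrDl. Qed.

Lemma dotNl u v : dot (- u) v = - dot u v.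
Proof. by rewrite /dot -sumrN; apply: eq_bigr => j _; rewrite mxE mulNr. Qed.

Lemma dot0l v : dot 0 v = 0.
Proof. by rewrite /dot big1// => j _; rewrite mxE mul0r. Qed.

Lemma dotZl a u v : dot (a *: u) v = a * dot u v.
Proof. by rewrite /dot mulr_sumr; apply: eq_bigr => j _; rewrite mxE mulrA. Qed.

Lemma dotC u v : dot u v = dot v u.
Proof. by apply: eq_bigr => j _; rewrite mulrC. Qed.

Lemma dot_delta j v : dot (delta_mx 0 j) v = v 0 j.
Proof.
rewrite /dot (bigD1 j)//= mxE !eqxx mul1r big1 ?addr0// => k kj.
by rewrite mxE (negbTE kj) andbF mul0r.
Qed.

(** A term is an amplitude, a pair of frequencies and a phase. The phase covers sines and keeps the
    class closed under products. *)
Definition trig_eval (s : seq (R * (V * V) * R)) (x : V * V) : R :=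
  \sum_(t <- s) t.1.1 * cos (dot t.1.2.1 x.1 + dot t.1.2.2 x.2 + t.2).

Definition trig_poly f := exists s, f = trig_eval s.

Lemma trig_poly_cst a : trig_poly (fun=> a).
Proof.
exists [:: (a, (0, 0), 0)]; apply/funext => x.
by rewrite /trig_eval big_seq1 /= !dot0l !addr0 cos0 mulr1.
Qed.

Lemma trig_polyD f g : trig_poly f -> trig_poly g -> trig_poly (fun x => f x + g x).
Proof.
by move=> [s ->] [r ->]; exists (s ++ r); apply/funext => x; rewrite /trig_eval big_cat.
Qed.

Lemma trig_polyM f g : trig_poly f -> trig_poly g -> trig_poly (fun x => f x * g x).
Proof.
move=> [s ->] [r ->].
(* Product-to-sum: cos A cos B = (cos (A + B) + cos (A - B)) / 2, applied to every pair of terms. *)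
exists (flatten [seq flatten [seq
   [:: (t.1.1 * r.1.1 / 2, (t.1.2.1 + r.1.2.1, t.1.2.2 + r.1.2.2), t.2 + r.2);
       (t.1.1 * r.1.1 / 2, (t.1.2.1 - r.1.2.1, t.1.2.2 - r.1.2.2), t.2 - r.2)]
  | r <- r] | t <- s]).
apply/funext => x; rewrite /trig_eval mulr_suml big_flatten big_map.
apply: eq_bigr => t _; rewrite mulr_sumr big_flatten big_map.
apply: eq_bigr => {}r _; rewrite big_cons big_seq1 /= !dotDl !dotNl.
set a := dot _ _; set b := dot _ _; set a' := dot _ _; set b' := dot _ _.
rewrite (_ : a + a' + _ + _ = (a + b + t.2) + (a' + b' + r.2)); last by ring.
rewrite (_ : a - a' + _ + _ = (a + b + t.2) - (a' + b' + r.2)); last by ring.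
set A := a + b + _; set B := a' + b' + _; by rewrite cosD cosB; field.
Qed.

Lemma trig_polyZ a f : trig_poly f -> trig_poly (fun x => a * f x).
Proof. by apply: trig_polyM; exact: trig_poly_cst. Qed.

Lemma trig_poly_sum (I : Type) (s : seq I) (F : I -> V * V -> R) :
  (forall i, trig_poly (F i)) -> trig_poly (fun x => \sum_(i <- s) F i x).
Proof.
move=> tF; elim: s => [|i s IHs].
  by under eq_fun do rewrite big_nil; exact: trig_poly_cst.
by under eq_fun do rewrite big_cons; exact: trig_polyD.
Qed.

Lemma trig_poly_prod (I : Type) (s : seq I) (F : I -> V * V -> R) :
  (forall i, trig_poly (F i)) -> trig_poly (fun x => \prod_(i <- s) F i x).
Proof.
move=> tF; elim: s => [|i s IHs].
  by under eq_fun do rewrite big_nil; exact: trig_poly_cst.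
by under eq_fun do rewrite big_cons; exact: trig_polyM.
Qed.

Definition entry c (x : V * V) : R := (if c.1 then x.2 else x.1) 0 c.2.

Lemma trig_poly_sin_coord a c : trig_poly (fun x => sin (a * entry c x)).
Proof.
pose e : V := a *: delta_mx 0 c.2.
exists [:: (1, if c.1 then (0, e) else (e, 0), - (pi / 2))].
apply/funext => x; rewrite /trig_eval big_seq1 /= mul1r cosBpihalf /entry.
by case: (c.1) => /=; rewrite dot0l dotZl dot_delta ?addr0 ?add0r.
Qed.

End trigonometric_polynomials.

Section trigonometric_approximation.
Context {R : realType} {n : nat} (L : R) (L0 : 0 < L).
Local Notation V := 'rV[R]_n.
Local Notation C := (bool * 'I_n)%type.
Implicit Types (c : C) (x y : V * V).

Lemma continuous_coord c : continuous (entry c : V * V -> R).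
Proof.
case: c => [[] j] x.
  by apply: (@continuous_comp _ _ _ snd (fun v : V => v 0 j)); [exact: cvg_snd|exact: coord_continuous].
by apply: (@continuous_comp _ _ _ fst (fun v : V => v 0 j)); [exact: cvg_fst|exact: coord_continuous].
Qed.

Lemma eq_coord x y : (forall c, entry c x = entry c y) -> x = y.
Proof.
case: x y => [x1 x2] [y1 y2] E; congr pair; apply/rowP => j.
  by have := E (false, j).
by have := E (true, j).
Qed.

(** The half-side is such that x / L ranges over [- pi / 2, pi / 2], where the sine is injective. *)
Definition box : set (V * V) := [set x | forall c, `|entry c x| <= L * (pi / 2)].

Lemma compact_box : compact box.
Proof.
pose I : set R := `[- (L * (pi / 2)), L * (pi / 2)]%classic.
have -> : box = [set v : V | forall j, I (v 0 j)] `*` [set v : V | forall j, I (v 0 j)].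
  apply/seteqP; split => x /= bx.
    split => j; rewrite /I /= in_itv /= -ler_norml.
      exact: (bx (false, j)).
    exact: (bx (true, j)).
  move=> [[] j]; rewrite ler_norml.
    by have := bx.2 j; rewrite /I /= in_itv.
  by have := bx.1 j; rewrite /I /= in_itv.
by apply: compact_setX; apply: (@rV_compact _ _ (fun=> I)) => _; exact: segment_compact.
Qed.

(* The coordinates of the box are mapped increasingly onto [0, 1]. *)
Definition unit_coord c x : R := (1 + sin (L^-1 * entry c x)) / 2.

Lemma unit_coord_itv c x : 0 <= unit_coord c x <= 1.
Proof.
have := sin_geN1 (L^-1 * entry c x); have := sin_le1 (L^-1 * entry c x).
by rewrite /unit_coord; move=> *; apply/andP; split; lra.
Qed.

Lemma continuous_unit_coord c : continuous (unit_coord c).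
Proof.
move=> x; apply: cvgM; last exact: cvg_cst.
apply: cvgD; first exact: cvg_cst.
apply: (@continuous_comp _ _ _ (fun x => L^-1 * entry c x) sin); last exact: continuous_sin.
by apply: cvgM; [exact: cvg_cst|exact: continuous_coord].
Qed.

Lemma unit_coord_inj x y : box x -> box y ->
  (forall c, unit_coord c x = unit_coord c y) -> x = y.
Proof.
move=> bx by_ E; apply: eq_coord => c.
have Lc z : box z -> L^-1 * entry c z \in `[- (pi / 2), pi / 2].
  move=> /(_ c); rewrite in_itv /= -ler_norml normrM gtr0_norm ?invr_gt0//.
  by rewrite ler_pdivrMl.
apply: (mulfI (lt0r_neq0 (_ : 0 < L^-1))); first by rewrite invr_gt0.
apply: sin_inj; rewrite ?Lc//.
by have := E c; rewrite /unit_coord; lra.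
Qed.

(** The squares make the mean distance to a random node a sum of variances. *)
Definition unit_dist x y : R := \sum_c (unit_coord c x - unit_coord c y) ^+ 2.

Lemma unit_dist_ge0 x y : 0 <= unit_dist x y.
Proof. by apply: sumr_ge0 => c _; exact: sqr_ge0. Qed.

(** Uniform continuity in a form that can be averaged. On the compact set of pairs of the box with
    |f x - f y| >= e the distance has a positive minimum, because the unit coordinates separate
    points; 2 B divided by that minimum is a suitable K. *)
Lemma near_diagonal (f : V * V -> R) (B e : R) : continuous f ->
  (forall x, `|f x| <= B) -> 0 < e ->
  exists2 K, 0 <= K & forall x y, box x -> box y -> `|f x - f y| <= e + K * unit_dist x y.
Proof.
move=> cf fB e0.
have B0 : 0 <= B by exact: le_trans (fB (0, 0)).
pose D : set ((V * V) * (V * V)) := (box `*` box) `&` [set z | e <= `|f z.1 - f z.2|].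
have cfd : continuous (fun z : (V * V) * (V * V) => `|f z.1 - f z.2|).
  move=> z; apply: (@continuous_comp _ _ _ (fun z : (V * V) * (V * V) => f z.1 - f z.2) Num.norm).
    apply: cvgB.
      by apply: (@continuous_comp _ _ _ fst f); [exact: cvg_fst|exact: cf].
    by apply: (@continuous_comp _ _ _ snd f); [exact: cvg_snd|exact: cf].
  exact: norm_continuous.
have cD : compact D.
  apply: (@subclosed_compact _ _ (box `*` box)).
  - apply: closedI; first by apply: compact_closed; [exact: norm_hausdorff|exact: compact_setX compact_box compact_box].
    by apply: (@closed_comp _ _ _ [set t : R | e <= t]) => //; exact: closed_ge.
  - exact: compact_setX compact_box compact_box.
  - by move=> z [].
have cr : continuous (fun z : (V * V) * (V * V) => unit_dist z.1 z.2).
  move=> z; apply: cvg_big => [|c _]; first exact: add_continuous.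
  apply: (@continuous_comp _ _ _ (fun z : (V * V) * (V * V) => unit_coord c z.1 - unit_coord c z.2) (fun t => t ^+ 2)).
    apply: cvgB.
      by apply: (@continuous_comp _ _ _ fst (unit_coord c)); [exact: cvg_fst|exact: continuous_unit_coord].
    by apply: (@continuous_comp _ _ _ snd (unit_coord c)); [exact: cvg_snd|exact: continuous_unit_coord].
  exact: exprn_continuous.
have [D0|/set0P/negP/negPn/eqP D0] := pselect (D !=set0); last first.
  exists 0 => // x y bx by_; rewrite mul0r addr0 leNgt; apply/negP => /ltW exy.
  by have : D (x, y) by []; rewrite D0.
have [[x0 y0] /set_mem[[bx0 by0] exy0] min0] :=
  compact_EVT_min D0 cD (continuous_subspaceT cr).
have d0 : 0 < unit_dist x0 y0.
  rewrite lt_neqAle unit_dist_ge0 andbT eq_sym; apply/negP => /eqP d0.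
  move: exy0; rewrite /= (_ : x0 = y0) ?subrr ?normr0 1?leNgt ?e0//.
  apply: unit_coord_inj => // c; apply/eqP; rewrite -subr_eq0 -sqrf_eq0.
  move/eqP: d0; rewrite psumr_eq0 => [/allP/(_ c)|? _]; last exact: sqr_ge0.
  by rewrite mem_index_enum => /(_ isT).
exists (2 * B / unit_dist x0 y0); first by rewrite divr_ge0 ?mulr_ge0// ltW.
move=> x y bx by_; have [exy|/ltW exy] := leP e `|f x - f y|; last first.
  rewrite (le_trans exy)// lerDl mulr_ge0 ?unit_dist_ge0//.
  by rewrite divr_ge0 ?mulr_ge0// ltW.
have /min0 /= le_d : ((x, y) : (V * V) * (V * V)) \in D by apply/mem_set.
apply: (@le_trans _ _ (2 * B)).
  by rewrite (le_trans (ler_normB _ _))// mulrDl mul1r lerD.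
apply: (@le_trans _ _ (2 * B / unit_dist x0 y0 * unit_dist x y)); last by rewrite lerDr ltW.
by rewrite mulrAC ler_pdivlMr// ler_wpM2l// mulr_ge0.
Qed.

Variable m : nat.

Definition trial_prob x (ci : C * 'I_m) (b : bool) : R :=
  if b then unit_coord ci.1 x else 1 - unit_coord ci.1 x.

Definition frequency c (w : {ffun C * 'I_m -> bool}) : R :=
  (\sum_i (w (c, i))%:R) / m%:R.

(** [asin] inverts the change of coordinates, so that the frequencies become the unit coordinates of
    the node. *)
Definition node (w : {ffun C * 'I_m -> bool}) : V * V :=
  let r b := \row_j (L * asin (2 * frequency (b, j) w - 1)) in (r false, r true).

(* Bernstein's operator in the unit coordinates, the points of [0, 1] being
   sampled by Bernoulli trials. *)
Definition bernstein (f : V * V -> R) x : R :=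
  \sum_w product_weight (trial_prob x) w * f (node w).

Lemma trial_prob_ge0 x ci b : 0 <= trial_prob x ci b.
Proof. by have /andP[s0 s1] := unit_coord_itv ci.1 x; case: b => //=; rewrite subr_ge0. Qed.

Lemma trial_prob_sum1 x ci : \sum_b trial_prob x ci b = 1.
Proof. by rewrite big_bool /= addrC subrK. Qed.

Lemma trig_poly_bernstein f : trig_poly (bernstein f).
Proof.
apply: trig_poly_sum => w; under eq_fun do rewrite mulrC.
apply: trig_polyZ; apply: trig_poly_prod => ci.
have ts : trig_poly (unit_coord ci.1).
  rewrite /unit_coord; under eq_fun do rewrite mulrC.
  apply: trig_polyZ; apply: trig_polyD; first exact: trig_poly_cst.
  exact: trig_poly_sin_coord.
rewrite /trial_prob; case: (w ci) => //.
apply: trig_polyD; first exact: trig_poly_cst.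
by under eq_fun do rewrite -mulN1r; exact: trig_polyZ.
Qed.

Lemma norm_bernstein_le (f : V * V -> R) B x : (forall y, `|f y| <= B) -> `|bernstein f x| <= B.
Proof.
move=> fB; rewrite -[B]mul1r -(product_weight_sum1 (trial_prob_sum1 x)) mulr_suml.
rewrite (le_trans (ler_norm_sum _ _ _))//; apply: ler_sum => w _.
have w0 := product_weight_ge0 (trial_prob_ge0 x) w.
by rewrite normrM (ger0_norm w0) ler_wpM2l.
Qed.

Hypothesis m0 : (0 < m)%N.

Lemma frequency_itv c w : 0 <= frequency c w <= 1.
Proof.
rewrite /frequency divr_ge0//=; last by apply: sumr_ge0.
rewrite ler_pdivrMr ?ltr0n// mul1r -[m in leRHS]card_ord -sum1_card natr_sum.
by apply: ler_sum => i _; case: (w _).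
Qed.

Let asin_itv c w : -1 <= 2 * frequency c w - 1 <= 1.
Proof. by have /andP[f0 f1] := frequency_itv c w; apply/andP; split; lra. Qed.

Lemma coord_node c w : entry c (node w) = L * asin (2 * frequency c w - 1).
Proof. by case: c => [[] j]; rewrite /entry /= mxE. Qed.

Lemma box_node w : box (node w).
Proof.
move=> c; rewrite coord_node normrM gtr0_norm// ler_pM2l// ler_norml.
by rewrite asin_geNpi2// asin_lepi2.
Qed.

Lemma unit_coord_node c w : unit_coord c (node w) = frequency c w.
Proof.
rewrite /unit_coord coord_node mulKf ?gt_eqF// asinK; last first.
  by rewrite in_itv /=.
by rewrite addrC subrK mulrC mulKf.
Qed.

Let sum_trials (F : C * 'I_m -> R) : \sum_ci F ci = \sum_c \sum_i F (c, i).
Proof. by rewrite pair_bigA; apply: eq_bigr => -[]. Qed.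

(** Each frequency is a mean of m independent trials of success probability s, with variance s (1 -
    s) / m. *)
Lemma variance_node_le x c :
  \sum_w product_weight (trial_prob x) w * (unit_coord c x - unit_coord c (node w)) ^+ 2
    <= m%:R^-1.
Proof.
have /andP[s0 s1] := unit_coord_itv c x; set s := unit_coord c x in s0 s1 *.
(* The centred share of one trial in the frequency of c; trials for the other coordinates contribute
   0. *)
pose h (ci : C * 'I_m) (b : bool) : R := if ci.1 == c then (b%:R - s) / m%:R else 0.
have Eh ci : \sum_b trial_prob x ci b * h ci b = 0.
  rewrite big_bool /= /h; case: eqP => [E|_]; last by rewrite !mulr0 addr0.
  by rewrite /trial_prob E -/s /=; ring.
have mR : (m%:R : R) != 0 by rewrite pnatr_eq0 -lt0n.
have -> : \sum_w product_weight (trial_prob x) w * (s - unit_coord c (node w)) ^+ 2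
    = \sum_w product_weight (trial_prob x) w * (\sum_ci h ci (w ci)) ^+ 2.
  apply: eq_bigr => w _; congr (_ * _); rewrite unit_coord_node -[LHS]sqrrN opprB.
  congr (_ ^+ 2); rewrite sum_trials.
  rewrite (bigD1 c)//= [X in _ = _ + X]big1 ?addr0; last first.
    by move=> c' /negbTE cc'; rewrite big1// => i _; rewrite /h /= cc'.
  under eq_bigr do rewrite /h /= eqxx.
  by rewrite -mulr_suml sumrB sumr_const card_ord /frequency -[s *+ m]mulr_natr mulrBl mulfK.
rewrite (le_trans (product_weight_sqr_le (trial_prob_sum1 x) h))//.
rewrite [X in _ + X ^+ 2]big1 ?expr0n ?addr0; last by move=> ci _; rewrite Eh normr0.
rewrite sum_trials.
rewrite (bigD1 c)//= [X in _ + X]big1 ?addr0; last first.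
  move=> c' /negbTE cc'; rewrite big1// => i _.
  by rewrite big_bool /h /= cc' expr0n !mulr0 addr0.
apply: (@le_trans _ _ (\sum_(i < m) m%:R ^- 2)).
  apply: ler_sum => i _; rewrite big_bool /h /trial_prob /= eqxx -/s !exprMn !exprVn !mulrA.
  rewrite -mulrDl ler_piMl ?invr_ge0 ?exprn_ge0//.
  rewrite (_ : _ + _ = s * (1 - s)); last by ring.
  by rewrite mulr_ile1// ?subr_ge0// lerBlDr lerDl.
rewrite sumr_const card_ord -[leLHS]mulr_natl expr2 invfM mulrA mulfV//.
by rewrite mul1r.
Qed.

(** Bernstein's argument: averaging the [near_diagonal] bound over the random node leaves e plus K
    times a sum of variances. *)
Lemma bernstein_approx (f : V * V -> R) e K x : 0 <= K ->
  (forall x y, box x -> box y -> `|f x - f y| <= e + K * unit_dist x y) ->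
  box x -> `|f x - bernstein f x| <= e + K * (#|{: C}|%:R / m%:R).
Proof.
move=> K0 fK bx.
have w0 := product_weight_ge0 (trial_prob_ge0 x).
have w1 := product_weight_sum1 (trial_prob_sum1 x).
rewrite -[f x]mul1r -w1 mulr_suml -sumrB.
rewrite (le_trans (ler_norm_sum _ _ _))//.
apply: (@le_trans _ _ (\sum_w product_weight (trial_prob x) w *
    (e + K * unit_dist x (node w)))).
  apply: ler_sum => w _; rewrite -mulrBr normrM (ger0_norm (w0 w)) ler_wpM2l//.
  by apply: fK => //; exact: box_node.
under eq_bigr do rewrite mulrDr.
rewrite big_split /= -mulr_suml w1 mul1r lerD2l.
under eq_bigr do rewrite mulrCA; rewrite -mulr_sumr ler_wpM2l//.
under eq_bigr do rewrite mulr_sumr; rewrite exchange_big /=.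
rewrite mulrC -[#|_|]sum1_card natr_sum mulr_sumr; apply: ler_sum => c _.
by rewrite mulr1; exact: variance_node_le.
Qed.

End trigonometric_approximation.

Section unit_mass.
Context d {T : measurableType d} {R : realType}.
Context (m : {measure set T -> \bar R}) (m1 : m setT = 1%E).
Implicit Types (f g : T -> R).

Lemma bounded_integrable f B : measurable_fun setT f -> (forall x, `|f x| <= B) ->
  m.-integrable setT (EFin \o f).
Proof.
move=> mf fB; apply: measurable_bounded_integrable => //.
  by rewrite [X in (X < _)%E](_ : _ = 1%E) ?ltry.
exists B; split; first exact: num_real.
by move=> M BM x _ /=; rewrite (le_trans (fB x))// ltW.
Qed.

Lemma Rintegral_cst1 (a : R) : \int[m]_x a = a.
Proof. by rewrite Rintegral_cst// [X in fine X](_ : _ = 1%E) ?mulr1. Qed.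

(** The difference of the integrands is dominated by e plus B' times the indicator of the complement
    of D. *)
Lemma le_normB_Rintegral f g (D : set T) e B B' : measurable_fun setT f ->
  measurable_fun setT g -> (forall x, `|f x| <= B) -> (forall x, `|g x| <= B) ->
  measurable D -> 0 <= e -> 0 <= B' -> (forall x, D x -> `|f x - g x| <= e) ->
  (forall x, `|f x - g x| <= B') -> (m (~` D) <= e%:E)%E ->
  `|\int[m]_x f x - \int[m]_x g x| <= e + B' * e.
Proof.
move=> mf mg fB gB mD e0 B'0 fge fgB' mDe.
have intf := bounded_integrable mf fB; have intg := bounded_integrable mg gB.
rewrite -RintegralB//.
have mfg : measurable_fun setT (fun x => f x - g x) by exact: measurable_funB.
have intfg := bounded_integrable mfg fgB'.
rewrite (le_trans (le_normr_Rintegral _ intfg))//.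
have mI : measurable_fun setT (\1_(~` D) : T -> R).
  by apply: measurable_indic; exact: measurableC.
have intI : m.-integrable setT (EFin \o (\1_(~` D) : T -> R)).
  apply: (@bounded_integrable _ 1) => // x.
  by rewrite indicE; case: (x \in _); rewrite ?normr0 ?normr1.
have le1 : forall x, `|f x - g x| <= e + B' * \1_(~` D) x.
  move=> x; rewrite indicE in_setC; have [/set_mem Dx|] := boolP (x \in D).
    by rewrite mulr0 addr0 fge.
  by move=> _; rewrite mulr1 (le_trans (fgB' x))// lerDr.
apply: (@le_trans _ _ (\int[m]_x (e + B' * \1_(~` D) x))).
  apply: le_Rintegral => //.
  - apply: (@bounded_integrable _ B') => [|x]; last by rewrite normr_id.
    exact: measurableT_comp.
  - apply: (@bounded_integrable _ (e + B')) => [|x].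
      by apply: measurable_funD => //; exact: measurable_funM.
    rewrite indicE ger0_norm; last by rewrite addr_ge0// mulr_ge0.
    by rewrite lerD2l ler_piMr//; case: (x \in _).
rewrite RintegralD//; last 2 first.
- by apply: (@bounded_integrable _ `|e|).
- apply: (@bounded_integrable _ B') => [|x]; first exact: measurable_funM.
  by rewrite indicE ger0_norm ?mulr_ge0// ler_piMr//; case: (x \in _).
rewrite Rintegral_cst1 lerD2l RintegralZl// ler_wpM2l//.
rewrite /Rintegral integral_indic//; last exact: measurableC.
rewrite setIT -lee_fin fineK//.
by rewrite ge0_fin_numE// (le_lt_trans mDe)// ltry.
Qed.

End unit_mass.

(** * Measurability for the product of Borel sigma-algebras *)

Section borel_measurability.
Context {R : realType}.

(** The real line carries here its own measurable structure, generated by the open intervals, rather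
    than [borel]. *)
Lemma continuous_measurable_borel (T : ptopologicalType) (f : T -> R) :
  continuous f -> measurable_fun setT (f : borel T -> R).
Proof.
move=> /continuousP cf; apply: (measurability _ (RGenOpens.measurableE R)).
move=> _ [_ [a [b ->] <-]]; rewrite setTI; apply: sub_sigma_algebra.
by apply: cf; exact: interval_open.
Qed.

Context {n : nat}.
Local Notation V := 'rV[R]_n.
Local Notation V2 := (borel V * borel V)%type.

Lemma continuous_dot (u : V) : continuous (dot u).
Proof.
move=> v.
have h j : xpredT j -> (fun w : V => u 0 j * w 0 j) w @[w --> v] --> u 0 j * v 0 j.
  move=> _; apply: (@cvgM R V (nbhs v) _ (fun=> u 0 j) (fun w : V => w 0 j)); first exact: cvg_cst.
  exact: coord_continuous.
exact: (@cvg_sumr R V 'I_n (nbhs v) (nbhs_filter v) _ _ _ _ h).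
Qed.

Lemma measurable_dot (u : V) : measurable_fun setT (dot u : borel V -> R).
Proof. by apply: continuous_measurable_borel; exact: continuous_dot. Qed.

Lemma measurable_dot2 (u v : V) :
  measurable_fun setT (fun x : V2 => dot u x.1 + dot v x.2).
Proof.
apply: measurable_funD.
  by apply: (measurableT_comp (measurable_dot u)); exact: measurable_fst.
by apply: (measurableT_comp (measurable_dot v)); exact: measurable_snd.
Qed.

Lemma measurable_coord c : measurable_fun setT (entry c : V2 -> R).
Proof.
have mj j : measurable_fun setT ((fun v : V => v 0 j) : borel V -> R).
  by apply: continuous_measurable_borel; exact: coord_continuous.
case: c => [[] j].
  by apply: (measurableT_comp (mj j)); exact: measurable_snd.
by apply: (measurableT_comp (mj j)); exact: measurable_fst.
Qed.

Lemma measurable_box L : measurable (box L : set V2).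
Proof.
have -> : (box L : set V2) = \bigcap_(c in [set: bool * 'I_n])
    ((entry c : V2 -> R) @^-1` [set t | `|t| <= L * (pi / 2)]).
  by apply/seteqP; split => x bx c => [_|]; [exact: bx|exact: (bx c Logic.I)].
apply: fin_bigcap_measurable => [|c _]; first exact: finite_finset.
rewrite -[X in measurable X]setTI; apply: measurable_coord => //.
rewrite (_ : [set t | _] = `[- (L * (pi / 2)), L * (pi / 2)]%classic)//.
by apply/seteqP; split => t /=; rewrite in_itv /= ler_norml.
Qed.

Lemma measurable_trig_poly f : trig_poly f -> measurable_fun setT (f : V2 -> R).
Proof.
move=> [s ->]; rewrite /trig_eval; apply: measurable_sum => t.
apply: measurable_funM => //.
apply: (@measurableT_comp _ _ _ _ _ _ (@cos R)).
  by apply: continuous_measurable_fun; exact: continuous_cos.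
by apply: measurable_funD => //; exact: measurable_dot2.
Qed.

Lemma bernstein_near (f : V * V -> R) B L e : 0 < L -> continuous f ->
  (forall x, `|f x| <= B) -> 0 < e ->
  \forall m \near \oo, forall x, box L x -> `|f x - bernstein L m f x| <= e.
Proof.
move=> L0 cf fB e0; have e20 : 0 < e / 2 by rewrite divr_gt0.
have [K K0 fK] := near_diagonal L0 cf fB e20.
pose a := K * #|{: bool * 'I_n}|%:R.
have a0 : 0 <= a by rewrite mulr_ge0.
near=> m => x bx.
have m0 : (0 < m)%N by near: m; exact: nbhs_infty_gt.
rewrite (le_trans (bernstein_approx L0 m0 K0 fK bx))// [leRHS]splitr lerD2l.
have mR : 0 < m%:R :> R by rewrite ltr0n.
rewrite mulrA ler_pdivrMr// [leRHS]mulrC -ler_pdivrMr// -/a.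
by near: m; exact: nbhs_infty_ger.
Unshelve. all: by end_near. Qed.

(* The product sigma-algebra is fine enough: a bounded continuous function is
   the pointwise limit of trigonometric polynomials on every box. *)
Lemma measurable_continuous2 (f : V * V -> R) B : continuous f ->
  (forall x, `|f x| <= B) -> measurable_fun setT (f : V2 -> R).
Proof.
move=> cf fB.
have -> : [set: V2] = \bigcup_k (box k.+1%:R : set V2).
  apply/esym; rewrite -subTset => x _.
  exists (Num.truncn (\sum_c `|entry c x|)) => // c.
  apply: (@le_trans _ _ (\sum_c `|entry c x|)).
    by rewrite (bigD1 c)//= lerDl sumr_ge0.
  apply: (@le_trans _ _ (Num.truncn (\sum_c `|entry c x|)).+1%:R).
    by apply: ltW; exact: truncnS_gt.
  by rewrite ler_peMr//; exact: pihalf_ge1.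
apply/measurable_fun_bigcup => [k|k]; first exact: measurable_box.
apply: (@measurable_fun_cvg _ V2 R (box k.+1%:R) (fun m => bernstein k.+1%:R m f)).
  by move=> m; apply: measurable_funTS; apply: measurable_trig_poly; exact: trig_poly_bernstein.
move=> x bx; apply/cvgrPdist_le => e e0.
have := @bernstein_near f B k.+1%:R e (ltr0Sn _ _) cf fB e0.
by apply: filterS => m; apply.
Qed.

End borel_measurability.

Section levy_continuity.
Context {R : realType} {n : nat}.
Local Notation V := 'rV[R]_n.
Local Notation V2 := (borel V * borel V)%type.
Implicit Types (m : {measure set V2 -> \bar R}).

Lemma Re_charfun m u v : complex.Re (charfun m u v) = \int[m]_x cos (dot u x.1 + dot v x.2).
Proof.
have -> : complex.Re (charfun m u v) =
  \int[m]_x complex.Re (expi (dot u x.1 + dot v x.2)) by [].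
by apply: eq_Rintegral => x _; rewrite expiE.
Qed.

Lemma Im_charfun m u v : complex.Im (charfun m u v) = \int[m]_x sin (dot u x.1 + dot v x.2).
Proof.
have -> : complex.Im (charfun m u v) =
  \int[m]_x complex.Im (expi (dot u x.1 + dot v x.2)) by [].
by apply: eq_Rintegral => x _; rewrite expiE.
Qed.

Lemma measurable_cos_dot2 (u v : V) :
  measurable_fun setT (fun x : V2 => cos (dot u x.1 + dot v x.2)).
Proof.
apply: (@measurableT_comp _ _ _ _ _ _ (@cos R)); last exact: measurable_dot2.
by apply: continuous_measurable_fun; exact: continuous_cos.
Qed.

Lemma measurable_sin_dot2 (u v : V) :
  measurable_fun setT (fun x : V2 => sin (dot u x.1 + dot v x.2)).
Proof.
apply: (@measurableT_comp _ _ _ _ _ _ (@sin R)); last exact: measurable_dot2.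
by apply: continuous_measurable_fun; exact: continuous_sin.
Qed.

(** The phase is split off by the addition formula, so the integral is a fixed linear combination of
    values of the characteristic function and inherits its convergence. *)
Lemma Rintegral_trig_eval m (s : seq (R * (V * V) * R)) : m setT = 1%E ->
  \int[m]_x trig_eval s x = \sum_(t <- s) t.1.1 *
    (cos t.2 * complex.Re (charfun m t.1.2.1 t.1.2.2) -
     sin t.2 * complex.Im (charfun m t.1.2.1 t.1.2.2)).
Proof.
move=> m1; have int1 s' : m.-integrable setT (EFin \o (trig_eval s' : V2 -> R)).
  apply: (@bounded_integrable _ _ _ _ m1 _ (\sum_(t <- s') `|t.1.1|)).
    by apply: measurable_trig_poly; exists s'.
  move=> x; rewrite (le_trans (ler_norm_sum _ _ _))//.
  by apply: ler_sum => t _; rewrite normrM ler_piMr//; exact: cos_max.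
have intc u v := @bounded_integrable _ _ _ _ m1 _ 1 (measurable_cos_dot2 u v) (fun x => cos_max _).
have ints u v := @bounded_integrable _ _ _ _ m1 _ 1 (measurable_sin_dot2 u v) (fun x => sin_max _).
elim: s => [|t s IHs].
  rewrite big_nil; under eq_Rintegral do rewrite /trig_eval big_nil.
  by rewrite Rintegral_cst1.
rewrite big_cons -IHs.
transitivity (\int[m]_x (t.1.1 * (cos t.2 * cos (dot t.1.2.1 x.1 + dot t.1.2.2 x.2) -
   sin t.2 * sin (dot t.1.2.1 x.1 + dot t.1.2.2 x.2)) + trig_eval s x)).
  apply: eq_Rintegral => x _; rewrite /trig_eval big_cons cosD; congr (_ * _ + _).
  by ring.
have intZ (a : R) (f : V2 -> R) : m.-integrable setT (EFin \o f) ->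
    m.-integrable setT (EFin \o (fun x => a * f x)).
  by move=> intf; rewrite /comp; under eq_fun do rewrite EFinM; exact: integrableZl.
have intB (f g : V2 -> R) : m.-integrable setT (EFin \o f) ->
    m.-integrable setT (EFin \o g) -> m.-integrable setT (EFin \o (fun x => f x - g x)).
  by move=> intf intg; rewrite /comp; under eq_fun do rewrite EFinB; exact: integrableB.
rewrite (RintegralD measurableT (intZ t.1.1 _ (intB _ _
  (intZ (cos t.2) _ (intc t.1.2.1 t.1.2.2)) (intZ (sin t.2) _ (ints t.1.2.1 t.1.2.2)))) (int1 s)).
congr (_ + _); rewrite RintegralZl//; last by apply: intB; apply: intZ.
congr (_ * _); rewrite RintegralB//; [|exact: intZ..].
by rewrite !RintegralZl// Re_charfun Im_charfun.
Qed.

Lemma cvg_Rintegral_trig_poly (mu : nat -> {measure set V2 -> \bar R})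
    (nu : {measure set V2 -> \bar R}) (f : V * V -> R) :
  (forall k, mu k setT = 1%E) -> nu setT = 1%E ->
  (forall u v, charfun (mu k) u v @[k --> \oo] --> charfun nu u v) ->
  trig_poly f -> \int[mu k]_x f x @[k --> \oo] --> \int[nu]_x f x.
Proof.
move=> mu1 nu1 cmu [s ->].
under eq_fun do rewrite Rintegral_trig_eval//; rewrite Rintegral_trig_eval//.
apply: cvg_big => [|t _]; first exact: add_continuous.
have cR := @cvg_Re _ _ _ eventually_filter _ _ (cmu t.1.2.1 t.1.2.2).
have cI := @cvg_Im _ _ _ eventually_filter _ _ (cmu t.1.2.1 t.1.2.2).
by apply: cvgM; [exact: cvg_cst|apply: cvgB; apply: cvgM => //; exact: cvg_cst].
Qed.

Lemma sub_box (L L' : R) : L <= L' -> (box L : set (V * V)) `<=` box L'.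
Proof.
move=> LL x bx c; rewrite (le_trans (bx c))// ler_wpM2r//.
by rewrite divr_ge0// pi_ge0.
Qed.

(** The boxes increase to the whole space, so a single law is tight by continuity from below. This
    handles the limit law. *)
Lemma box_tight (nu : {measure set V2 -> \bar R}) e : nu setT = 1%E -> 0 < e ->
  \forall k \near \oo, (nu (~` (box k%:R : set V2)) <= e%:E)%E.
Proof.
move=> nu1 e0.
have cb : nu (box k%:R) @[k --> \oo] --> nu (\bigcup_k (box k%:R : set V2)).
  apply: nondecreasing_cvg_mu => //.
  - by move=> k; exact: measurable_box.
  - by apply: bigcup_measurable => k _; exact: measurable_box.
  - by move=> k l kl; apply/subsetPset; apply: sub_box; rewrite ler_nat.
have bT : \bigcup_k (box k%:R : set V2) = setT.
  rewrite -subTset => x _.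
  exists (Num.truncn (\sum_c `|entry c x|)).+1 => // c.
  apply: (@le_trans _ _ (\sum_c `|entry c x|)).
    by rewrite (bigD1 c)//= lerDl sumr_ge0.
  apply: (@le_trans _ _ (Num.truncn (\sum_c `|entry c x|)).+1%:R).
    by apply: ltW; exact: truncnS_gt.
  by rewrite ler_peMr//; exact: pihalf_ge1.
rewrite bT nu1 in cb.
have fin_b k : nu (box k%:R : set V2) \is a fin_num.
  rewrite ge0_fin_numE// (@le_lt_trans _ _ 1%E) ?ltry// -nu1.
  by rewrite le_measure ?inE//; exact: measurable_box.
have /fine_cvgP[_ /cvgrPdist_le /(_ e e0)] := cb.
apply: filterS => k /= le_e.
have := measureU nu (@measurable_box R n k%:R) (measurableC (@measurable_box R n k%:R)) (setICr _).
rewrite setUv => E0; have {E0}E := etrans (esym nu1) E0.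
have finC : nu (~` (box k%:R : set V2)) \is a fin_num.
  rewrite ge0_fin_numE// (@le_lt_trans _ _ 1%E) ?ltry// -nu1.
  by rewrite le_measure ?inE//; apply: measurableC; exact: measurable_box.
rewrite -(fineK finC) lee_fin; apply: le_trans le_e; rewrite (le_trans _ (ler_norm _))//.
by rewrite lerBrDr addrC -lee_fin EFinD !fineK// -E.
Qed.

Theorem levy_continuity (mu : nat -> {measure set V2 -> \bar R})
    (nu : {measure set V2 -> \bar R}) :
  (forall k, mu k setT = 1%E) -> nu setT = 1%E ->
  (forall u v, charfun (mu k) u v @[k --> \oo] --> charfun nu u v) ->
  (forall e : R, 0 < e -> exists L, \forall k \near \oo, (mu k (~` (box L : set V2)) <= e%:E)%E) ->
  weak_cvg mu nu.
Proof.
move=> mu1 nu1 cmu tmu f cf [B fB].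
have B0 : 0 <= B by exact: le_trans (fB (0, 0)).
have mf := measurable_continuous2 cf fB.
apply/cvgrPdist_lt => e e0.
have B10 : 0 < 1 + 2 * B by rewrite ltr_pwDl// mulr_ge0.
have D0 : 0 < 4 * (1 + 2 * B) by rewrite mulr_gt0.
(* [le_normB_Rintegral] loses a + 2 B a = e / 4, once for the limit and once for mu k; the
   polynomial itself costs another e / 4. *)
pose a := e / (4 * (1 + 2 * B)).
have a0 : 0 < a by rewrite divr_gt0.
have [L0 tL0] := tmu a a0.
have [L [L_gt0 tL nL]] : exists L, [/\ 0 < L,
    \forall k \near \oo, (mu k (~` (box L : set V2)) <= a%:E)%E &
    (nu (~` (box L : set V2)) <= a%:E)%E].
  (* A large integer serves as half-side for both: for the limit by [box_tight], for mu because
     enlarging the box L0 preserves the bound. *)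
  near \oo => k.
  have k0 : 0 < (k%:R : R) by rewrite ltr0n; near: k; exact: nbhs_infty_gt.
  exists k%:R; split => //; last by near: k; exact: box_tight.
  apply: filterS tL0 => l; apply: le_trans.
  have L0k : L0 <= k%:R by near: k; exact: nbhs_infty_ger.
  rewrite le_measure ?inE//; do ?[by apply: measurableC; exact: measurable_box].
  by apply: subsetC; exact: sub_box.
near \oo => m.
have fm : forall x, box L x -> `|f x - bernstein L m f x| <= a.
  by near: m; exact: bernstein_near.
have bB x := norm_bernstein_le L m x fB.
have tb : trig_poly (bernstein L m f) by exact: trig_poly_bernstein.
have mb := measurable_trig_poly tb.
have fb2 x : `|f x - bernstein L m f x| <= 2 * B.
  by rewrite (le_trans (ler_normB _ _))// mulrDl mul1r lerD.
have B20 : 0 <= 2 * B by rewrite mulr_ge0.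
have close (q : {measure set V2 -> \bar R}) : q setT = 1%E ->
    (q (~` (box L : set V2)) <= a%:E)%E ->
    `|\int[q]_x f x - \int[q]_x bernstein L m f x| <= e / 4.
  move=> q1 qL.
  apply: (le_trans (le_normB_Rintegral q1 mf mb fB bB (@measurable_box _ _ L) (ltW a0) B20 fm fb2 qL)).
  rewrite -[X in X + _]mul1r -mulrDl le_eqVlt; apply/orP; left; apply/eqP.
  by rewrite /a; field; rewrite gt_eqF.
have cb := cvg_Rintegral_trig_poly mu1 nu1 cmu tb.
near=> k.
have h1 := close _ nu1 nL.
have h2 : `|\int[mu k]_x f x - \int[mu k]_x bernstein L m f x| <= e / 4.
  by apply: close => //; near: k.
have h3 : `|\int[nu]_x bernstein L m f x - \int[mu k]_x bernstein L m f x| < e / 4.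
  by near: k; move/cvgrPdist_lt : cb; apply; rewrite divr_gt0.
rewrite (_ : _ - _ = (\int[nu]_x f x - \int[nu]_x bernstein L m f x) +
  (\int[nu]_x bernstein L m f x - \int[mu k]_x bernstein L m f x) -
  (\int[mu k]_x f x - \int[mu k]_x bernstein L m f x)); last by ring.
rewrite (le_lt_trans (ler_normB _ _))//; have := ler_normD
  (\int[nu]_x f x - \int[nu]_x bernstein L m f x)
  (\int[nu]_x bernstein L m f x - \int[mu k]_x bernstein L m f x).
by lra.
Unshelve. all: by end_near. Qed.

End levy_continuity.

(** * Compound Poisson laws *)

Section integral_dirac_sum.
Context d {T : measurableType d} {R : realType} {I : finType}.
Context (Q : pred I) (c : I -> {nonneg R}) (z : I -> T).
Local Open Scope ereal_scope.

Lemma dirac_sumE (A : set T) :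
  dirac_sum Q c z A = (\sum_(i | Q i) (c i)%:num * \1_A (z i))%R%:E.
Proof. by rewrite /dirac_sum -sumEFin; apply: eq_bigr => i _; rewrite EFinM. Qed.

Lemma ge0_integral_dirac_sum (f : T -> \bar R) :
  measurable_fun setT f -> (forall x, 0 <= f x) ->
  \int[dirac_sum Q c z]_x f x = \sum_(i | Q i) (c i)%:num%:E * f (z i).
Proof.
move=> mf f0.
(* The finite sum is recast as a sum over natural numbers, to which additivity of the integral in
   the measure applies; indices outside Q get the zero measure. *)
pose m (k : nat) : {measure set T -> \bar R} :=
  if insub k is Some j then
    if Q (enum_val j) then
      (mscale (c (enum_val (j : 'I_#|I|))) (dirac (z (enum_val j))) : {measure set T -> \bar R})
    else (mzero : {measure set T -> \bar R})
  else (mzero : {measure set T -> \bar R}).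
have mE (j : 'I_#|I|) : m j = if Q (enum_val j) then
    (mscale (c (enum_val j)) (dirac (z (enum_val j))) : {measure set T -> \bar R})
    else (mzero : {measure set T -> \bar R}).
  by rewrite /m valK.
have sumE (F : I -> \bar R) : \sum_(i | Q i) F i =
    \sum_(j < #|I|) if Q (enum_val j) then F (enum_val j) else 0.
  by rewrite big_mkcond (reindex _ (onW_bij _ (enum_val_bij I))).
rewrite (eq_measure_integral (msum m #|I|)); last first.
  move=> A mA _; rewrite /msum [LHS]sumE; apply: eq_bigr => j _.
  by rewrite mE; case: ifP.
rewrite ge0_integral_measure_sum// sumE; apply: eq_bigr => j _.
rewrite mE; case: ifP => _; last by rewrite integral_measure_zero.
by rewrite ge0_integral_mscale// integral_dirac// diracT mul1e.
Qed.

Lemma Rintegral_dirac_sum (f : T -> R) : measurable_fun setT f ->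
  (\int[dirac_sum Q c z]_x f x = \sum_(i | Q i) (c i)%:num * f (z i))%R.
Proof.
move=> mf; rewrite /Rintegral integralE.
have mfE : measurable_fun setT (EFin \o f) by exact/measurable_EFinP.
rewrite !ge0_integral_dirac_sum//; [|exact: measurable_funeneg|exact: measurable_funepos].
rewrite (eq_bigr (fun i => ((c i)%:num * Num.max (f (z i)) 0)%:E)); last first.
  by move=> i _; rewrite funepos.unlock /= -EFin_max EFinM.
rewrite [X in _ - X](eq_bigr (fun i => ((c i)%:num * Num.max (- f (z i)) 0)%:E)); last first.
  by move=> i _; rewrite funeneg.unlock /= -EFin_max EFinM.
rewrite !sumEFin /= -sumrB; apply: eq_bigr => i _; rewrite -mulrBr; congr (_ * _)%R.
by case: (leP (f (z i)) 0)%R => fz; case: (leP (- f (z i)) 0)%R => fz' /=; lra.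
Qed.

End integral_dirac_sum.

Section compound_poisson_law.
Context {R : realType} {n : nat} {I : finType}.
Context (c : I -> {nonneg R}) (z : I -> 'rV[R]_n).
Local Notation V := 'rV[R]_n.
Local Notation nu := (dirac_sum xpredT c (z : I -> borel V)).

(** nu is a finite sum of weighted Dirac masses, hence so is its k-fold convolution power: its atoms
    are indexed by words of length k, with multiplied weights and added jumps. *)
Fixpoint words (k : nat) : finType := if k is k'.+1 then (I * words k')%type else unit.

Fixpoint word_weight (k : nat) : words k -> {nonneg R} :=
  if k is k'.+1 then fun w : I * words k' => ((c w.1)%:num * (word_weight w.2)%:num)%:nng
  else fun=> 1%:nng.

Fixpoint word_sum (k : nat) : words k -> V :=
  if k is k'.+1 then fun w : I * words k' => z w.1 + word_sum w.2 else fun=> 0.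

Definition word_law (k : nat) : set (borel V) -> \bar R :=
  dirac_sum xpredT (@word_weight k) (@word_sum k : words k -> borel V).

HB.instance Definition _ k := Measure.on (word_law k).

Definition total_rate : R := \sum_i (c i)%:num.

Lemma big_words (U : nmodType) k (F : words k.+1 -> U) :
  \sum_(w : words k.+1) F w = \sum_i \sum_(w : words k) F (i, w).
Proof. by rewrite pair_bigA; apply: eq_bigr => -[]. Qed.

Lemma big_words0 (U : nmodType) (F : words 0 -> U) : \sum_(w : words 0) F w = F tt.
Proof. by rewrite (bigD1 tt)//= big1 ?addr0// => -[]. Qed.

Lemma sum_word_weight k : \sum_(w : words k) (word_weight w)%:num = total_rate ^+ k.
Proof.
elim: k => [|k IHk]; first by rewrite big_words0.
rewrite big_words exprS mulr_suml; apply: eq_bigr => i _.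
by rewrite /= -mulr_sumr IHk.
Qed.

(** The Fourier transform turns convolution powers into powers. *)
Lemma word_weight_expi k v :
  \sum_(w : words k) (word_weight w)%:num%:C%C * expi (dot v (word_sum w)) =
  (\sum_i (c i)%:num%:C%C * expi (dot v (z i))) ^+ k.
Proof.
elim: k => [|k IHk].
  by rewrite big_words0 /= dotC dot0l expi0 mul1r.
rewrite big_words exprS mulr_suml; apply: eq_bigr => i _.
rewrite -IHk mulr_sumr; apply: eq_bigr => w _ /=.
by rewrite rmorphM dotC dotDl expiD ![dot _ v]dotC; ring.
Qed.

Lemma measurable_addr (a : V) : measurable_fun setT (fun x : borel V => (x + a : borel V)).
Proof.
apply: (@continuous_borel_measurable V V (fun x => x + a)) => x.
exact: (cvgD cvg_id (cvg_cst a)).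
Qed.

Lemma measurable_addl (a : V) : measurable_fun setT (fun x : borel V => (a + x : borel V)).
Proof.
rewrite (_ : (fun x => _) = (fun x : borel V => ((x : V) + a : borel V))).
  exact: measurable_addr.
by apply/funext => x; exact: addrC.
Qed.

Lemma measurable_translate (A : set (borel V)) (a : V) : measurable A ->
  measurable ([set y : V | A (a + y)] : set (borel V)).
Proof. by move=> mA; rewrite -[X in measurable X]setTI; exact: measurable_addl. Qed.

(** Measurability of A makes the mass of its translates a measurable function of the translation, as
    integration against nu requires. *)
Lemma convolution_power_word_law k (A : set (borel V)) : measurable A ->
  convolution_power nu k A = word_law k A.
Proof.
elim: k A => [|k IHk] A mA.
  by rewrite /word_law dirac_sumE big_words0 mul1r.
transitivity (\int[nu]_x word_law k [set y : V | A ((x : V) + y)%R])%E.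
  by apply: eq_integral => x _; exact: IHk (measurable_translate _ mA).
rewrite ge0_integral_dirac_sum//; last first.
  under eq_fun do rewrite /word_law dirac_sumE.
  apply/measurable_EFinP; apply: measurable_sum => w; apply: measurable_funM => //.
  rewrite (_ : (fun x => _) = (\1_A : borel V -> R) \o
      (fun x : borel V => ((x : V) + word_sum w : borel V))).
    apply: measurableT_comp; last exact: measurable_addr.
    exact: measurable_indic.
  by apply/funext => x; rewrite /= !indicE; congr (_%:R); congr nat_of_bool; apply/idP/idP; rewrite !inE.
rewrite /word_law dirac_sumE big_words -sumEFin; apply: eq_bigr => i _.
rewrite dirac_sumE -EFinM mulr_sumr; congr EFin; apply: eq_bigr => w _.
by rewrite mulrA.
Qed.

(** [compound_poisson] is a bare set function. The same series is rebuilt from [mseries] and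
    [mscale] so as to be a measure that can be integrated against. *)
Definition compound_series : set (borel V) -> \bar R :=
  mseries (fun k => mscale (k`!%:R^-1)%:nng (word_law k)) 0.

HB.instance Definition _ := Measure.on compound_series.

Definition compound_law : set (borel V) -> \bar R :=
  mscale (NngNum (expR_ge0 (- total_rate))) compound_series.

HB.instance Definition _ := Measure.on compound_law.

Lemma total_rateE : fine (nu setT) = total_rate.
Proof. by rewrite dirac_sumE /=; apply: eq_bigr => i _; rewrite indicT mulr1. Qed.

Lemma compound_poissonE (A : set (borel V)) : measurable A ->
  compound_poisson nu A = compound_law A.
Proof.
move=> mA; rewrite /compound_poisson total_rateE; congr (_ * _)%E.
apply: eq_eseriesr => k _; congr (_ * _)%E; exact: convolution_power_word_law.
Qed.

(** Nonnegativity of f lets the integral be exchanged with the series without prior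
    integrability. *)
Lemma Rintegral_compound_law (f : V -> R) (l : R) :
  measurable_fun setT (f : borel V -> R) -> (forall x, 0 <= f x) ->
  \sum_(k < N.+1) k`!%:R^-1 * \sum_(w : words k) (word_weight w)%:num * f (word_sum w)
    @[N --> \oo] --> l ->
  \int[compound_law]_x f x = expR (- total_rate) * l.
Proof.
move=> mf f0 cl; have mfE : measurable_fun setT (EFin \o (f : borel V -> R)) by exact/measurable_EFinP.
rewrite /Rintegral ge0_integral_mscale//; last by move=> x _; rewrite lee_fin.
rewrite ge0_integral_measure_series//; last by move=> x _; rewrite lee_fin.
under eq_eseriesr => k _.
  rewrite ge0_integral_mscale//; last by move=> x _; rewrite lee_fin.
  rewrite (@ge0_integral_dirac_sum _ _ _ _ xpredT (@word_weight k) (@word_sum k : words k -> borel V))//.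
  under eq_bigr do rewrite -EFinM.
  rewrite sumEFin -EFinM.
  over.
rewrite (_ : (\sum_(_ <oo) _)%E = l%:E)//.
apply/cvg_lim => //; rewrite -(cvg_shiftS _ (nbhs l%:E)) /=.
apply: cvg_EFin; first by apply: nearW => N; rewrite sumEFin.
apply: cvg_trans cl; apply: near_eq_cvg; apply: nearW => N /=.
by rewrite sumEFin /= big_mkord.
Qed.

(** [fine] sends both infinities to 0, so the value 1 can only come from 1. *)
Let fine_eq1 (x : \bar R) : fine x = 1 -> x = 1%E.
Proof. by case: x => [r /= ->||] // /eqP; rewrite /= eq_sym oner_eq0. Qed.

Lemma compound_law_setT : compound_law setT = 1%E.
Proof.
have H := @Rintegral_compound_law (fun=> 1) (expR total_rate).
have : \int[compound_law]_x (1 : R) = 1.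
  rewrite H//; first by rewrite expRN mulVf// gt_eqF// expR_gt0.
  have : series (exp_coeff total_rate) N.+1 @[N --> \oo] --> expR total_rate.
    by rewrite cvg_shiftS; exact: is_cvg_series_exp_coeff.
  apply: cvg_trans; apply: near_eq_cvg; apply: nearW => N.
  rewrite /series /= big_mkord; apply: eq_bigr => k _.
  under eq_bigr do rewrite mulr1.
  by rewrite sum_word_weight /exp_coeff mulrC.
rewrite /Rintegral integral_cst// mul1e.
exact: fine_eq1.
Qed.

End compound_poisson_law.

Section compound_poisson_charfun.
Context {R : realType} {n : nat} {I : finType}.
Context (c : I -> {nonneg R}) (z : I -> 'rV[R]_n).
Local Notation V := 'rV[R]_n.
Local Notation law := (compound_law c z).

Let phi v : R[i] := \sum_i (c i)%:num%:C%C * expi (dot v (z i)).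

Let cexp_phi v : cexp (\sum_i (c i)%:num%:C%C * (expi (dot v (z i)) - 1)) =
  (expR (- total_rate c))%:C%C * cexp (phi v).
Proof.
have -> : \sum_i (c i)%:num%:C%C * (expi (dot v (z i)) - 1) = (- total_rate c)%:C%C + phi v.
  rewrite addrC rmorphN rmorph_sum /phi -sumrB; apply: eq_bigr => i _.
  by rewrite mulrBr mulr1.
by rewrite cexpD; congr (_ * _); rewrite /cexp /= cos0 sin0 mulr1 mulr0.
Qed.

(** One computation for F = Re with t = cos and for F = Im with t = sin. The summand 1 keeps the
    integrand nonnegative and adds exp of the total rate. *)
Let sum_weights v (F : R[i] -> R) (t : R -> R) : {morph F : x y / x + y} -> F 0 = 0 ->
  (forall a x, F (a%:C%C * x) = a * F x) -> (forall x, F (expi x) = t x) ->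
  (forall (u : nat -> R[i]) l, (u k : R[i]^o) @[k --> \oo] --> (l : R[i]^o) ->
     F (u k) @[k --> \oo] --> F l) ->
  \sum_(k < N.+1) k`!%:R^-1 *
    (\sum_(w : words k) (word_weight c w)%:num * (1 + t (dot v (word_sum z w))))
    @[N --> \oo] --> expR (total_rate c) + F (cexp (phi v)).
Proof.
move=> FD F0 FZ Ft Fc.
have Fsum (J : Type) (s : seq J) (G : J -> R[i]) :
    F (\sum_(j <- s) G j) = \sum_(j <- s) F (G j).
  by elim/big_rec2: _ => // j y x _ <-; rewrite FD.
have cF := Fc _ _ (@cvg_series_cexp _ (phi v)).
have cr : series (exp_coeff (total_rate c)) N.+1 @[N --> \oo] --> expR (total_rate c).
  by rewrite cvg_shiftS; exact: is_cvg_series_exp_coeff.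
apply: cvg_trans (cvgD cr cF); apply: near_eq_cvg; apply: nearW => N.
rewrite fctE /series /= big_mkord Fsum -big_split /=; apply: eq_bigr => k _.
have -> : (k`!%:R^-1 : R[i]) = (k`!%:R^-1)%:C%C by rewrite natrc fmorphV.
rewrite FZ (_ : exp_coeff _ _ = k`!%:R^-1 * total_rate c ^+ k); last exact: mulrC.
rewrite -mulrDr; congr (_ * _).
rewrite -sum_word_weight /phi -word_weight_expi Fsum -big_split /=.
by apply: eq_bigr => w _; rewrite FZ Ft mulrDr mulr1.
Qed.

Let intlaw (f : V -> R) : measurable_fun setT (f : borel V -> R) -> (forall x, `|f x| <= 1) ->
  law.-integrable setT (EFin \o (f : borel V -> R)).
Proof. exact: bounded_integrable (compound_law_setT c z) _ _. Qed.

(** A function of arbitrary sign bounded by 1 is reached from the nonnegative 1 + f, the total mass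
    being 1. *)
Let Rintegral_1D (f : V -> R) l : measurable_fun setT (f : borel V -> R) ->
  (forall x, `|f x| <= 1) ->
  \int[law]_x (1 + f x) = expR (- total_rate c) * (expR (total_rate c) + l) ->
  \int[law]_x f x = expR (- total_rate c) * l.
Proof.
move=> mf f1; rewrite RintegralD//; last 2 first.
- by apply: intlaw => // x; rewrite normr1.
- exact: intlaw.
rewrite Rintegral_cst1; last exact: compound_law_setT.
by rewrite mulrDr expRN mulVf ?gt_eqF ?expR_gt0// => /addrI.
Qed.

Let norm1D (t : R) : `|t| <= 1 -> 0 <= 1 + t.
Proof. by rewrite ler_norml => /andP[? _]; rewrite -lerBlDl sub0r. Qed.

Lemma measurable_cos_dot (v : V) : measurable_fun setT (fun x : borel V => cos (dot v x)).
Proof.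
apply: (@measurableT_comp _ _ _ _ _ _ (@cos R)); last exact: measurable_dot.
by apply: continuous_measurable_fun; exact: continuous_cos.
Qed.

Lemma measurable_sin_dot (v : V) : measurable_fun setT (fun x : borel V => sin (dot v x)).
Proof.
apply: (@measurableT_comp _ _ _ _ _ _ (@sin R)); last exact: measurable_dot.
by apply: continuous_measurable_fun; exact: continuous_sin.
Qed.

Lemma compound_law_cos v : \int[law]_x cos (dot v x) =
  complex.Re (cexp (\sum_i (c i)%:num%:C%C * (expi (dot v (z i)) - 1))).
Proof.
rewrite cexp_phi ReM /= mul0r subr0; apply: Rintegral_1D.
- exact: measurable_cos_dot.
- by move=> x; exact: cos_max.
apply: Rintegral_compound_law.
- by apply: measurable_funD => //; exact: measurable_cos_dot.
- by move=> x; apply: norm1D; exact: cos_max.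
apply: (@sum_weights v (@complex.Re R) cos) => //.
- exact: ReD.
- by move=> a x; rewrite ReM /= mul0r subr0.
- by move=> x; rewrite expiE.
- by move=> u l; exact: cvg_Re.
Qed.

Lemma compound_law_sin v : \int[law]_x sin (dot v x) =
  complex.Im (cexp (\sum_i (c i)%:num%:C%C * (expi (dot v (z i)) - 1))).
Proof.
rewrite cexp_phi ImM /= mul0r addr0; apply: Rintegral_1D.
- exact: measurable_sin_dot.
- by move=> x; exact: sin_max.
apply: Rintegral_compound_law.
- by apply: measurable_funD => //; exact: measurable_sin_dot.
- by move=> x; apply: norm1D; exact: sin_max.
apply: (@sum_weights v (@complex.Im R) sin) => //.
- exact: ImD.
- by move=> a x; rewrite ImM /= mul0r addr0.
- by move=> x; rewrite expiE.
- by move=> u l; exact: cvg_Im.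
Qed.

End compound_poisson_charfun.

(** * Words grouped by letter counts, and sums of independent Poisson multiples *)

Section poisson_counts.
Context {R : realType} {n : nat} {I : finType}.
Context (c : I -> {nonneg R}) (z : I -> 'rV[R]_n) (B : nat).
Local Notation V := 'rV[R]_n.
Local Notation counts := {ffun I -> 'I_B.+1}.
Implicit Types (m : counts) (f : V -> R).

Definition count_sum m : V := \sum_i (m i : nat)%:R *: z i.

(** A product of Poisson masses without the normalizing factors exp (- c i). *)
Definition count_weight m : R := \prod_i ((c i)%:num ^+ m i / (m i)`!%:R).

Definition count_total m : nat := \sum_i m i.

Let count_mean k f : R :=
  \sum_(m | count_total m == k) count_weight m * f (count_sum m).

(** Counts are capped at B so as to form a finite type. As [inord] falls back to a default beyond B,
    incrementing is faithful when the total is below B; decrementing always is. *)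
Let incr i m : counts := [ffun j => inord (m j + (j == i))].
Let decr i m : counts := [ffun j => inord (m j - (j == i))].

Let le_total m j : (m j <= count_total m)%N.
Proof. by rewrite /count_total (bigD1 j)//= leq_addr. Qed.

Let decrE i m j : decr i m j = (m j - (j == i))%N :> nat.
Proof. by rewrite ffunE inordK// ltnS (leq_trans (leq_subr _ _))// -ltnS. Qed.

Let incrE i m j : (count_total m < B)%N -> incr i m j = (m j + (j == i))%N :> nat.
Proof.
move=> mB; rewrite ffunE inordK// ltnS; have := le_total m j.
by case: (j == i); rewrite ?addn1 ?addn0 => mj; [exact: leq_ltn_trans mj mB|exact: leq_trans mj (ltnW mB)].
Qed.

Let incr_total i m : (count_total m < B)%N -> count_total (incr i m) = (count_total m).+1.
Proof.
move=> mB; rewrite /count_total; under eq_bigr do rewrite incrE//.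
by rewrite big_split /= -[RHS]addn1; congr addn; rewrite (bigD1 i)//= eqxx big1// => j /negbTE ->.
Qed.

Let decrK i m : (0 < m i)%N -> count_total m = (count_total (decr i m)).+1.
Proof.
move=> mi; rewrite /count_total (bigD1 i)//= [in RHS](bigD1 i)//= decrE eqxx subn1.
rewrite -addSn prednK//; congr addn; apply: eq_bigr => j ji.
by rewrite decrE (negbTE ji) subn0.
Qed.

Let count_weight_incr i m : (count_total m < B)%N ->
  (incr i m i)%:R * count_weight (incr i m) = (c i)%:num * count_weight m.
Proof.
move=> mB; rewrite /count_weight (bigD1 i)//= [in RHS](bigD1 i)//= !mulrA incrE// eqxx addn1.
congr (_ * _).
  have a0 : ((m i).+1%:R : R) != 0 by rewrite pnatr_eq0.
  have f0 : ((m i)`!%:R : R) != 0 by rewrite pnatr_eq0 -lt0n fact_gt0.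
  by rewrite factS natrM exprS invfM mulrACA mulfV// mul1r.
by apply: eq_bigr => j ji; rewrite incrE// (negbTE ji) addn0.
Qed.

Let count_sum_incr i m : (count_total m < B)%N -> count_sum (incr i m) = z i + count_sum m.
Proof.
move=> mB; rewrite /count_sum (bigD1 i)//= [in RHS](bigD1 i)//= incrE// eqxx addrA.
congr (_ + _); first by rewrite natrD scalerDl scale1r addrC.
by apply: eq_bigr => j ji; rewrite incrE// (negbTE ji) addn0.
Qed.

(** Write k + 1 as the sum of the m i and remove one jump of type i: m i times the weight of m is c
    i times the weight of the reduced count. Removing the first letter gives words the same
    recursion, up to the factor k + 1. *)
Let count_meanS k f : (k < B)%N ->
  k.+1%:R * count_mean k.+1 f = \sum_i (c i)%:num * count_mean k (fun y => f (z i + y)).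
Proof.
move=> kB.
have -> : k.+1%:R * count_mean k.+1 f = \sum_i \sum_(m | count_total m == k.+1)
    (m i)%:R * (count_weight m * f (count_sum m)).
  rewrite exchange_big mulr_sumr; apply: eq_bigr => m /eqP <-.
  by rewrite /count_total natr_sum mulr_suml.
(* Counts with m i = 0 contribute nothing; on the others, removing and adding one jump of type i are
   inverse bijections. *)
apply: eq_bigr => i _; rewrite mulr_sumr (bigID (fun m : counts => (0 < m i)%N)) /=.
rewrite [X in _ + X]big1 ?addr0; last first.
  by move=> m /andP[_]; rewrite -eqn0Ngt => /eqP ->; rewrite mul0r.
rewrite (reindex_onto (incr i) (decr i)) /=; last first.
  move=> m /andP[/eqP mk mi]; apply/ffunP => j; apply: val_inj.
  have := decrK mi; rewrite mk => -[Ek]; rewrite /= incrE -?Ek// decrE.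
  by case: eqP => [->|_]; rewrite ?subnK// subn0 addn0.
rewrite (eq_bigl (fun m => count_total m == k)); last first.
  move=> m; apply/idP/idP.
    move=> /andP[/andP[/eqP tk ik] /eqP E].
    by have := decrK ik; rewrite tk E => -[->].
  move=> /eqP tk; have mB : (count_total m < B)%N by rewrite tk.
  rewrite incr_total// tk eqxx incrE// eqxx addn1 /=; apply/eqP/ffunP => j.
  by apply: val_inj; rewrite /= decrE incrE// addnK.
apply: eq_bigr => m /eqP tk; have mB : (count_total m < B)%N by rewrite tk.
by rewrite mulrA count_weight_incr// count_sum_incr// mulrA.
Qed.

(** The multinomial theorem: k! / prod (m i)! words share the counts m. Induction on k replaces
    counting them. *)
Lemma word_mean_count k f : (k <= B)%N ->
  \sum_(w : words k) (word_weight c w)%:num * f (word_sum z w) =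
  k`!%:R * \sum_(m : counts | count_total m == k) count_weight m * f (count_sum m).
Proof.
elim: k f => [|k IHk] f kB.
  rewrite big_words0 /= fact0 !mul1r (big_pred1 ([ffun=> ord0] : counts)).
    rewrite /count_weight big1 ?mul1r; last by move=> i _; rewrite ffunE expr0 fact0 divr1.
    by congr f; rewrite /count_sum big1// => i _; rewrite ffunE scale0r.
  move=> m; apply/eqP/eqP => [/eqP|->]; last first.
    by rewrite /count_total big1// => i _; rewrite ffunE.
  rewrite sum_nat_eq0 => /forallP m0; apply/ffunP => i; apply: val_inj.
  by have := m0 i; rewrite ffunE => /eqP.
rewrite big_words factS mulnC natrM -mulrA -/(count_mean k.+1 f) count_meanS//.
rewrite mulr_sumr; apply: eq_bigr => i _ /=.
under eq_bigr do rewrite -mulrA.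
by rewrite -mulr_sumr (IHk (fun y => f (z i + y)) (ltnW kB)) mulrCA.
Qed.

End poisson_counts.

Section poisson_representation.
Context {R : realType} {n : nat} {I : finType}.
Context (c : I -> {nonneg R}) (z : I -> 'rV[R]_n).
Local Notation V := 'rV[R]_n.
Context d (T : measurableType d) (P : probability T R) (U : I -> T -> nat).

Definition poisson_mass (a : R) (m : nat) : R := expR (- a) * (a ^+ m / m`!%:R).

Let joint (m : I -> nat) : set T := [set t | forall i, U i t = m i].

Hypothesis mU : forall m, measurable (joint m).
Hypothesis PU : forall m, P (joint m) = (\prod_i poisson_mass (c i)%:num (m i))%:E.

Let X (t : T) : V := \sum_i (U i t)%:R *: z i.
Let N (t : T) : nat := \sum_i U i t.

(** Fixing the number of jumps makes the event a finite union of joint events and matches it with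
    one term of the compound series. *)
Let cell (A : set (borel V)) k := [set t | N t = k /\ A (X t)].

Let cellE A k : cell A k = \bigcup_(m in [set` [pred m : {ffun I -> 'I_k.+1} |
   (count_total m == k) && (count_sum z m \in A)]]) joint (fun i => m i).
Proof.
apply/seteqP; split => t /=.
  move=> [Nk AX].
  have Uk i : (U i t < k.+1)%N.
    by rewrite ltnS -Nk /N (bigD1 i)//= leq_addr.
  pose m : {ffun I -> 'I_k.+1} := [ffun i => Ordinal (Uk i)].
  exists m => [/=|i]; last by rewrite ffunE.
  apply/andP; split.
    by rewrite /count_total -[X in _ == X]Nk; apply/eqP; apply: eq_bigr => i _; rewrite ffunE.
  apply/mem_set; rewrite (_ : count_sum z m = X t)//.
  by apply: eq_bigr => i _; rewrite ffunE.
move=> [m /= /andP[/eqP mk /set_mem Am] Um]; split.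
  by rewrite -[RHS]mk; apply: eq_bigr => i _; rewrite Um.
by rewrite /X; under eq_bigr do rewrite Um.
Qed.

Let measurable_cell A k : measurable (cell A k).
Proof.
rewrite cellE; apply: fin_bigcup_measurable => [|m _]; last exact: mU.
exact: finite_finset.
Qed.

Let prod_poisson_mass k (m : {ffun I -> 'I_k.+1}) :
  \prod_i poisson_mass (c i)%:num (m i) = expR (- total_rate c) * count_weight c m.
Proof.
rewrite /poisson_mass big_split /=; congr (_ * _).
rewrite /total_rate -sumrN; elim/big_rec2: _ => [|i y x _ ->]; first by rewrite expR0.
by rewrite expRD.
Qed.

Let P_cell A k : P (cell A k) = ((expR (- total_rate c))%:E *
  ((k`!%:R^-1)%:E * word_law c z k A))%E.
Proof.
rewrite cellE measure_fin_bigcup.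
- rewrite -(bigfs _ (index_enum_uniq _)); last by move=> m _; rewrite mem_index_enum.
  rewrite (eq_bigr (fun m : {ffun I -> 'I_k.+1} =>
    (expR (- total_rate c) * count_weight c m)%:E)); last first.
    by move=> m _; rewrite -prod_poisson_mass; exact: PU.
  rewrite sumEFin /word_law dirac_sumE -!EFinM; congr EFin.
  rewrite (word_mean_count c z (fun y => \1_A y) (leqnn k)) mulKf; last first.
    by rewrite pnatr_eq0 -lt0n fact_gt0.
  rewrite mulr_sumr big_mkcond [RHS]big_mkcond; apply: eq_bigr => m _ /=.
  by rewrite indicE; case: (_ == k) => //=; case: (_ \in A); rewrite ?mulr1 ?mulr0.
- exact: finite_finset.
- move=> m m' _ _ [t [Um Um']]; apply/ffunP => i; apply: val_inj.
  by rewrite /= -Um -Um'.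
- by move=> m _; exact: mU.
Qed.

Lemma poisson_sum_law (A : set (borel V)) : measurable A ->
  compound_law c z A = P [set t | A (\sum_i (U i t)%:R *: z i)].
Proof.
move=> mA; rewrite [X in P X](_ : _ = \bigcup_k cell A k); last first.
  by apply/seteqP; split => t /= => [At|[k _ []]//]; exists (N t).
rewrite measure_semi_bigcup//.
- rewrite [RHS](eq_eseriesr (fun k _ => P_cell A k)).
  rewrite nneseriesZl//.
  by move=> k _; rewrite mule_ge0// lee_fin.
- by move=> k k' _ _ [t [[<- _] [<- _]]].
- by apply: bigcup_measurable.
Qed.

End poisson_representation.

Section poisson_families.
Context {R : realType} {n : nat} {I : finType} (Q : pred I).
Context (c : I -> {nonneg R}) (z : I -> 'rV[R]_n).
Local Notation V := 'rV[R]_n.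

(** Rate 0 stands for the indices outside Q, so that words can be taken over the whole index
    type. *)
Definition restrict_rate i : {nonneg R} := if Q i then c i else 0%:nng.

Lemma dirac_sum_restrict :
  dirac_sum Q c (z : I -> borel V) = dirac_sum xpredT restrict_rate (z : I -> borel V).
Proof.
apply/funext => A; rewrite !dirac_sumE big_mkcond; congr EFin; apply: eq_bigr => i _.
by rewrite /restrict_rate; case: ifP; rewrite ?mul0r.
Qed.

(** At rate 0 the point mass at 0 fits the same formula, because 0 ^+ 0 = 1. *)
Lemma poisson_prob_set1 (a : {nonneg R}) m :
  poisson_prob a%:num 0 [set m] = (poisson_mass a%:num m)%:E.
Proof.
rewrite /poisson_prob /poisson_mass; case: ifPn => [a0|].
  rewrite esum_set1 ?lee_fin ?poisson_pmf_ge0// /poisson_pmf a0.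
  by rewrite mulrC.
rewrite -leNgt => a0; have -> : a%:num = 0 by apply/eqP; rewrite eq_le a0 /=.
rewrite oppr0 expR0 mul1r diracE; case: m => [|m].
  by rewrite mem_set//= expr0 fact0 divr1.
by rewrite memNset//= expr0n /= mul0r.
Qed.

Lemma poisson_family_law d (T : measurableType d) (P : probability T R)
    (U : I -> {RV P >-> nat}) :
  mutually_independent_rv P Q U ->
  (forall i, Q i -> forall A : set nat, distribution P (U i) A = poisson_prob (c i)%:num 0 A) ->
  forall A : set (borel V), measurable A ->
  compound_law restrict_rate z A = P [set t | A (\sum_(i | Q i) (U i t)%:R *: z i)].
Proof.
move=> indU lawU A mA.
pose U' i t : nat := if Q i then U i t else 0%N.
have mU1 i k : measurable [set t | U i t = k].
  rewrite -[X in measurable X]setTI.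
  exact: (measurable_funPT (U i) measurableT [set k] Logic.I).
(* U' vanishes off Q, so its joint event is empty unless m does too, and otherwise involves the
   independent variables alone. *)
have jointE m : [set t | forall i, U' i t = m i] =
    if [forall i, ~~ Q i ==> (m i == 0%N)] then
    [set t | forall i, i \in [set i | Q i]%SET -> [set m i] (U i t)] else set0.
  case: ifPn => [/fintype.forallP m0|]; last first.
    rewrite negb_forall => /fintype.existsP[j]; rewrite negb_imply => /andP[Qj mj].
    apply/seteqP; split => t //= /(_ j); rewrite /U' (negbTE Qj) => E.
    by rewrite -E in mj.
  apply/seteqP; split => t /= Ut i => [|].
    by rewrite inE => Qi; have := Ut i; rewrite /U' Qi.
  rewrite /U'; case: ifPn => Qi; first by apply: Ut; rewrite inE.
  by have := m0 i; rewrite Qi => /eqP ->.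
rewrite (@poisson_sum_law _ _ _ restrict_rate z _ _ P U')//.
- congr (P _); apply/seteqP; split => t /=;
  by rewrite [X in A X -> _]big_mkcond [X in _ -> A X]big_mkcond;
    congr (A _); apply: eq_bigr => i _; rewrite /U'; case: ifP; rewrite ?scale0r.
- move=> m; rewrite jointE; case: ifP => // _.
  rewrite (_ : [set t | _] = \bigcap_(i in [set` [set i | Q i]%SET]) [set t | U i t = m i])//.
  by apply: fin_bigcap_measurable => [|i _]; [exact: finite_finset|exact: mU1].
- move=> m; rewrite jointE; case: ifPn => [/fintype.forallP m0|]; last first.
    rewrite negb_forall => /fintype.existsP[j]; rewrite negb_imply => /andP[Qj mj].
    rewrite measure0 (bigD1 j)//= /restrict_rate (negbTE Qj) /poisson_mass /=.
    by rewrite expr0n (negbTE mj) mul0r mulr0 mul0r.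
  have /indU E : forall i, i \in [set i | Q i]%SET -> Q i by move=> i; rewrite inE.
  rewrite [LHS](E (fun i => [set m i]))// -prodEFin; rewrite (eq_bigl Q); last by move=> i; rewrite inE.
  rewrite big_mkcond; apply: eq_bigr => i _; rewrite /restrict_rate.
  case: ifPn => Qi.
    by have := lawU i Qi [set m i]; rewrite poisson_prob_set1.
  have := m0 i; rewrite Qi => /eqP ->.
  by rewrite /poisson_mass oppr0 expR0 mul1r expr0 fact0 divr1.
Qed.

End poisson_families.

(** * Geometry of the dominant directions *)

Section orthogonal_projection.
Context {R : realType} {n : nat}.
Local Notation V := 'rV[R]_n.
Implicit Types (u v : V) (M : 'M[R]_n).

Lemma dot_mulmx u v : dot u v = (u *m v^T) 0 0.
Proof. by rewrite mxE; apply: eq_bigr => j _; rewrite mxE. Qed.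

Lemma dotDr u v v' : dot u (v + v') = dot u v + dot u v'.
Proof. by rewrite dot_mulmx linearD mulmxDr mxE -!dot_mulmx. Qed.

Lemma dotZr (a : R) u v : dot u (a *: v) = a * dot u v.
Proof. by rewrite dot_mulmx linearZ -scalemxAr mxE -dot_mulmx. Qed.

Lemma dotNr u v : dot u (- v) = - dot u v.
Proof. by rewrite -scaleN1r dotZr mulN1r. Qed.

Lemma dot0r u : dot u 0 = 0.
Proof. by rewrite -(scale0r 0) dotZr mul0r. Qed.

Lemma dot_sumr (I : Type) (r : seq I) (Q : pred I) u (F : I -> V) :
  dot u (\sum_(i <- r | Q i) F i) = \sum_(i <- r | Q i) dot u (F i).
Proof.
by elim/big_rec2: _ => [|i y x _ <-]; rewrite ?dot0r// dotDr.
Qed.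

Lemma dotvv_eq0 u : (dot u u == 0) = (u == 0).
Proof.
apply/eqP/eqP => [/eqP|->]; last exact: dot0r.
rewrite psumr_eq0 => [/allP u0|j _]; last by rewrite -expr2 sqr_ge0.
apply/rowP => j; have := u0 j (mem_index_enum j).
by rewrite -expr2 sqrf_eq0 mxE => /eqP.
Qed.

Lemma dot_orthocomp M u v : (u <= M)%MS -> (v <= orthocomp M)%MS -> dot u v = 0.
Proof.
rewrite sub_kermx => /submxP[D ->] /eqP vM.
by rewrite dot_mulmx -mulmxA -[M *m _]trmxK trmx_mul trmxK vM trmx0 mulmx0 mxE.
Qed.

(** A vector in both is orthogonal to itself, hence 0. *)
Lemma cap_orthocomp M : (M :&: orthocomp M = 0)%MS.
Proof.
apply/eqP; rewrite -submx0; apply/row_subP => i.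
set r := row i _; have := row_sub i (M :&: orthocomp M)%MS.
rewrite -/r sub_capmx => /andP[rM rMc].
by rewrite submx0 -dotvv_eq0 (dot_orthocomp rM rMc).
Qed.

Lemma add_orthocomp_full M : row_full (M + orthocomp M)%MS.
Proof.
have /eqP dxM : (M :&: orthocomp M)%MS == 0 by rewrite cap_orthocomp.
rewrite /row_full mxrank_disjoint_sum// mxrank_ker mxrank_tr subnKC//.
exact: rank_leq_row.
Qed.

Lemma orthoproj_id M v : (v <= M)%MS -> v *m orthoproj M = v.
Proof. by move=> vM; apply: proj_mx_id => //; exact: cap_orthocomp. Qed.

Lemma orthoprojC_sub M v : (v *m (1%:M - orthoproj M) <= orthocomp M)%MS.
Proof.
rewrite mulmxBr mulmx1; apply: proj_mx_compl_sub.
by apply: submx_full; exact: add_orthocomp_full.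
Qed.

(** Membership becomes finitely many linear equations, with the columns of [cokermx] as normals.
    This gives measurability and lets a Gaussian law be tested one equation at a time. *)
Lemma submx_dot M v :
  (v <= M)%MS = [forall j, dot (col j (cokermx M))^T v == 0].
Proof.
have E j : dot (col j (cokermx M))^T v = (v *m cokermx M) 0 j.
  by rewrite dotC mxE; apply: eq_bigr => i _; rewrite !mxE.
rewrite submxE; apply/eqP/fintype.forallP => [v0 j|v0].
  by rewrite E v0 mxE.
by apply/rowP => j; rewrite -E (eqP (v0 j)) mxE.
Qed.

Lemma subspace_set_bigcap M : subspace_set M =
  \bigcap_(j in [set: 'I_n]) (dot (col j (cokermx M))^T @^-1` [set 0] : set (borel V)).
Proof.
apply/seteqP; split => v /=; rewrite /subspace_set /= submx_dot.
  by move=> /fintype.forallP v0 j _; exact/eqP/(v0 j).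
by move=> v0; apply/fintype.forallP => j; exact/eqP/(v0 j Logic.I).
Qed.

Lemma measurable_dot_preimage u (A : set R) : measurable A ->
  measurable (dot u @^-1` A : set (borel V)).
Proof. by move=> mA; rewrite -[X in measurable X]setTI; exact: measurable_dot. Qed.

Lemma measurable_subspace_set M : measurable (subspace_set M).
Proof.
rewrite subspace_set_bigcap; apply: fin_bigcap_measurable => [|j _].
  exact: finite_finset.
exact: measurable_dot_preimage.
Qed.

End orthogonal_projection.

Section dominant_geometry.
Context {R : realType} {Y : finType} (ya yb : bool -> Y) (p : bool -> R).
Local Notation V := 'rV[R]_#|Y|.
Local Notation PiG := (@PiG R Y ya yb).
Local Notation PiJ := (@PiJ R Y ya yb).
Local Notation gdir := (@gdir R Y ya yb).
Local Notation mean := (@mean R Y ya yb p).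

Lemma gdir_PiG b : gdir b *m PiG = gdir b.
Proof.
by apply: orthoproj_id; case: b; [exact: addsmxSr | exact: addsmxSl].
Qed.

Lemma gdir_PiJ b : gdir b *m PiJ = 0.
Proof. by rewrite mulmxBr mulmx1 gdir_PiG subrr. Qed.

Lemma ebasis_ya_mean b : (ebasis (ya b) : V) - mean b = (1 - p b) *: gdir b.
Proof. by apply/rowP => j; rewrite !mxE; ring. Qed.

Lemma ebasis_yb_mean b : (ebasis (yb b) : V) - mean b = - p b *: gdir b.
Proof. by apply/rowP => j; rewrite !mxE; ring. Qed.

Lemma jump_orthocomp b y : (jump ya yb p b y <= orthocomp (Mspace ya yb))%MS.
Proof. exact: orthoprojC_sub. Qed.

Lemma Delta_orthocomp : (Delta ya yb p <= orthocomp (Mspace ya yb))%MS.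
Proof. exact: orthoprojC_sub. Qed.

Lemma dot_Sigma (w : {i01 R}) (u : V) : dot (u *m Sigma ya yb p w) u =
  \sum_(b : bool) (proportion w b)%:num * (p b * (1 - p b) * dot u (gdir b) ^+ 2).
Proof.
rewrite dotC /Sigma mulmx_sumr dot_sumr; apply: eq_bigr => b _.
rewrite -scalemxAr mulmxA [u *m _]mx11_scalar -dot_mulmx mul_scalar_mx scalerA dotZr.
by ring.
Qed.

End dominant_geometry.

(** * Characteristic functions and tightness of the statistic *)

Section null_sequences.
Context {R : realType}.

Lemma cvg_bounded_mul0 (a b : nat -> R) (K : R) :
  (\forall n \near \oo, `|a n| <= K) -> b n @[n --> \oo] --> (0 : R) ->
  a n * b n @[n --> \oo] --> (0 : R).
Proof.
move=> aK b0; apply/norm_cvg0P.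
apply: (@squeeze_cvgr _ _ _ _ (fun=> 0) (fun n => K * `|b n|)).
- near=> n; rewrite normr_ge0 normrM ler_wpM2r//.
  by near: n.
- exact: cvg_cst.
- rewrite -(mulr0 K); apply: cvgM; first exact: cvg_cst.
  exact/norm_cvg0P.
Unshelve. all: by end_near. Qed.

Lemma eqO_invn_bounded (f : nat -> R) :
  (f : nat -> R^o) =O_\oo ((fun n => n%:R^-1) : nat -> R^o) ->
  exists K, \forall n \near \oo, `|n%:R * f n| <= K.
Proof.
move=> /eqO_exP [K [K0 fK]]; exists K; near=> n.
have n0 : 0 < n%:R :> R by rewrite ltr0n; near: n; exact: nbhs_infty_gt.
have : `|f n| <= K * `|n%:R^-1| by near: n.
by rewrite normrM (gtr0_norm n0) [`|n%:R^-1|]gtr0_norm ?invr_gt0// -ler_pdivlMl// mulrC.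
Unshelve. all: by end_near. Qed.

End null_sequences.

Section user_scores.
Context {R : realType} {Y : finType} (ya yb : bool -> Y) (p : bool -> R).
Context (alpha : bool -> Y -> {nonneg R}) (W : nat -> bool -> Y -> {nonneg R}).
Hypothesis W_critical : two_dominant_critical ya yb p alpha W.
Local Notation V := 'rV[R]_#|Y|.
Context (u v : V).
Local Notation PiG := (@PiG R Y ya yb).
Local Notation PiJ := (@PiJ R Y ya yb).
Local Notation gdir := (@gdir R Y ya yb).
Local Notation mean := (@mean R Y ya yb p).
Local Notation jump := (@jump R Y ya yb p).
Local Notation s n := ((Num.sqrt n%:R)^-1 : R).
Local Notation c b := (dot u (gdir b)).

(* What one user with input b and message y adds to <u, S.1> + <v, S.2>. *)
Definition score n b y : R :=
  s n * dot u (((ebasis y : V) - mean b) *m PiG) + dot v (jump b y).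

Lemma score_ya n b : score n b (ya b) = s n * ((1 - p b) * c b).
Proof.
rewrite /score /Defs.jump ebasis_ya_mean -!scalemxAl gdir_PiG gdir_PiJ.
by rewrite scaler0 dot0r addr0 dotZr.
Qed.

Lemma score_yb n b : score n b (yb b) = s n * (- p b * c b).
Proof.
rewrite /score /Defs.jump ebasis_yb_mean -!scalemxAl gdir_PiG gdir_PiJ.
by rewrite scaler0 dot0r addr0 dotZr.
Qed.

Lemma score_cvg b y : score n b y @[n --> \oo] --> dot v (jump b y).
Proof.
rewrite -[X in _ --> X]add0r -(mul0r (dot u (((ebasis y : V) - mean b) *m PiG))).
apply: cvgD; last exact: cvg_cst.
by apply: cvgM; [exact: cvgn_sqrt_inv | exact: cvg_cst].
Qed.

Lemma cvg_sqrt_inv_mul (a : R) : s n * a @[n --> \oo] --> (0 : R).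
Proof.
rewrite -(mul0r a).
by apply: cvgM; [exact: cvgn_sqrt_inv | exact: cvg_cst].
Qed.

(** One limit for psi equal to the identity, the square, cos - 1 and sin. The hypothesis treats the
    dominant messages with exact weights p and 1 - p; passing to W costs a bounded factor times a
    value of psi that tends to psi 0 = 0. For the other messages, n W tends to alpha and the score
    to <v, jump>. *)
Lemma cvg_user_mean b (psi : R -> R) (L : R) : continuous psi -> psi 0 = 0 ->
  n%:R * (p b * psi (s n * ((1 - p b) * c b)) +
          (1 - p b) * psi (s n * (- p b * c b))) @[n --> \oo] --> L ->
  n%:R * (\sum_y (W n b y)%:num * psi (score n b y)) @[n --> \oo] -->
  L + \sum_(y | y \notin dominant ya yb b) (alpha b y)%:num * psi (dot v (jump b y)).
Proof.
move=> cpsi psi0 psiL.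
have [yab _ Wa Wb Walpha] := W_critical b.
have [Ka aK] := eqO_invn_bounded Wa; have [Kb bK] := eqO_invn_bounded Wb.
have psis a : psi (s n * a) @[n --> \oo] --> (0 : R).
  by rewrite -psi0; apply: (continuous_cvg _ (cpsi _) (cvg_sqrt_inv_mul a)).
have E n : n%:R * (\sum_y (W n b y)%:num * psi (score n b y)) =
    (n%:R * (p b * psi (s n * ((1 - p b) * c b)) +
          (1 - p b) * psi (s n * (- p b * c b))) +
     (n%:R * ((W n b (ya b))%:num - p b) * psi (s n * ((1 - p b) * c b)) +
      n%:R * ((W n b (yb b))%:num - (1 - p b)) * psi (s n * (- p b * c b)))) +
    \sum_(y | y \notin dominant ya yb b) n%:R * (W n b y)%:num * psi (score n b y).
  rewrite (bigD1 (ya b))//= (bigD1 (yb b)) 1?eq_sym//= score_ya score_yb.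
  rewrite [X in _ + (_ + X)](_ : _ = \sum_(y | y \notin dominant ya yb b)
      (W n b y)%:num * psi (score n b y)); last first.
    by apply: eq_bigl => y; rewrite !inE negb_or.
  rewrite addrA mulrDr mulr_sumr; congr (_ + _); first by ring.
  by apply: eq_bigr => y _; rewrite mulrA.
rewrite (eq_fun E); apply: cvgD.
  rewrite -[X in _ --> X]addr0; apply: cvgD => //.
  rewrite -[X in _ --> X]addr0; apply: cvgD.
    exact: cvg_bounded_mul0 aK (psis _).
  exact: cvg_bounded_mul0 bK (psis _).
apply: cvg_sumr => y yD; apply: cvgM; first exact: Walpha.
by apply: (continuous_cvg _ (cpsi _)); exact: score_cvg.
Qed.

(** The Levy-Khintchine exponent for input b; weighted by the limiting proportions, the two add up
    to [limit_exponent]. *)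
Definition user_exponent b : R[i] :=
  (- (2^-1 * (p b * (1 - p b) * c b ^+ 2)))%:C%C +
  \sum_(y | y \notin dominant ya yb b)
     (alpha b y)%:num%:C%C * (expi (dot v (jump b y)) - 1).

Definition user_charfun n b : R[i] :=
  \sum_y (W n b y)%:num%:C%C * expi (score n b y).

Lemma cvg_user_id b : n%:R * (\sum_y (W n b y)%:num * score n b y) @[n --> \oo] -->
  \sum_(y | y \notin dominant ya yb b) (alpha b y)%:num * dot v (jump b y).
Proof.
rewrite -[X in _ --> X]add0r; apply: (@cvg_user_mean b id 0) => //.
  by move=> ?; exact: cvg_id.
(* Under the weights p and 1 - p the dominant score has mean exactly 0. *)
apply: cvg_near_cst; apply: nearW => n.
by rewrite /=; ring.
Qed.

Lemma cvg_user_sqr b : n%:R * (\sum_y (W n b y)%:num * score n b y ^+ 2) @[n --> \oo] -->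
  p b * (1 - p b) * c b ^+ 2 +
  \sum_(y | y \notin dominant ya yb b) (alpha b y)%:num * dot v (jump b y) ^+ 2.
Proof.
apply: (@cvg_user_mean b (fun t => t ^+ 2)).
- by move=> x; exact: exprn_continuous.
- by rewrite expr0n.
apply: cvg_near_cst; near=> n.
have n0 : n != 0%N by rewrite -lt0n; near: n; exact: nbhs_infty_gt.
have := @natr_sqrtV R n; rewrite n0 => E.
rewrite -[RHS]mulr1 -[X in _ = _ * X]E; ring.
Unshelve. all: by end_near. Qed.

Lemma cvg_taylor_Re (a : R) :
  n%:R * (cos (s n * a) - 1) @[n --> \oo] --> - (a ^+ 2 / 2).
Proof.
have := @cvg_Re R _ _ eventually_filter _ _ (@cvg_expi_taylor2 R a).
apply: cvg_trans; apply: near_eq_cvg; apply: nearW => n.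
by rewrite natrc expiE ReM /= mul0r !subr0.
Qed.

Lemma cvg_taylor_Im (a : R) :
  n%:R * (sin (s n * a) - s n * a) @[n --> \oo] --> (0 : R).
Proof.
have := @cvg_Im R _ _ eventually_filter _ _ (@cvg_expi_taylor2 R a).
apply: cvg_trans; apply: near_eq_cvg; apply: nearW => n.
by rewrite natrc expiE ImM /= mul0r subr0 addr0.
Qed.

Lemma cvg_user_cos b : n%:R * (\sum_y (W n b y)%:num * (cos (score n b y) - 1)) @[n --> \oo] -->
  - (2^-1 * (p b * (1 - p b) * c b ^+ 2)) +
  \sum_(y | y \notin dominant ya yb b) (alpha b y)%:num * (cos (dot v (jump b y)) - 1).
Proof.
apply: (@cvg_user_mean b (fun t => cos t - 1)).
- move=> x; apply: cvgB; [exact: continuous_cos | exact: cvg_cst].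
- by rewrite cos0 subrr.
(* p (1 - p)^2 + (1 - p) p^2 = p (1 - p), the variance of the dominant choice. *)
have -> : - (2^-1 * (p b * (1 - p b) * c b ^+ 2)) =
    p b * - (((1 - p b) * c b) ^+ 2 / 2) + (1 - p b) * - ((- p b * c b) ^+ 2 / 2).
  by field.
pose a := (1 - p b) * c b; pose a' := - p b * c b.
rewrite (_ : (fun n => _) = (fun n => p b * (n%:R * (cos (s n * a) - 1)) +
    (1 - p b) * (n%:R * (cos (s n * a') - 1)))); last first.
  by apply/funext => n; rewrite -/a -/a'; ring.
apply: cvgD; (apply: cvgM; first exact: cvg_cst); exact: cvg_taylor_Re.
Qed.

Lemma cvg_user_sin b : n%:R * (\sum_y (W n b y)%:num * sin (score n b y)) @[n --> \oo] -->
  \sum_(y | y \notin dominant ya yb b) (alpha b y)%:num * sin (dot v (jump b y)).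
Proof.
rewrite -[X in _ --> X]add0r; apply: (@cvg_user_mean b (@sin R)).
- by move=> x; exact: continuous_sin.
- exact: sin0.
have -> : 0 = p b * 0 + (1 - p b) * 0 :> R by rewrite !mulr0 addr0.
pose a := (1 - p b) * c b; pose a' := - p b * c b.
(* The linear terms inserted here cancel, the dominant score having mean 0, and leave remainders of
   third order. *)
rewrite (_ : (fun n => _) = (fun n => p b * (n%:R * (sin (s n * a) - s n * a)) +
    (1 - p b) * (n%:R * (sin (s n * a') - s n * a')))); last first.
  by apply/funext => n; rewrite -/a -/a' /a /a'; ring.
apply: cvgD; (apply: cvgM; first exact: cvg_cst); exact: cvg_taylor_Im.
Qed.

Hypothesis W_sum1 : forall n b, (0 < n)%N -> \sum_y (W n b y)%:num = 1.

Lemma cvg_user_charfun b :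
  (n%:R * (user_charfun n b - 1) : R[i]^o) @[n --> \oo] --> (user_exponent b : R[i]^o).
Proof.
have E n : (0 < n)%N -> user_charfun n b - 1 =
    ((\sum_y (W n b y)%:num * (cos (score n b y) - 1))%R +i*
     (\sum_y (W n b y)%:num * sin (score n b y))%R)%C.
  move=> n0; have -> : (1 : R[i]) = (\sum_y (W n b y)%:num)%:C%C by rewrite W_sum1.
  rewrite rmorph_sum -sumrB; apply/eqP; rewrite eq_complex Re_sum Im_sum /=.
  by apply/andP; split; apply/eqP; apply: eq_bigr => y _;
    rewrite /= expR0; ring.
apply: cvg_complex.
  have -> : complex.Re (user_exponent b) = - (2^-1 * (p b * (1 - p b) * c b ^+ 2)) +
      \sum_(y | y \notin dominant ya yb b) (alpha b y)%:num * (cos (dot v (jump b y)) - 1).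
    rewrite /user_exponent ReD Re_sum; congr (_ + _); apply: eq_bigr => y _.
    by rewrite expiE ReM ReB /=; ring.
  move: (@cvg_user_cos b); apply: cvg_trans; apply: near_eq_cvg; near=> n.
  have n0 : (0 < n)%N by near: n; exact: nbhs_infty_gt.
  by rewrite E// natrc ReM /= mul0r subr0.
have -> : complex.Im (user_exponent b) =
    \sum_(y | y \notin dominant ya yb b) (alpha b y)%:num * sin (dot v (jump b y)).
  rewrite /user_exponent ImD Im_sum add0r; apply: eq_bigr => y _.
  by rewrite expiE ImM ImB /=; ring.
move: (@cvg_user_sin b); apply: cvg_trans; apply: near_eq_cvg; near=> n.
have n0 : (0 < n)%N by near: n; exact: nbhs_infty_gt.
by rewrite E// natrc ImM /= mul0r addr0.
Unshelve. all: by end_near. Qed.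

Lemma normc_user_charfun n b : (0 < n)%N -> Normc.normc (user_charfun n b) <= 1.
Proof.
move=> n0; rewrite (le_trans (normc_sum _ _ _))// -(W_sum1 b n0).
apply: ler_sum => y _; rewrite Normc.normcM normc_expi mulr1 normc_real.
by rewrite ger0_norm.
Qed.

Lemma Re_user_exponent_le0 b : complex.Re (user_exponent b) <= 0.
Proof.
have [_ /andP[/ltW p0 /ltW p1] _ _ _] := W_critical b.
rewrite /user_exponent ReD Re_sum -[leRHS]addr0; apply: lerD.
  rewrite [leLHS](_ : _ = - (2^-1 * (p b * (1 - p b) * c b ^+ 2)))// oppr_le0.
  by apply: mulr_ge0 => //; apply: mulr_ge0 (sqr_ge0 _); rewrite mulr_ge0// subr_ge0.
apply: sumr_le0 => y _; rewrite expiE ReM /= mul0r subr0.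
by rewrite mulr_ge0_le0// subr_le0 cos_le1.
Qed.

Lemma cvg_user_charfun_expn b (r : nat -> nat) (rho : R) :
  (r n)%:R / n%:R @[n --> \oo] --> rho ->
  (user_charfun n b ^+ r n : R[i]^o) @[n --> \oo] -->
  (cexp (rho%:C%C * user_exponent b) : R[i]^o).
Proof.
(* c = 0: the characteristic function of a user is bounded by 1 and the exponent has nonpositive
   real part. *)
apply: (@cvg_cexp_expn R _ _ _ _ 0).
- near=> n; rewrite mul0r expR0; apply: normc_user_charfun.
  by near: n; exact: nbhs_infty_gt.
- by [].
- exact: Re_user_exponent_le0.
- exact: cvg_user_charfun.
Unshelve. all: by end_near. Qed.

End user_scores.

Lemma sum_users (V : nmodType) (F : bool -> V) n l : (l <= n)%N ->
  \sum_(i < n) F (i < l)%N = F false *+ (n - l) + F true *+ l.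
Proof.
move=> ln; rewrite -(big_mkord xpredT (fun i => F (i < l)%N)).
rewrite (big_cat_nat (n := l))//= addrC; congr (_ + _).
  rewrite -sumr_const_nat; apply: eq_big_nat => i /andP[li _].
  by rewrite ltnNge li.
rewrite -[l in RHS]subn0 -sumr_const_nat; apply: eq_big_nat => i /andP[_ ->] //.
Qed.

Lemma prod_users (A : comPzRingType) (F : bool -> A) n l : (l <= n)%N ->
  \prod_(i < n) F (i < l)%N = F false ^+ (n - l) * F true ^+ l.
Proof.
move=> ln; rewrite -(big_mkord xpredT (fun i => F (i < l)%N)).
rewrite (big_cat_nat (n := l))//= mulrC; congr (_ * _).
  rewrite -prodr_const_nat; apply: eq_big_nat => i /andP[li _].
  by rewrite ltnNge li.
rewrite -[l in RHS]subn0 -prodr_const_nat; apply: eq_big_nat => i /andP[_ ->] //.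
Qed.

Section charfun_dirac_sum.
Context {R : realType} {n : nat} {I : finType}.
Local Notation V := 'rV[R]_n.
Context (Q : pred I) (c : I -> {nonneg R}).

Lemma cintegral_dirac_sum d (T : measurableType d) (z : I -> T) (f : T -> R[i]) :
  measurable_fun setT (fun x => complex.Re (f x)) -> measurable_fun setT (fun x => complex.Im (f x)) ->
  cintegral (dirac_sum Q c z) f = \sum_(i | Q i) (c i)%:num%:C%C * f (z i).
Proof.
move=> mRe mIm; apply/eqP; rewrite eq_complex Re_sum Im_sum; apply/andP; split; apply/eqP.
  rewrite [LHS](Rintegral_dirac_sum _ _ _ mRe); apply: eq_bigr => i _.
  by rewrite ReM /= mul0r subr0.
rewrite [LHS](Rintegral_dirac_sum _ _ _ mIm); apply: eq_bigr => i _.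
by rewrite ImM /= mul0r addr0.
Qed.

Lemma charfun_dirac_sum (z : I -> borel V * borel V) (u v : V) :
  charfun (dirac_sum Q c z) u v =
  \sum_(i | Q i) (c i)%:num%:C%C * expi (dot u (z i).1 + dot v (z i).2).
Proof.
apply: (@cintegral_dirac_sum _ _ z (fun x => expi (dot u x.1 + dot v x.2))).
  rewrite (_ : (fun x => _) = fun x => cos (dot u x.1 + dot v x.2)); last first.
    by apply/funext => x /=; rewrite expR0 mul1r.
  exact: measurable_cos_dot2.
rewrite (_ : (fun x => _) = fun x => sin (dot u x.1 + dot v x.2)); last first.
  by apply/funext => x /=; rewrite expR0 mul1r.
exact: measurable_sin_dot2.
Qed.

End charfun_dirac_sum.

(** * The statistic as a sum of user scores, and its second moments *)

Section statistic.
Context {R : realType} {Y : finType} (ya yb : bool -> Y) (p : bool -> R).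
Local Notation V := 'rV[R]_#|Y|.
Local Notation PiG := (@PiG R Y ya yb).
Local Notation PiJ := (@PiJ R Y ya yb).
Local Notation mean := (@mean R Y ya yb p).
Local Notation score := (@score R Y ya yb p).
Local Notation s n := ((Num.sqrt n%:R)^-1 : R).

Lemma histogramE n (x : {ffun 'I_n -> Y}) :
  histogram x = \sum_(i < n) ebasis (x i) :> V.
Proof.
apply/rowP => j; rewrite summxE mxE -sum1_card natr_sum big_mkcond /=.
apply: eq_bigr => i _; rewrite inE mxE /= -[j in RHS]enum_valK (inj_eq enum_rank_inj).
by rewrite eq_sym; case: (_ == _).
Qed.

(** Each message is recentred at the mean of its own user, according to l; the leftover is the
    mismatch with the centering by k, and it produces [Delta] when l = k + 1. *)
Lemma HhatE n k l (x : {ffun 'I_n -> Y}) : (l <= n)%N ->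
  Hhat ya yb p k x = \sum_(i < n) ((ebasis (x i) : V) - mean (i < l)%N) +
    (l%:R - k%:R) *: (mean true - mean false).
Proof.
move=> ln; rewrite sumrB -histogramE (@sum_users _ mean)// /Hhat.
rewrite -[mean false *+ _]scaler_nat -[mean true *+ _]scaler_nat natrB//; apply/rowP => j; rewrite !mxE; ring.
Qed.

Definition centering_shift (u v : V) n : R :=
  s n * dot u ((mean true - mean false) *m PiG) + dot v (Delta ya yb p).

Lemma dot_Sstat (u v : V) n k l (x : {ffun 'I_n -> Y}) : (l <= n)%N ->
  dot u (Sstat ya yb p k x).1 + dot v (Sstat ya yb p k x).2 =
  \sum_(i < n) score u v n (i < l)%N (x i) + (l%:R - k%:R) * centering_shift u v n.
Proof.
move=> ln; rewrite /= (HhatE k x ln) !mulmxDl !mulmx_suml -!scalemxAl dotZr.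
rewrite !dotDr !dot_sumr !dotZr /score big_split /= -mulr_sumr /centering_shift.
by rewrite /Delta /jump; ring.
Qed.

Lemma charfun_Slaw (W : bool -> Y -> {nonneg R}) (u v : V) n k l : (l <= n)%N ->
  charfun (Slaw ya yb p W n k l) u v =
  expi ((l%:R - k%:R) * centering_shift u v n) *
  ((\sum_y (W false y)%:num%:C%C * expi (score u v n false y)) ^+ (n - l) *
   (\sum_y (W true y)%:num%:C%C * expi (score u v n true y)) ^+ l).
Proof.
move=> ln; rewrite charfun_dirac_sum.
rewrite -(@prod_users _ (fun b => \sum_y (W b y)%:num%:C%C * expi (score u v n b y)))//.
rewrite bigA_distr_bigA mulr_sumr; apply: eq_bigr => x _.
rewrite (dot_Sstat _ _ _ _ ln) expiD expi_sum big_split /= rmorph_prod; ring.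
Qed.

Lemma dirac_sum_T d (T : measurableType d) (I : finType) (c : I -> {nonneg R}) (z : I -> T) :
  dirac_sum xpredT c z setT = (\sum_i (c i)%:num)%:E.
Proof. by rewrite dirac_sumE; under eq_bigr do rewrite indicT mulr1. Qed.

Lemma Slaw_setT (W : bool -> Y -> {nonneg R}) n k l :
  ((0 < n)%N -> forall b, \sum_y (W b y)%:num = 1) ->
  Slaw ya yb p W n k l setT = 1%E.
Proof.
move=> W1; rewrite /Slaw dirac_sum_T; congr EFin.
apply: (product_weight_sum1 (q := fun (i : 'I_n) => fun y => (W (i < l)%N y)%:num)).
move=> i; apply: W1; exact: leq_ltn_trans (ltn_ord i).
Qed.

Definition Slaw_sqr (W : bool -> Y -> {nonneg R}) n k l (u v : V) : R :=
  \sum_(x : {ffun 'I_n -> Y}) (messages_prob W l x)%:num *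
    (dot u (Sstat ya yb p k x).1 + dot v (Sstat ya yb p k x).2) ^+ 2.

(** From (a + c)^2 <= 2 a^2 + 2 c^2 for the random part a and the shift c. Each input is counted as
    if all n users had it, which frees the bound on the random part from l and gives it the form
    whose limit is known. *)
Lemma Slaw_sqr_le (W : bool -> Y -> {nonneg R}) n k l (u v : V) : (l <= n)%N ->
  ((0 < n)%N -> forall b, \sum_y (W b y)%:num = 1) ->
  Slaw_sqr W n k l u v <=
  2 * (\sum_(b : bool) n%:R * (\sum_y (W b y)%:num * score u v n b y ^+ 2) +
       (\sum_(b : bool) n%:R * `|\sum_y (W b y)%:num * score u v n b y|) ^+ 2) +
  2 * ((l%:R - k%:R) * centering_shift u v n) ^+ 2.
Proof.
move=> ln W1; rewrite /Slaw_sqr; set c := _ * centering_shift _ _ _.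
pose q (i : 'I_n) := fun y => (W (i < l)%N y)%:num.
pose h (i : 'I_n) := score u v n (i < l)%N.
have q1 i : \sum_y q i y = 1.
  by apply: W1; exact: leq_ltn_trans (ltn_ord i).
apply: (@le_trans _ _ (2 * (\sum_x product_weight q x * (\sum_i h i (x i)) ^+ 2) + 2 * c ^+ 2)).
  have -> : 2 * c ^+ 2 = \sum_x product_weight q x * (2 * c ^+ 2).
    by rewrite -mulr_suml product_weight_sum1// mul1r.
  rewrite mulr_sumr -big_split; apply: ler_sum => x _; rewrite (dot_Sstat _ _ _ _ ln) -/c /=.
  rewrite [X in _ <= X + _]mulrCA -mulrDr ler_wpM2l//; first exact: prodr_ge0.
  set a := \sum_(i < n) score _ _ _ _ _.
  by rewrite -subr_ge0 (_ : _ - _ = (a - c) ^+ 2) ?sqr_ge0//; rewrite /h -/a; ring.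
rewrite lerD2r ler_wpM2l// (le_trans (product_weight_sqr_le q1 h))//.
have sum_le (F : bool -> R) : (forall b, 0 <= F b) ->
    \sum_(i < n) F (i < l)%N <= \sum_(b : bool) n%:R * F b.
  move=> F0; rewrite sum_users// big_bool /= addrC -[F true *+ _]mulr_natl -[F false *+ _]mulr_natl.
  by rewrite lerD// ler_wpM2r// ler_nat// leq_subr.
apply: lerD.
  apply: (sum_le (fun b => \sum_y (W b y)%:num * score u v n b y ^+ 2)) => b.
  by apply: sumr_ge0 => y _; rewrite mulr_ge0// sqr_ge0.
rewrite lerXn2r// ?nnegrE ?sumr_ge0//.
exact: (sum_le (fun b => `|\sum_y (W b y)%:num * score u v n b y|)).
Qed.

Definition entry_dir (c : bool * 'I_#|Y|) : V * V :=
  if c.1 then (0, delta_mx 0 c.2) else (delta_mx 0 c.2, 0).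

Lemma dot_entry_dir c (x : V * V) :
  dot (entry_dir c).1 x.1 + dot (entry_dir c).2 x.2 = entry c x.
Proof.
by rewrite /entry_dir /entry; case: c.1; rewrite /= dot0l dot_delta ?add0r ?addr0.
Qed.

(** Chebyshev's inequality: off the box some coordinate exceeds L pi / 2 in size, so the sum of the
    squared coordinates exceeds its square. *)
Lemma Slaw_boxC_le (W : bool -> Y -> {nonneg R}) n k l (L : R) : 0 < L ->
  (Slaw ya yb p W n k l (~` (box L : set (borel V * borel V))) <=
   ((\sum_c Slaw_sqr W n k l (entry_dir c).1 (entry_dir c).2) / (L * (pi / 2)) ^+ 2)%:E)%E.
Proof.
move=> L0; have a0 : 0 < L * (pi / 2) by rewrite mulr_gt0// divr_gt0// pi_gt0.
rewrite /Slaw dirac_sumE lee_fin /Slaw_sqr exchange_big mulr_suml; apply: ler_sum => x _.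
rewrite -mulr_sumr -mulrA ler_wpM2l//.
rewrite indicE; case: (boolP (_ \in _)) => [/set_mem|_]; last first.
  by rewrite mulr_ge0 ?invr_ge0 ?sqr_ge0// sumr_ge0// => c _; rewrite sqr_ge0.
move=> /existsNP[c /negP]; rewrite -ltNge => /ltW Lc.
under eq_bigr => b _ do rewrite dot_entry_dir.
rewrite ler_pdivlMr ?exprn_gt0// mul1r (bigD1 c)//= ler_wpDr//.
  by rewrite sumr_ge0// => b _; rewrite sqr_ge0.
by rewrite -[leRHS]real_normK ?num_real// lerXn2r ?nnegrE// ltW.
Qed.

End statistic.

Section limits.
Context {R : realType} {Y : finType} (ya yb : bool -> Y) (p : bool -> R).
Context (alpha : bool -> Y -> {nonneg R}) (W : nat -> bool -> Y -> {nonneg R}).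
Context (k : nat -> nat) (w : {i01 R}).
Hypothesis W_sum1 : forall n b, (0 < n)%N -> \sum_y (W n b y)%:num = 1.
Hypothesis W_critical : two_dominant_critical ya yb p alpha W.
Hypothesis k_prop : (k n)%:R / n%:R @[n --> \oo] --> w%:num.
(** m = 0 gives the dataset of P_n and m = 1 its neighbour, that of Q_n. *)
Context (l : nat -> nat) (m : nat).
Hypothesis l_le : forall n, (0 < n)%N -> (l n <= n)%N.
Hypothesis lE : forall n, l n = (k n + m)%N.
Local Notation V := 'rV[R]_#|Y|.
Local Notation score := (@score R Y ya yb p).

Lemma cvg_users b :
  (if b then l n else n - l n)%N%:R / n%:R @[n --> \oo] --> (proportion w b)%:num.
Proof.
have lw : (l n)%:R / n%:R @[n --> \oo] --> w%:num.
  rewrite (_ : (fun n => _) = (fun n => (k n)%:R / n%:R + m%:R * n%:R^-1)); last first.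
    by apply/funext => n; rewrite lE natrD mulrDl.
  rewrite -[X in _ --> X]addr0 -[X in _ --> _ + X](mulr0 m%:R).
  by apply: cvgD => //; apply: cvgM; [exact: cvg_cst | exact: cvgn_inv].
case: b => //=.
have H : 1 - (l n)%:R / n%:R @[n --> \oo] --> 1 - w%:num.
  by apply: cvgB => //; exact: cvg_cst.
apply: cvg_trans H; apply: near_eq_cvg; near=> n.
have n0 : (0 < n)%N by near: n; exact: nbhs_infty_gt.
by rewrite natrB ?l_le// mulrBl divff// pnatr_eq0 -lt0n.
Unshelve. all: by end_near. Qed.

Lemma cvg_centering_shift (u v : V) :
  ((l n)%:R - (k n)%:R) * centering_shift ya yb p u v n @[n --> \oo] -->
  m%:R * dot v (Delta ya yb p).
Proof.
rewrite (_ : (fun n => _) = (fun n => m%:R * centering_shift ya yb p u v n)); last first.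
  by apply/funext => n; rewrite lE natrD; ring.
apply: cvgM; first exact: cvg_cst.
rewrite -[X in _ --> X]add0r; apply: cvgD; last exact: cvg_cst.
exact: cvg_sqrt_inv_mul.
Qed.

Lemma cvg_expi (f : nat -> R) a : f n @[n --> \oo] --> a ->
  (expi (f n) : R[i]^o) @[n --> \oo] --> (expi a : R[i]^o).
Proof.
move=> fa; apply: cvg_cexp; apply: cvg_complex => //=; exact: cvg_cst.
Qed.

Definition limit_exponent (u v : V) : R[i] :=
  (- (2^-1 * dot (u *m Sigma ya yb p w) u))%:C%C +
  \sum_(i | nondominant ya yb i) (rate alpha w i.1 i.2)%:num%:C%C *
    (expi (dot v (jump ya yb p i.1 i.2)) - 1).

Lemma limit_exponentE (u v : V) : limit_exponent u v =
  \sum_(b : bool) (proportion w b)%:num%:C%C * user_exponent ya yb p alpha u v b.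
Proof.
rewrite /limit_exponent dot_Sigma mulr_sumr -sumrN rmorph_sum.
rewrite [X in _ + X](_ : _ = \sum_(b : bool) \sum_(y | y \notin dominant ya yb b)
    (rate alpha w b y)%:num%:C%C * (expi (dot v (jump ya yb p b y)) - 1)); last first.
  by rewrite pair_big_dep.
rewrite -big_split; apply: eq_bigr => b _; rewrite /user_exponent [RHS]mulrDr /=; congr (_ + _).
  by rewrite -rmorphM; congr (_%:C)%C; ring.
by rewrite mulr_sumr; apply: eq_bigr => y _; rewrite mulrA -rmorphM.
Qed.

Lemma cvg_charfun_Slaw (u v : V) :
  charfun (Slaw ya yb p (W n) n (k n) (l n)) u v @[n --> \oo] -->
  (expi (m%:R * dot v (Delta ya yb p)) * cexp (limit_exponent u v) : R[i]^o).
Proof.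
have H : (expi (((l n)%:R - (k n)%:R) * centering_shift ya yb p u v n) *
    (user_charfun ya yb p W u v n false ^+ (n - l n) *
     user_charfun ya yb p W u v n true ^+ l n) : R[i]^o) @[n --> \oo] -->
   (expi (m%:R * dot v (Delta ya yb p)) * cexp (limit_exponent u v) : R[i]^o).
  rewrite limit_exponentE big_bool /= addrC cexpD.
  apply: cvg_mulc; first exact: (cvg_expi (@cvg_centering_shift u v)).
  apply: cvg_mulc; apply: (cvg_user_charfun_expn W_critical) => //.
    exact: (@cvg_users false).
  exact: (@cvg_users true).
apply: cvg_trans H; apply: near_eq_cvg; near=> n.
have n0 : (0 < n)%N by near: n; exact: nbhs_infty_gt.
by rewrite charfun_Slaw// l_le.
Unshelve. all: by end_near. Qed.

(** The bound converges by the first and second moment limits of a single user; convergent bounds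
    can be summed over the coordinates. *)
Lemma Slaw_sqr_bounded (u v : V) : exists2 f : nat -> R,
  (\forall n \near \oo, Slaw_sqr ya yb p (W n) n (k n) (l n) u v <= f n) & cvgn f.
Proof.
pose f n := 2 * (\sum_(b : bool) n%:R * (\sum_y (W n b y)%:num * score u v n b y ^+ 2) +
   (\sum_(b : bool) `|n%:R * (\sum_y (W n b y)%:num * score u v n b y)|) ^+ 2) +
  2 * (((l n)%:R - (k n)%:R) * centering_shift ya yb p u v n) ^+ 2.
exists f.
  near=> n; have n0 : (0 < n)%N by near: n; exact: nbhs_infty_gt.
  rewrite (le_trans (Slaw_sqr_le _ _ _ _ _ _ _ _))// ?l_le//; first by move=> _ b; exact: W_sum1.
  by rewrite /f; under [X in _ <= _ * (_ + X ^+ 2) + _]eq_bigr do rewrite normrM ger0_norm//.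
apply: cvgP; apply: cvgD.
  apply: cvgM; first exact: cvg_cst.
  apply: cvgD.
    by apply: cvg_sumr => b _; exact: (cvg_user_sqr W_critical).
  apply: (continuous_cvg _ (@exprn_continuous _ 2 _)); apply: cvg_sumr => b _.
  by apply: cvg_norm; exact: (cvg_user_id W_critical).
apply: cvgM; first exact: cvg_cst.
by apply: (continuous_cvg _ (@exprn_continuous _ 2 _)); exact: cvg_centering_shift.
Unshelve. all: by end_near. Qed.

Lemma Slaw_tight (e : R) : 0 < e -> exists L, \forall n \near \oo,
  (Slaw ya yb p (W n) n (k n) (l n) (~` (box L : set (borel V * borel V))) <= e%:E)%E.
Proof.
move=> e0.
have /choice[f fP] : forall c, exists f : nat -> R,
    (\forall n \near \oo, Slaw_sqr ya yb p (W n) n (k n) (l n)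
      (entry_dir c).1 (entry_dir c).2 <= f n) /\ cvgn f.
  by move=> c; have [f ? ?] := Slaw_sqr_bounded (entry_dir c).1 (entry_dir c).2; exists f.
(* Adding 1 to the limit yields an eventual upper bound. *)
pose B : R := \sum_c limn (f c) + 1.
have fB : \forall n \near \oo, \sum_c f c n <= B.
  apply: (@cvgr_le _ _ _ _ (fun n => \sum_c f c n) (\sum_c limn (f c))).
    by apply: cvg_sumr => c _; exact: (fP c).2.
  by rewrite ltrDl.
have fS : \forall n \near \oo, forall c, Slaw_sqr ya yb p (W n) n (k n) (l n)
      (entry_dir c).1 (entry_dir c).2 <= f c n.
  apply: filter_forall => c; exact: (fP c).1.
(* Then e L >= B, and L >= 1 gives (L pi / 2)^2 >= L^2 >= L. *)
pose L : R := 1 + `|B| / e; have L1 : 1 <= L by rewrite lerDl divr_ge0// ltW.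
exists L; near=> n; rewrite (le_trans (Slaw_boxC_le _ _ _ _ _ _ _ _))// ?(lt_le_trans ltr01)//.
have L0 : 0 < L by rewrite (lt_le_trans ltr01).
have Lpi : L <= L * (pi / 2).
  by rewrite ler_peMr ?(ltW L0)// ler_pdivlMr// mul1r pi_ge2.
rewrite lee_fin ler_pdivrMr ?exprn_gt0//; last exact: lt_le_trans Lpi.
apply: (@le_trans _ _ B).
  apply: (@le_trans _ _ (\sum_c f c n)); last by near: n.
  by apply: ler_sum => c _; move: c; near: n.
apply: (@le_trans _ _ (e * L)).
  by rewrite mulrDr mulr1 mulrCA divff ?gt_eqF// mulr1 (le_trans (ler_norm _))// lerDr ltW.
rewrite ler_wpM2l ?(ltW e0)//; apply: (@le_trans _ _ (L ^+ 2)).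
  by rewrite expr2 ler_peMr// ltW.
by rewrite lerXn2r ?nnegrE// (ltW L0, ltW (lt_le_trans L0 Lpi)).
Unshelve. all: by end_near. Qed.

Lemma weak_cvg_Slaw (mu : {measure set (borel V * borel V) -> \bar R}) :
  mu setT = 1%E ->
  (forall u v, charfun mu u v =
     expi (m%:R * dot v (Delta ya yb p)) * cexp (limit_exponent u v)) ->
  weak_cvg (fun n => Slaw ya yb p (W n) n (k n) (l n)) mu.
Proof.
move=> mu1 muE; apply: levy_continuity => //.
- move=> n; apply: Slaw_setT => n0 b; exact: W_sum1.
- by move=> u v; rewrite muE; exact: cvg_charfun_Slaw.
- exact: Slaw_tight.
Qed.

End limits.

(** * The limit laws *)

Section probability_integrals.
Context {R : realType}.

Lemma eq_measure_Rintegral d (T : measurableType d) (m1 m2 : {measure set T -> \bar R})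
    (f : T -> R) : (forall A, measurable A -> m1 A = m2 A) ->
  \int[m1]_x f x = \int[m2]_x f x.
Proof.
by move=> m12; rewrite /Rintegral; congr fine; apply: eq_measure_integral => A mA _; exact: m12.
Qed.

Lemma Rintegral_distribution d d' (T : measurableType d) (T' : measurableType d')
    (P : probability T R) (X : {RV P >-> T'}) (f : T' -> R) B :
  measurable_fun setT f -> (forall x, `|f x| <= B) ->
  \int[distribution P X]_x f x = \int[P]_t f (X t).
Proof.
move=> mf fB; rewrite /Rintegral integral_distribution//; first exact/measurable_EFinP.
apply: (@bounded_integrable _ _ _ P (@probability_setT _ _ _ P) (f \o X) B) => [|t].
  exact: measurableT_comp.
exact: fB.
Qed.

Lemma Rintegral_product d1 d2 (T1 : measurableType d1) (T2 : measurableType d2)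
    (m1 : probability T1 R) (m2 : probability T2 R) (f : T1 -> R) (g : T2 -> R) B B' :
  measurable_fun setT f -> measurable_fun setT g ->
  (forall x, `|f x| <= B) -> (forall y, `|g y| <= B') ->
  \int[(m1 \x m2)%E]_x (f x.1 * g x.2) = (\int[m1]_x f x) * (\int[m2]_y g y).
Proof.
move=> mf mg fB gB; have m1T := @probability_setT _ _ _ m1; have m2T := @probability_setT _ _ _ m2.
have ig := bounded_integrable m2T mg gB.
rewrite {1}/Rintegral -integral12_prod_meas1.
  rewrite /fubini_F (eq_integral (fun x => (f x * \int[m2]_y g y)%:E)).
    by rewrite -RintegralZr//; exact: bounded_integrable fB.
  move=> x _ /=; under eq_integral do rewrite EFinM.
  rewrite integralZl// EFinM; congr (_ * _)%E.
  by rewrite /Rintegral fineK//; exact: integrable_fin_num.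
apply: (@bounded_integrable _ _ _ _ _ _ (B * B')) => [||x].
- rewrite -setXTT; apply: etrans; first exact: product_measure1E.
  by rewrite -[RHS]mule1; congr (_ * _)%E.
- by apply: measurable_funM; apply: measurableT_comp.
- by rewrite normrM ler_pM.
Qed.

End probability_integrals.

Section limit_laws.
Context {R : realType} {n : nat}.
Local Notation V := 'rV[R]_n.

Definition charfun1 (m : {measure set (borel V) -> \bar R}) (u : V) : R[i] :=
  cintegral m (fun x => expi (dot u x)).

Lemma Re_charfun1 m u : complex.Re (charfun1 m u) = \int[m]_x cos (dot u x).
Proof. by apply: eq_Rintegral => x _; rewrite expiE. Qed.

Lemma Im_charfun1 m u : complex.Im (charfun1 m u) = \int[m]_x sin (dot u x).
Proof. by apply: eq_Rintegral => x _; rewrite expiE. Qed.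

Lemma eq_complexP (z z' : R[i]) :
  complex.Re z = complex.Re z' -> complex.Im z = complex.Im z' -> z = z'.
Proof. by case: z z' => a b [a' b'] /= -> ->. Qed.

Lemma charfun_factor (mu : {measure set (borel V * borel V) -> \bar R})
    (m1 m2 : {measure set (borel V) -> \bar R}) (u v : V) :
  mu setT = 1%E ->
  (forall f g : V -> R, measurable_fun setT (f : borel V -> R) ->
    measurable_fun setT (g : borel V -> R) ->
    (forall x, `|f x| <= 1) -> (forall x, `|g x| <= 1) ->
    \int[mu]_x (f x.1 * g x.2) = (\int[m1]_x f x) * (\int[m2]_y g y)) ->
  charfun mu u v = charfun1 m1 u * charfun1 m2 v.
Proof.
move=> mT mE.
have mc w : measurable_fun setT (fun x : borel V => cos (dot w x)) by exact: measurable_cos_dot.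
have ms w : measurable_fun setT (fun x : borel V => sin (dot w x)) by exact: measurable_sin_dot.
have c1 (w x : V) : `|cos (dot w x)| <= 1 by exact: cos_max.
have s1 (w x : V) : `|sin (dot w x)| <= 1 by exact: sin_max.
have intM (f g : V -> R) : measurable_fun setT (f : borel V -> R) ->
    measurable_fun setT (g : borel V -> R) ->
    (forall x, `|f x| <= 1) -> (forall x, `|g x| <= 1) ->
    mu.-integrable setT (EFin \o (fun x => f x.1 * g x.2)).
  move=> mf mg f1 g1; apply: (bounded_integrable mT (B := 1)) => [|x].
    apply: measurable_funM.
      by apply: (measurableT_comp mf); exact: measurable_fst.
    by apply: (measurableT_comp mg); exact: measurable_snd.
  by rewrite normrM mulr_ile1.
apply: eq_complexP.
  rewrite Re_charfun ReM !Re_charfun1 !Im_charfun1.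
  rewrite -(mE _ _ (mc u) (mc v) (c1 u) (c1 v)) -(mE _ _ (ms u) (ms v) (s1 u) (s1 v)).
  rewrite -(RintegralB measurableT (intM _ _ (mc u) (mc v) (c1 u) (c1 v))
    (intM _ _ (ms u) (ms v) (s1 u) (s1 v))).
  by apply: eq_Rintegral => x _; rewrite cosD.
rewrite Im_charfun ImM !Re_charfun1 !Im_charfun1.
rewrite -(mE _ _ (mc u) (ms v) (c1 u) (s1 v)) -(mE _ _ (ms u) (mc v) (s1 u) (c1 v)).
rewrite -(RintegralD measurableT (intM _ _ (mc u) (ms v) (c1 u) (s1 v))
  (intM _ _ (ms u) (mc v) (s1 u) (c1 v))).
by apply: eq_Rintegral => x _; rewrite sinD addrC.
Qed.

Lemma charfun_product (m1 m2 : probability (borel V) R) (u v : V) :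
  charfun (m1 \x m2)%E u v = charfun1 m1 u * charfun1 m2 v.
Proof.
apply: charfun_factor => [|f g mf mg f1 g1].
  rewrite -setXTT; apply: etrans; first exact: product_measure1E.
  by rewrite -[RHS]mule1; congr (_ * _)%E; exact: probability_setT.
exact: (@Rintegral_product R _ _ _ _ m1 m2 f g 1 1 mf mg f1 g1).
Qed.

(** The law of <u, G> is a one-dimensional normal law, possibly a point mass. Its sine integral
    vanishes because u and - u give the same variance, hence the same law. *)
Lemma gaussian_charfun1 (S : 'M[R]_n) (gamma : probability (borel V) R) (u : V) :
  gaussian_law 0 S gamma -> 0 <= dot (u *m S) u ->
  charfun1 gamma u = (expR (- (2^-1 * dot (u *m S) u)))%:C%C.
Proof.
move=> gG S0; have gT := @probability_setT _ _ _ gamma.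
have mc w : measurable_fun setT (fun x : borel V => cos (dot w x)) by exact: measurable_cos_dot.
have ms w : measurable_fun setT (fun x : borel V => sin (dot w x)) by exact: measurable_sin_dot.
have md w : measurable_fun setT (dot w : borel V -> measurableTypeR R) := measurable_dot w.
have push (f : R -> R) w : measurable_fun setT (f : measurableTypeR R -> R) -> (forall x, `|f x| <= 1) ->
    \int[gamma]_x f (dot w x) = \int[pushforward gamma (dot w : borel V -> measurableTypeR R)]_y f y.
  move=> mf f1; rewrite /Rintegral [in RHS]integral_pushforward//.
  - exact/measurable_EFinP.
  - apply: (bounded_integrable gT (B := 1)) => [|x]; last exact: f1.
    by apply: (measurableT_comp mf); exact: measurable_dot.
have mcos : measurable_fun setT (@cos R : measurableTypeR R -> R).
  by apply: continuous_measurable_fun; exact: continuous_cos.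
have msin : measurable_fun setT (@sin R : measurableTypeR R -> R).
  by apply: continuous_measurable_fun; exact: continuous_sin.
apply: eq_complexP; rewrite ?Re_charfun1 ?Im_charfun1 /=.
  rewrite (push md (@cos R))//; last by move=> x; exact: cos_max.
  have [S_eq0|S_neq0] := eqVneq (dot (u *m S) u) 0.
    rewrite (eq_measure_Rintegral (m2 := dirac (0 : measurableTypeR R))); last first.
      by move=> A mA; rewrite [LHS]gG// /normal_law S_eq0 eqxx dot0r.
    rewrite /Rintegral integral_dirac//=; last exact/measurable_EFinP.
    by rewrite indicT mul1r cos0 S_eq0 mulr0 oppr0 expR0.
  have -> : expR (- (2^-1 * dot (u *m S) u)) =
      \int[normal_prob 0 (Num.sqrt (dot (u *m S) u))]_x cos x.
    rewrite integral_cos_normal_prob ?sqrtr_gt0 ?lt_neqAle ?S0 1?eq_sym ?S_neq0//.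
    by rewrite sqr_sqrtr// mulrC.
  rewrite /Rintegral; congr fine; apply: eq_measure_integral => A mA _.
  by rewrite [LHS]gG// /normal_law (negbTE S_neq0) dot0r.
have sin_sym : \int[gamma]_x sin (dot (- u) x) = \int[gamma]_x sin (dot u x).
  rewrite !(push md (@sin R))//; [|by move=> x; exact: sin_max..].
  apply: eq_measure_Rintegral => A mA.
  have E : normal_law (dot (- u) 0) (dot (- u *m S) (- u)) A =
      normal_law (dot u 0) (dot (u *m S) u) A.
    by rewrite !dot0r mulNmx dotNl dotNr opprK.
  exact: etrans (gG (- u) A mA) (etrans E (esym (gG u A mA))).
have : \int[gamma]_x sin (dot (- u) x) = - \int[gamma]_x sin (dot u x).
  rewrite -mulN1r -RintegralZl//; last first.
    by apply: (bounded_integrable gT (B := 1)) => // x; exact: sin_max.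
  by apply: eq_Rintegral => x _; rewrite dotNl sinN mulN1r.
rewrite sin_sym => /eqP; rewrite -addr_eq0 -mulr2n mulrn_eq0 /= => /eqP ->//.
Qed.

Lemma compound_charfun1 (I : finType) (c : I -> {nonneg R}) (z : I -> V)
    (m : {measure set (borel V) -> \bar R}) (v : V) :
  (forall A, measurable A -> m A = compound_law c z A) ->
  charfun1 m v = cexp (\sum_i (c i)%:num%:C%C * (expi (dot v (z i)) - 1)).
Proof.
move=> mE; apply: eq_complexP; rewrite ?Re_charfun1 ?Im_charfun1.
  by rewrite (eq_measure_Rintegral _ mE) compound_law_cos.
by rewrite (eq_measure_Rintegral _ mE) compound_law_sin.
Qed.

(** Words of jumps in M have their sums in M, so every convolution power is carried by M. *)
Lemma compound_law_subspace (I : finType) (c : I -> {nonneg R}) (z : I -> V) (M : 'M[R]_n) :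
  (forall i, (z i <= M)%MS) -> compound_law c z (subspace_set M) = 1%E.
Proof.
move=> zM; rewrite -(compound_law_setT c z) /compound_law /mscale /=; congr (_ * _)%E.
rewrite /compound_series /mseries /=; apply: eq_eseriesr => k _; rewrite /mscale /=.
congr (_ * _)%E; rewrite /word_law !dirac_sumE; congr EFin; apply: eq_bigr => s _.
rewrite indicT indicE mem_set// /subspace_set /=.
by elim: k s => [|k IHk] s /=; [exact: sub0mx | rewrite addmx_sub].
Qed.

(** Each equation of M has variance 0 under S, so [normal_law] makes it a point mass at 0 and the
    equation holds almost surely; finitely many equations describe M. *)
Lemma gaussian_subspace (S M : 'M[R]_n) (gamma : probability (borel V) R) :
  gaussian_law 0 S gamma ->
  (forall u, (forall x, (x <= M)%MS -> dot u x = 0) -> dot (u *m S) u = 0) ->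
  gamma (subspace_set M) = 1%E.
Proof.
move=> gG S0.
have g0 j : {ae gamma, forall x : borel V, dot (col j (cokermx M))^T x = 0}.
  set u := (_)^T.
  have u0 : dot (u *m S) u = 0.
    apply: S0 => x; rewrite submx_dot => /fintype.forallP/(_ j)/eqP//.
  exists (~` (dot u @^-1` [set 0])); split => //.
    exact: measurableC (measurable_dot_preimage _ _).
  rewrite probability_setC; last exact: measurable_dot_preimage.
  rewrite [X in (_ - X)%E](_ : _ = 1%E) ?subee//.
  by rewrite gG// /normal_law u0 eqxx dot0r diracE mem_set.
have : {ae gamma, forall x : borel V, subspace_set M x}.
  have FF := ae_filter_ringOfSetsType gamma.
  apply: (@filterS _ _ FF _ _ _ (filter_forall FF g0)) => x x0; rewrite subspace_set_bigcap => j _; exact: x0.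
move/negligibleP => /(_ (measurableC (measurable_subspace_set M))).
rewrite [X in X = _ -> _](probability_setC gamma (measurable_subspace_set M)).
by case: (gamma _) => [r||]// -[] /subr0_eq <-.
Qed.

Context d (T : measurableType d) (P : probability T R).

Lemma independent_rv_pair_law d1 d2 (T1 : measurableType d1) (T2 : measurableType d2)
    (X : {RV P >-> T1}) (Z : {RV P >-> T2}) : independent_rv P X Z ->
  forall A, measurable A ->
    distribution P (rv_pair X Z) A = (distribution P X \x distribution P Z)%E A.
Proof.
by move=> XZ A mA; apply/esym; apply: product_measure_unique mA => B C mB mC; exact: XZ.
Qed.

Lemma independent_rv_shift (X Z : {RV P >-> borel V}) (a : V) :
  independent_rv P X Z -> independent_rv P X (rv_shift Z a).
Proof.
move=> XZ A B mA mB; apply: (XZ A ([set y | B ((y : V) + a)] : set (borel V))) => //.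
by rewrite -[X in measurable X]setTI; exact: measurable_addr.
Qed.

Lemma charfun_rv_pair (X Z : {RV P >-> borel V}) (u v : V) : independent_rv P X Z ->
  charfun (distribution P (rv_pair X Z)) u v =
  charfun1 (distribution P X) u * charfun1 (distribution P Z) v.
Proof.
move=> /independent_rv_pair_law XZ; rewrite -charfun_product.
by apply: eq_complexP; rewrite ?Re_charfun ?Im_charfun; exact: eq_measure_Rintegral.
Qed.

Lemma charfun1_shift (Z : {RV P >-> borel V}) (a v : V) :
  charfun1 (distribution P (rv_shift Z a)) v =
  charfun1 (distribution P Z) v * expi (dot v a).
Proof.
have PT := @probability_setT _ _ _ P.
have mc : measurable_fun setT (fun x : borel V => cos (dot v x)) by exact: measurable_cos_dot.
have ms : measurable_fun setT (fun x : borel V => sin (dot v x)) by exact: measurable_sin_dot.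
have ic : P.-integrable setT (EFin \o (fun t => cos (dot v (Z t)))).
  apply: (bounded_integrable PT (B := 1)) => [|t]; last exact: cos_max.
  by apply: (measurableT_comp mc).
have is_ : P.-integrable setT (EFin \o (fun t => sin (dot v (Z t)))).
  apply: (bounded_integrable PT (B := 1)) => [|t]; last exact: sin_max.
  by apply: (measurableT_comp ms).
have iZ (f : T -> R) (b : R) : P.-integrable setT (EFin \o f) ->
    P.-integrable setT (EFin \o (fun t => f t * b)).
  move=> /(@integrableZr _ _ _ P _ measurableT b); exact: eq_integrable.
apply: eq_complexP.
  rewrite ReM !Re_charfun1 Im_charfun1 expiE /=.
  rewrite !(@Rintegral_distribution _ _ _ _ _ P _ _ 1)//; try by move=> x; exact: cos_max || exact: sin_max.
  rewrite -!RintegralZr// -RintegralB//; [|exact: iZ..].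
  by apply: eq_Rintegral => t _; rewrite /rv_shift dotDr cosD.
rewrite ImM !Im_charfun1 Re_charfun1 expiE /=.
rewrite !(@Rintegral_distribution _ _ _ _ _ P _ _ 1)//; try by move=> x; exact: cos_max || exact: sin_max.
rewrite -!RintegralZr// -RintegralD//; [|exact: iZ..].
by apply: eq_Rintegral => t _; rewrite /rv_shift dotDr sinD addrC.
Qed.

End limit_laws.

Theorem proposition5p4 (R : realType) (Y : finType)
    (W : nat -> bool -> Y -> {nonneg R})
    (ya yb : bool -> Y) (p : bool -> R) (alpha : bool -> Y -> {nonneg R})
    (k : nat -> nat) (w : {i01 R})
    (W_sum1 : forall n b, (0 < n)%N -> \sum_y (W n b y)%:num = 1)
    (W_critical : two_dominant_critical ya yb p alpha W)
    (dominant_disjoint :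
       (dominant ya yb false :&: dominant ya yb true)%SET = finset.set0)
    (k_lt : forall n, (0 < n)%N -> (k n < n)%N)
    (k_prop : (k n)%:R / n%:R @[n --> \oo] --> w%:num)
    (d : measure_display) (T : measurableType d) (P : probability T R)
    (G J : {RV P >-> borel 'rV[R]_#|Y|})
    (G_gaussian : gaussian_law 0 (Sigma ya yb p w) (distribution P G))
    (J_compound_poisson : forall A, measurable A ->
       distribution P J A = compound_poisson (nu ya yb p alpha w) A)
    (GJ_independent : independent_rv P G J) :
  let M : 'M[R]_#|Y| := Mspace ya yb in
  let J' := rv_shift J (Delta ya yb p) in
  let Pn n := Slaw ya yb p (W n) n (k n) (k n) in
  let Qn n := Slaw ya yb p (W n) n (k n) (k n).+1 in
  let Poo := distribution P (rv_pair G J) in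
  let Qoo := distribution P (rv_pair G J') in
  (* the equivalent description of the law of J by independent Poisson
     variables, U false and U true being the families U and V *)
  (forall (d' : measure_display) (T' : measurableType d')
      (P' : probability T' R) (U : bool * Y -> {RV P' >-> nat}),
    mutually_independent_rv P' (nondominant ya yb) U ->
    (forall b y, y \notin dominant ya yb b -> forall A : set nat,
       distribution P' (U (b, y)) A
       = poisson_prob (rate alpha w b y)%:num 0 A) ->
    forall A, measurable A ->
      distribution P J A =
      P' [set t | A (\sum_(i | nondominant ya yb i)
                       (U i t)%:R *: jump ya yb p i.1 i.2)]) /\
  (* weak convergence *)
  (weak_cvg Pn Poo /\ weak_cvg Qn Qoo) /\
  (* convergence of the characteristic functions, and their limits *)
  (forall u v : 'rV[R]_#|Y|, (u <= M)%MS -> (v <= orthocomp M)%MS ->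
    [/\ charfun (Pn n) u v @[n --> \oo] --> charfun Poo u v,
        charfun (Qn n) u v @[n --> \oo] --> charfun Qoo u v,
        charfun Poo u v =
          cexp (- (2^-1 * dot (u *m Sigma ya yb p w) u)%:C%C +
                cintegral (nu ya yb p alpha w)
                  (fun z => expi (dot v z) - 1)) &
        charfun Qoo u v =
          charfun Poo u v * expi (dot v (Delta ya yb p))]) /\
  (* the limits are products of a Gaussian law on M, common to both, and of a
     law on the orthogonal complement of M *)
  [/\ distribution P G (subspace_set M) = 1%E,
      distribution P J (subspace_set (orthocomp M)) = 1%E,
      distribution P J' (subspace_set (orthocomp M)) = 1%E,
      forall A, measurable A ->
        Poo A = (distribution P G \x distribution P J)%E A &
      forall A, measurable A ->
        Qoo A = (distribution P G \x distribution P J')%E A].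
Proof.
move=> M J' Pn Qn Poo Qoo.
(* Dominant messages keep an index but get rate 0. *)
pose c := restrict_rate (nondominant ya yb) (fun i => rate alpha w i.1 i.2).
pose z i := jump ya yb p i.1 i.2.
have JE A : measurable A -> distribution P J A = compound_law c z A.
  move=> mA; rewrite J_compound_poisson// /nu.
  rewrite (dirac_sum_restrict (nondominant ya yb) (fun i => rate alpha w i.1 i.2) z).
  exact: compound_poissonE.
have cfE (u v : 'rV[R]_#|Y|) :
    charfun1 (distribution P G) u * charfun1 (distribution P J) v =
    cexp (limit_exponent ya yb p alpha w u v).
  rewrite (gaussian_charfun1 G_gaussian); last first.
    rewrite dot_Sigma sumr_ge0// => b _; rewrite mulr_ge0//.
    have [_ /andP[/ltW p0 /ltW p1] _ _ _] := W_critical b.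
    by apply: mulr_ge0 (sqr_ge0 _); rewrite mulr_ge0// subr_ge0.
  rewrite (compound_charfun1 _ JE) /limit_exponent cexpD; congr (_ * _).
    by rewrite /cexp /= cos0 sin0 mulr1 mulr0.
  congr cexp; rewrite [RHS]big_mkcond; apply: eq_bigr => i _ /=.
  by rewrite /c /restrict_rate; case: ifP => // _; rewrite mul0r.
have GJ' : independent_rv P G J' by exact: independent_rv_shift.
have PooE u v : charfun Poo u v = cexp (limit_exponent ya yb p alpha w u v).
  by rewrite charfun_rv_pair.
have QooE u v : charfun Qoo u v = charfun Poo u v * expi (dot v (Delta ya yb p)).
  by rewrite PooE charfun_rv_pair// charfun1_shift mulrA cfE.
(* Both limits are put in the form of [weak_cvg_Slaw], with m = 0 here and m = 1 in [QnE]. *)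
have PnE (u v : 'rV[R]_#|Y|) : charfun Poo u v =
    expi (0%:R * dot v (Delta ya yb p)) * cexp (limit_exponent ya yb p alpha w u v).
  by rewrite mul0r expi0 mul1r.
have QnE (u v : 'rV[R]_#|Y|) : charfun Qoo u v =
    expi (1%:R * dot v (Delta ya yb p)) * cexp (limit_exponent ya yb p alpha w u v).
  by rewrite mul1r mulrC QooE PooE.
have k_le n : (0 < n)%N -> (k n <= n)%N by move=> /k_lt/ltnW.
have kE n : k n = (k n + 0)%N by rewrite addn0.
have k1E n : (k n).+1 = (k n + 1)%N by rewrite addn1.
have JM : distribution P J (subspace_set (orthocomp M)) = 1%E.
  rewrite JE; last exact: measurable_subspace_set.
  by apply: compound_law_subspace => i; exact: jump_orthocomp.
split=> [d' T' P' U indU lawU A mA|].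
  rewrite JE//; apply: poisson_family_law => // -[b y] /=; exact: lawU.
split.
  split.
    apply: (weak_cvg_Slaw W_sum1 W_critical k_prop k_le kE _ PnE).
    exact: probability_setT.
  (* [k_lt] is by definition k + 1 <= n, so the neighbouring dataset has at most n users with input
     1. *)
  apply: (weak_cvg_Slaw W_sum1 W_critical k_prop k_lt k1E _ QnE).
  exact: probability_setT.
split.
  move=> u v _ _; split => //.
  - rewrite PnE; exact: (@cvg_charfun_Slaw _ _ _ _ _ _ _ _ _ W_sum1 W_critical k_prop _ _ k_le kE).
  - rewrite QnE; exact: (@cvg_charfun_Slaw _ _ _ _ _ _ _ _ _ W_sum1 W_critical k_prop _ _ k_lt k1E).
  rewrite PooE /limit_exponent rmorphN; congr (cexp (_ + _)).
  apply/esym; apply: (@cintegral_dirac_sum R _ (nondominant ya yb)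
    (fun i => rate alpha w i.1 i.2) _ (borel 'rV[R]_#|Y|) z (fun x => expi (dot v x) - 1)).
    rewrite (_ : (fun x => _) = fun x => cos (dot v x) - 1); last first.
      by apply/funext => x; rewrite expiE.
    by apply: measurable_funB => //; exact: measurable_cos_dot.
  rewrite (_ : (fun x => _) = fun x => sin (dot v x)); last first.
    by apply/funext => x; rewrite expiE ImB /= subr0.
  exact: measurable_sin_dot.
split => //.
- apply: (gaussian_subspace G_gaussian) => u uM.
  rewrite dot_Sigma big1// => b _; rewrite uM ?expr0n ?mulr0//.
  by case: b; [exact: addsmxSr|exact: addsmxSl].
- rewrite -[RHS]JM /distribution /pushforward; congr (P _).
  (* [Delta] lies in the complement, so translation by it preserves membership in both
     directions. *)
  apply/seteqP; split => t; rewrite /subspace_set /=.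
    move=> H; rewrite -[J t : 'rV_ _](addrK (Delta ya yb p)).
    by rewrite addmx_sub// eqmx_opp Delta_orthocomp.
  by move=> H; rewrite addmx_sub// Delta_orthocomp.
- exact: independent_rv_pair_law.
- exact: independent_rv_pair_law.
Qed.
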